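(* Let $d\ge2$. (i) Let $E\subset[0,1]^d$ be compact, and suppose that $K\subset\mathbb{R}^d$ is a convex polyhedron symmetric about the origin (with non-empty interior) and that the Hausdorff dimension of $E$ is greater than $1$. Then $\Delta_K(\rho E)$ has positive Lebesgue measure for almost every $\rho\in SO(d)$. Moreover, this is sharp in the following sense: for every $0\le\alpha<1$ there exists a compact set $E\subset[0,1]^d$ of Hausdorff dimension $\alpha$ such that $\Delta_K(E)$ has Lebesgue measure $0$ for every bounded convex body $K\subset\mathbb{R}^d$ symmetric about the origin. (ii) Let $E\subset[0,1]^d$ be compact, let $K\subset\mathbb{R}^d$ be any bounded convex body symmetric about the origin, and suppose that the Hausdorff dimension of $E$ is greater than $\frac{d+1}{2}$. Then $\Delta_K(\rho E)$ has positive Lebesgue measure for almost every $\rho\in SO(d)$. (iii) Suppose that $E\subset\mathbb{R}^d$ is a compact radial set, i.e. $E=\{r\omega:\omega\in S^{d-1},\ r\in E_0\}$ for some $E_0\subset[0,1]$, and that the Hausdorff dimension of $E$ is greater than $\frac{d+1}{2}$. Let $K\subset\mathbb{R}^d$ be any bounded convex body symmetric about the origin. Then $\Delta_K(E)$ has positive Lebesgue measure.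
   Context: A convex body has non-empty interior. For a bounded convex set $K\subset\mathbb{R}^d$, symmetric about the origin and with non-empty interior, $\|\cdot\|_K$ is the norm induced by $K$ (the norm whose unit ball is $K$, up to boundary points). The $K$-distance set of $E\subset\mathbb{R}^d$ is $\Delta_K(E)=\{\|x-y\|_K: x,y\in E\}\subset[0,\infty)$; ''Lebesgue measure'' of $\Delta_K(E)$ means one-dimensional Lebesgue measure. ''Almost every $\rho\in SO(d)$'' is with respect to Haar measure, and $\rho E=\{\rho x:x\in E\}$. *)

(* Defs.v *)
From HB Require Import structures.
From mathcomp Require Import all_boot all_order all_algebra.
From mathcomp Require Import all_classical all_reals all_analysis.

Set Implicit Arguments.
Unset Strict Implicit.
Unset Printing Implicit Defensive.

Import Order.TTheory GRing.Theory Num.Theory.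
Import numFieldNormedType.Exports.

Local Open Scope classical_set_scope.
Local Open Scope ring_scope.

(* R^d is the space 'cV[R]_d of column vectors.  The canonical norm of
   mathcomp-analysis on matrices is the sup norm; it is used only through the
   notions it induces (compact, interior, bounded, open), which are the
   Euclidean ones.  Metric notions use the Euclidean norm [enorm]. *)
Section Euclidean.
Context {R : realType} {d : nat}.
Implicit Types (x y w : 'cV[R]_d) (E U : set 'cV[R]_d).

Definition dot x y : R := \sum_i x i ord0 * y i ord0.

Definition enorm x : R := Num.sqrt (dot x x).

Definition unit_sphere : set 'cV[R]_d := [set w | enorm w = 1].

Definition unit_cube : set 'cV[R]_d :=
  [set x | forall i, 0 <= x i ord0 <= 1].

(* Equal to -oo on the empty set. *)
Definition diam U : \bar R :=
  ereal_sup [set (enorm (x - y))%:E | x in U & y in U].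

(* The case split makes empty sets in a cover cost nothing also when s = 0,
   where poweR gives x `^ 0 = 1 for every x. *)
Definition diam_pow (s : R) U : \bar R :=
  if U == set0 then 0%E else poweR (diam U) s.

Definition hausdorff_content (s delta : R) E : \bar R :=
  ereal_inf [set (\sum_(0 <= i <oo) diam_pow s (U i))%E | U in
    [set U : nat -> set 'cV[R]_d | E `<=` \bigcup_i U i /\
                                   forall i, (diam (U i) <= delta%:E)%E]].

(* The content is nonincreasing in delta, so this supremum is its limit as
   delta tends to 0. *)
Definition hausdorff_measure (s : R) E : \bar R :=
  ereal_sup [set hausdorff_content s delta E | delta in [set t : R | 0 < t]].

Definition hausdorff_dim E : \bar R :=
  ereal_inf [set s%:E | s in
    [set s : R | 0 <= s /\ hausdorff_measure s E = 0%E]].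

End Euclidean.

Section ConvexBodies.
Context {R : realType} {d : nat}.
Implicit Types (K E : set 'cV[R]_d).

(* K is not assumed closed: the induced norm does not see the boundary. *)
Definition convex_body K : Prop :=
  [/\ convex_set (K : set (convex_lmodType 'cV[R]_d)),
      bounded_set K & K° !=set0].

Definition origin_symmetric K : Prop := forall x, K x -> K (- x).

Definition polyhedron K : Prop :=
  exists (n : nat) (a : 'I_n -> 'cV[R]_d) (b : 'I_n -> R),
    K = [set x | forall i, dot (a i) x <= b i].

Definition body_norm K (x : 'cV[R]_d) : R :=
  inf [set t : R | 0 < t /\ exists2 y, K y & x = t *: y].

Definition distance_set K E : set R :=
  [set body_norm K (x - y) | x in E & y in E].

End ConvexBodies.

Section Rotations.
Context (R : realType) (d : nat).

Definition SO : set 'M[R]_d :=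
  [set rho | rho^T *m rho = 1%:M /\ \det rho = 1].

Definition rotate (rho : 'M[R]_d) (E : set 'cV[R]_d) : set 'cV[R]_d :=
  [set rho *m x | x in E].

Definition borel_mx := g_sigma_algebraType (@open 'M[R]_d).

(* Normalized Haar measure of the compact group SO(d), seen as a Borel
   probability measure on the space of matrices that is carried by SO(d). *)
Definition is_haar_SO (mu : probability borel_mx R) : Prop :=
  mu SO = 1%E /\
  forall (g : 'M[R]_d) (A : set borel_mx), SO g -> measurable A ->
    mu [set g *m (x : 'M[R]_d) | x in A] = mu A.

(* By uniqueness of Haar measure, [mu] ranges over a single measure. *)
Definition almost_every_rotation (P : 'M[R]_d -> Prop) : Prop :=
  forall mu : probability borel_mx R, is_haar_SO mu ->
    {ae mu, forall rho : borel_mx, SO rho -> P rho}.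

End Rotations.

(* Main.v *)
Require Import Defs.
From mathcomp Require Import all_boot all_order all_algebra.
From mathcomp Require Import all_classical all_reals all_analysis.
From mathcomp Require Import measurable_realfun.
From mathcomp Require Import ring lra zify.
From mathcomp Require complex.
Import Order.TTheory GRing.Theory Num.Theory.
Import numFieldNormedType.Exports.
Local Open Scope classical_set_scope.
Local Open Scope ring_scope.

Set Implicit Arguments.
Unset Strict Implicit.
Unset Printing Implicit Defensive.

(* At each scale delta, E carries finitely many weighted points satisfying a
   Frostman condition.  If the weighted number nu(t) of pairs at rotated distance
   within delta of t has mean square O(delta^2) over t and over the rotations, then
   by Cauchy-Schwarz the distances meet a number of order 1/delta of delta-intervals
   and, by Fatou's lemma and compactness, the distance set has positive measure for
   almost every rotation.

   (i) The norm of a polyhedron is a maximum of finitely many linear forms, and a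
   linear form of a rotated vector v is O(delta) with probability O(delta / |v|).
   For the sharpness, put a Cantor set of dimension alpha with k intervals of
   length r at each step, 2 k r < 1, on an axis: its differences are covered by
   (2 k)^n intervals of length 2 r^n.

   (ii) With M = 1/delta and finitely many u_i spread over the boundary of K, nu(t)
   is dominated by sums of cosines over frequencies xi of size at most M: the squared
   transform A(xi) of the weights against the exponential sum over the points
   t rho^T u_i.  Cauchy-Schwarz with the weight |xi|^(-(d-1)/2) separates the energy
   of E of dimension (d+1)/2 from the mean over t and rho of the squared
   exponential sum.  The latter decays like |xi|^(-(d-1)): its mean over rotations
   is radial, so the mean over t can be replaced by a sum over lattice points of a
   cube, where Fejer kernels are available.

   (iii) A radial set with a point x != 0 contains the sphere through x, whose
   difference set contains a segment. *)

(** * Euclidean space *)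

(** For a general [K] the boundary has neither smoothness nor curvature, so an exponential sum over
    it need not decay in a given direction. What survives is its mean square over rotations and
    dilations, for which it is enough that the boundary is (d-1)-dimensional at every scale. Since
    only the length of a frequency matters after averaging, one frequency may be replaced by many
    points of the same sphere; a grid lifted to spheres of consecutive integer radii rounds to
    distinct lattice points, and over a whole lattice cube the mean square reduces to a count of
    close pairs. The weight W = |xi|^(-(d-1)/2) balances Cauchy-Schwarz: the squared exponential sum
    S^2 has mean O(W^2), so the sum of A S^2 / W has mean O(sum of A W), which is the other factor
    again. Over dyadic shells that energy is a geometric series of ratio 2^((d+1)/2 - s), hence the
    threshold; for polyhedra the ratio is 2^(1-s). Every scale is finite: point masses, grids and
    trigonometric sums replace measures and Fourier transforms, and integrals are taken only against
    Haar measure. *)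

Section EuclideanNorm.
Context {R : realType} {d : nat}.
Implicit Types (x y z : 'cV[R]_d) (a b : R).

Lemma dotC x y : dot x y = dot y x.
Proof. by apply: eq_bigr => i _; rewrite mulrC. Qed.

Lemma dotDl x y z : dot (x + y) z = dot x z + dot y z.
Proof. by rewrite -big_split; apply: eq_bigr => i _; rewrite mxE mulrDl. Qed.

Lemma dotZl a x y : dot (a *: x) y = a * dot x y.
Proof. by rewrite mulr_sumr; apply: eq_bigr => i _; rewrite mxE mulrA. Qed.

Lemma dotDr x y z : dot z (x + y) = dot z x + dot z y.
Proof. by rewrite dotC dotDl !(dotC z). Qed.

Lemma dotZr a x y : dot x (a *: y) = a * dot x y.
Proof. by rewrite dotC dotZl dotC. Qed.

Lemma dotNl x y : dot (- x) y = - dot x y.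
Proof. by rewrite -scaleN1r dotZl mulN1r. Qed.

Lemma dotNr x y : dot x (- y) = - dot x y.
Proof. by rewrite dotC dotNl dotC. Qed.

Lemma dotBl x y z : dot (x - y) z = dot x z - dot y z.
Proof. by rewrite dotDl dotNl. Qed.

Lemma dotBr x y z : dot z (x - y) = dot z x - dot z y.
Proof. by rewrite dotDr dotNr. Qed.

Lemma dot0l y : dot 0 y = 0.
Proof. by rewrite -(scale0r (0 : 'cV[R]_d)) dotZl mul0r. Qed.

Lemma dotxx_ge0 x : 0 <= dot x x.
Proof. by apply: sumr_ge0 => i _; rewrite -expr2 sqr_ge0. Qed.

Lemma dotxx_eq0 x : (dot x x == 0) = (x == 0).
Proof.
apply/eqP/eqP => [h|->]; last by rewrite dot0l.
apply/matrixP => i j; rewrite ord1 mxE; apply/eqP.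
have /psumr_eq0P : \sum_i x i ord0 * x i ord0 = 0 by [].
move=> /(_ _ i isT) e; rewrite -sqrf_eq0 expr2 e // => k _.
by rewrite -expr2 sqr_ge0.
Qed.

Lemma enorm_ge0 x : 0 <= enorm x.
Proof. exact: sqrtr_ge0. Qed.

Lemma sqr_enorm x : enorm x ^+ 2 = dot x x.
Proof. by rewrite sqr_sqrtr // dotxx_ge0. Qed.

Lemma enorm_eq0 x : (enorm x == 0) = (x == 0).
Proof. by rewrite -dotxx_eq0 -sqr_enorm sqrf_eq0. Qed.

Lemma enorm0 : enorm (0 : 'cV[R]_d) = 0.
Proof. by apply/eqP; rewrite enorm_eq0. Qed.

Lemma enorm_gt0 x : (0 < enorm x) = (x != 0).
Proof. by rewrite lt0r enorm_ge0 andbT enorm_eq0. Qed.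

Lemma enormN x : enorm (- x) = enorm x.
Proof. by rewrite /enorm dotNl dotNr opprK. Qed.

Lemma enormZ a x : enorm (a *: x) = `|a| * enorm x.
Proof.
by rewrite /enorm dotZl dotZr mulrA -expr2 sqrtrM ?sqr_ge0 // sqrtr_sqr.
Qed.

Lemma enormB x y : enorm (x - y) = enorm (y - x).
Proof. by rewrite -opprB enormN. Qed.

Lemma cauchy_schwarz_dot x y : `|dot x y| <= enorm x * enorm y.
Proof.
rewrite -ler_sqr ?nnegrE ?normr_ge0 ?mulr_ge0 ?enorm_ge0 // real_normK ?num_real //.
rewrite exprMn !sqr_enorm.
have [->|y0] := eqVneq y 0; first by rewrite dotC !dot0l mulr0 expr0n.
have yy : 0 < dot y y by rewrite lt0r dotxx_ge0 dotxx_eq0 y0.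
have := dotxx_ge0 (dot y y *: x - dot x y *: y).
rewrite !dotBl !dotBr !dotZl !dotZr (dotC y x) => h.
rewrite -subr_ge0 -(pmulr_rge0 _ yy).
apply: le_trans h _; lra.
Qed.

Lemma ler_enormD x y : enorm (x + y) <= enorm x + enorm y.
Proof.
rewrite -ler_sqr ?nnegrE ?addr_ge0 ?enorm_ge0 // sqrrD !sqr_enorm.
rewrite dotDl !dotDr (dotC y x).
have := le_trans (ler_norm _) (cauchy_schwarz_dot x y); lra.
Qed.

Lemma ler_enormB x y : enorm (x - y) <= enorm x + enorm y.
Proof. by rewrite -(enormN y) ler_enormD. Qed.

Lemma enorm_dist3 x y z : enorm (x - z) <= enorm (x - y) + enorm (y - z).
Proof. by rewrite -[x - z](subrKA y) ler_enormD. Qed.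

Lemma coord_le_enorm x i : `|x i ord0| <= enorm x.
Proof.
rewrite -ler_sqr ?nnegrE ?normr_ge0 ?enorm_ge0 // sqr_enorm real_normK ?num_real //.
rewrite /dot (bigD1 i) //= -expr2 lerDl; apply: sumr_ge0 => j _.
by rewrite -expr2 sqr_ge0.
Qed.

Lemma enorm_le_coord x (r : R) : 0 <= r ->
  (forall i, `|x i ord0| <= r) -> enorm x <= d%:R * r.
Proof.
move=> r0 xr; rewrite -ler_sqr ?nnegrE ?enorm_ge0 ?mulr_ge0 // sqr_enorm.
apply: (@le_trans _ _ (\sum_(i < d) r ^+ 2)).
  apply: ler_sum => i _; rewrite -expr2 -(real_normK (num_real _)).
  by rewrite ler_sqr ?nnegrE.
rewrite sumr_const card_ord exprMn -[leLHS]mulr_natl ler_wpM2r ?sqr_ge0 //.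
rewrite expr2 -natrM ler_nat; nia.
Qed.

Lemma dot_mulmx (A : 'M[R]_d) x y : dot (A *m x) y = dot x (A^T *m y).
Proof.
have E (u v : 'cV[R]_d) : dot u v = (u^T *m v) ord0 ord0.
  by rewrite mxE; apply: eq_bigr => i _; rewrite mxE.
by rewrite !E trmx_mul mulmxA.
Qed.

Lemma enorm_le_norm x : enorm x <= d%:R * `|x|.
Proof.
apply: enorm_le_coord => // i.
by rewrite [leRHS]/Num.Def.normr /= mx_normrE; apply/bigmax_geP; right => /=; exists (i, ord0).
Qed.

Lemma norm_le_enorm x : `|x| <= enorm x.
Proof.
rewrite [leLHS]/Num.Def.normr /= mx_normrE bigmax_le ?enorm_ge0 // => -[i j] _ /=.
by rewrite ord1 coord_le_enorm.
Qed.

End EuclideanNorm.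

(** * Averages over rotations *)

Section HaarMeasure.
Context {R : realType} {d : nat}.
Notation mxT := (borel_mx R d).
Local Notation SO := (@SO R d).

Lemma measurable_open_mx (U : set mxT) : open (U : set 'M[R]_d) -> measurable U.
Proof. exact: sub_sigma_algebra. Qed.

Lemma measurable_entry i j : measurable_fun setT (fun rho : mxT => (rho : 'M[R]_d) i j).
Proof.
apply: (measurability _ (RGenOpens.measurableE R)).
move=> _ [_ [a [b ->]] <-]; rewrite setTI; apply: measurable_open_mx.
apply: open_comp => [x _|]; first exact: coord_continuous.
exact: interval_open.
Qed.

Lemma measurable_dot_rot (x y : 'cV[R]_d) :
  measurable_fun setT (fun rho : mxT => dot ((rho : 'M[R]_d) *m x) y).
Proof.
apply: measurable_sum => i; apply: measurable_funM => //.
under eq_fun do rewrite mxE.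
by apply: measurable_sum => j; apply: measurable_funM => //; exact: measurable_entry.
Qed.

Lemma measurable_SO : measurable (SO : set mxT).
Proof.
have -> : (SO : set mxT) =
    (\bigcap_(i in [set: 'I_d]) \bigcap_(j in [set: 'I_d])
       ((fun rho : mxT => ((rho : 'M[R]_d)^T *m rho) i j) @^-1` [set (1%:M : 'M[R]_d) i j]))
    `&` ((fun rho : mxT => \det (rho : 'M[R]_d)) @^-1` [set 1]).
  apply/seteqP; split => [rho [e1 e2]|rho [e1 e2]].
    by split => // i _ j _ /=; rewrite e1.
  by split => //; apply/matrixP => i j; exact: e1.
apply: measurableI.
  apply: fin_bigcap_measurable => // i _; apply: fin_bigcap_measurable => // j _.
  rewrite -[_ @^-1` _]setTI; apply: (_ : measurable_fun setT _) => //.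
  under eq_fun do rewrite mxE.
  apply: measurable_sum => k; apply: measurable_funM; last exact: measurable_entry.
  under eq_fun do rewrite mxE; exact: measurable_entry.
rewrite -[_ @^-1` _]setTI; apply: (_ : measurable_fun setT _) => //.
apply: measurable_sum => s; apply: measurable_funM => //.
by apply: measurable_prod => i _; exact: measurable_entry.
Qed.

Lemma SO_mul (g h : 'M[R]_d) : SO g -> SO h -> SO (g *m h).
Proof.
move=> [g1 g2] [h1 h2]; split; last by rewrite det_mulmx g2 h2 mulr1.
by rewrite trmx_mul -mulmxA (mulmxA g^T) g1 mul1mx.
Qed.

Lemma SO_trK (g : 'M[R]_d) : SO g -> g *m g^T = 1%:M.
Proof. by move=> [/mulmx1C]. Qed.

Lemma SO_tr (g : 'M[R]_d) : SO g -> SO g^T.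
Proof. by move=> sg; split; [rewrite trmxK SO_trK | rewrite det_tr; case: sg]. Qed.

Lemma SO_dot (g : 'M[R]_d) x y : SO g -> dot (g *m x) (g *m y) = dot x y.
Proof. by move=> [g1 _]; rewrite dot_mulmx mulmxA g1 mul1mx. Qed.

Lemma SO_enorm (g : 'M[R]_d) x : SO g -> enorm (g *m x) = enorm x.
Proof. by move=> sg; rewrite /enorm SO_dot. Qed.

Lemma mulmx_continuous (g : 'M[R]_d) : continuous (fun x : 'M[R]_d => g *m x).
Proof.
move=> x; apply/(@cvgrPdist_lt R 'M[R]_d 'M[R]_d (nbhs x) _ (fun y => g *m y) (g *m x)) => e e0.
pose C := 1 + \sum_i \sum_k `|g i k|.
have C0 : 0 < C by rewrite ltr_pwDl // sumr_ge0 // => i _; rewrite sumr_ge0.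
near=> y.
rewrite -mulmxBr [ltLHS]/Num.Def.normr /= mx_normrE.
apply: (@le_lt_trans _ _ (C * `|x - y|)); last first.
  by rewrite mulrC -ltr_pdivlMr //; near: y; apply: cvgr_dist_lt; rewrite ?divr_gt0.
apply: bigmax_le => [|[i j] _ /=]; first by rewrite mulr_ge0 // ltW.
rewrite mxE; apply: le_trans (ler_norm_sum _ _ _) _.
apply: (@le_trans _ _ (\sum_k (`|g i k| * `|x - y|))).
  apply: ler_sum => k _; rewrite normrM ler_wpM2l //.
  rewrite [leRHS]/Num.Def.normr /= mx_normrE; apply/bigmax_geP; right => /=.
  by exists (k, j).
rewrite -mulr_suml ler_wpM2r //.
apply: (@le_trans _ _ (\sum_i \sum_k `|g i k|)); last by rewrite lerDr.
by rewrite [leRHS](bigD1 i) //= lerDl sumr_ge0 // => l _; rewrite sumr_ge0.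
Unshelve. all: by end_near. Qed.

Lemma measurable_mulmx_left (g : 'M[R]_d) :
  measurable_fun setT (fun rho : mxT => (g *m (rho : 'M[R]_d)) : mxT).
Proof.
apply: (measurability _ (erefl : @measurable _ mxT = <<s open >>)).
move=> _ [U oU <-]; rewrite setTI; apply: measurable_open_mx.
by apply: open_comp => // x _; exact: mulmx_continuous.
Qed.

Variable mu : probability mxT R.
Hypothesis haar_mu : is_haar_SO mu.

Definition rot_mean (f : 'M[R]_d -> R) : \bar R := (\int[mu]_(rho in (SO : set mxT)) (f rho)%:E)%E.

Lemma rot_mean_translate (g : 'M[R]_d) (f : 'M[R]_d -> R) : SO g ->
  measurable_fun setT (f : mxT -> R) -> (forall rho, 0 <= f rho) ->
  rot_mean (fun rho => f (g *m rho)) = rot_mean f.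
Proof.
move=> sg mf f0.
pose phi : mxT -> mxT := fun rho => g *m (rho : 'M[R]_d).
have mphi : measurable_fun setT phi by exact: measurable_mulmx_left.
(* Invariance is stated for images; the preimage under translation by [g] is the image under its
   inverse [g^T]. *)
have EphiA (A : set mxT) : phi @^-1` A = [set g^T *m (x : 'M[R]_d) | x in A].
  apply/seteqP; split => [x Ax|_ [x Ax <-]] /=.
    by exists (phi x) => //; rewrite /phi mulmxA (proj1 sg) mul1mx.
  by rewrite /phi mulmxA SO_trK // mul1mx.
have ESO : phi @^-1` SO = SO.
  apply/seteqP; split => [x sx|x sx] /=; last exact: SO_mul.
  by rewrite -[x](mul1mx) -(proj1 sg) -mulmxA; apply: SO_mul => //; exact: SO_tr.
have := ge0_integral_pushforward mphi mu measurable_SO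
  (measurable_funTS (proj2 (measurable_EFinP _ _) mf)) (fun y _ => f0 y).
move=> E; transitivity (\int[mu]_(x in phi @^-1` SO) ((EFin \o f) \o phi) x)%E.
  by rewrite ESO.
rewrite -E; apply: eq_measure_integral => A mA _.
transitivity (mu (phi @^-1` A)); first by [].
by rewrite EphiA (proj2 haar_mu) //; exact: SO_tr.
Qed.

(** By Fatou's lemma the lower limit of [Phi n] has finite mean, so it is finite for almost every
    rotation, and [Phi n rho] lies below that limit plus one for infinitely many [n]. The bound [L]
    may depend on [rho]. *)
Lemma ae_rotation_liminf (Phi : nat -> 'M[R]_d -> R) (C : R) (P : 'M[R]_d -> Prop) :
  (forall n, measurable_fun setT (Phi n : mxT -> R)) -> (forall n rho, 0 <= Phi n rho) ->
  (forall n, (rot_mean (Phi n) <= C%:E)%E) ->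
  (forall rho, SO rho -> forall L, (forall m, exists2 n, (m <= n)%N & Phi n rho <= L) -> P rho) ->
  {ae mu, forall rho : mxT, SO rho -> P rho}.
Proof.
move=> mPhi Phi0 PhiC PhiP.
pose F rho := limn_einf (fun n => (Phi n rho)%:E).
have mF : measurable_fun (SO : set mxT) F.
  apply: measurableT_comp => //.
  apply: measurable_fun_limn_esup => n.
  apply: measurableT_comp => //; apply: measurable_funTS; exact/measurable_EFinP.
have F0 rho : (0 <= F rho)%E.
  by rewrite /F limn_einf_lim; apply: lime_ge; [exact: is_cvg_einfs|];
    apply: nearW => n; apply: le_ereal_inf_tmp => _ [m _ <-]; rewrite lee_fin.
have iF : mu.-integrable (SO : set mxT) F.
  apply/integrableP; split => //.
  under eq_integral do rewrite gee0_abs ?F0 //.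
  apply: le_lt_trans (fatou _ _ _ _) _ => //=.
  - exact: measurable_SO.
  - by move=> n; apply: measurable_funTS; exact/measurable_EFinP.
  - by move=> n x _; rewrite lee_fin.
  apply: (@le_lt_trans _ _ C%:E); last exact: ltry.
  rewrite limn_einf_lim; apply: lime_le; first exact: is_cvg_einfs.
  apply: nearW => n; apply: le_trans (PhiC n).
  by apply: ereal_inf_lbound; exists n => /=.
have := integrable_ae measurable_SO iF.
apply: filterS => rho fin /[dup] srho /fin Frho.
pose L := fine (F rho) + 1.
apply: (PhiP _ srho L) => m; apply: contrapT => noex.
have : (L%:E <= F rho)%E.
  rewrite /F limn_einf_lim; apply: lime_ge; first exact: is_cvg_einfs.
  exists m => // n /= mn; apply: le_ereal_inf_tmp => _ [k nk <-].
  rewrite lee_fin leNgt; apply/negP => lt; apply: noex; exists k; last exact: ltW.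
  exact: leq_trans nk.
by rewrite -(fineK Frho) lee_fin /L gerDl ler10.
Qed.

End HaarMeasure.

(** * Householder reflections and transitivity of SO(d) on spheres *)

Section Reflections.
Context {R : realType} {d : nat}.
Implicit Types (x y u v w : 'cV[R]_d).

Definition basis_vec (i : 'I_d) : 'cV[R]_d := delta_mx i ord0.

Lemma dot_basis_vec i x : dot (basis_vec i) x = x i ord0.
Proof.
rewrite /dot (bigD1 i) //= mxE !eqxx mul1r big1 ?addr0 // => j ji.
by rewrite mxE (negbTE ji) mul0r.
Qed.

Lemma enorm_basis_vec i : enorm (basis_vec i) = 1.
Proof. by rewrite /enorm dot_basis_vec mxE !eqxx sqrtr1. Qed.

Definition householder u : 'M[R]_d := 1%:M - (2 / dot u u) *: (u *m u^T).

Lemma mulmx_trdot u x : u^T *m x = (dot u x)%:M.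
Proof.
apply/matrixP => i j; rewrite !ord1 !mxE eqxx mulr1n.
by apply: eq_bigr => k _; rewrite mxE.
Qed.

Lemma householderE u x : householder u *m x = x - (2 * dot u x / dot u u) *: u.
Proof.
rewrite /householder mulmxBl mul1mx -scalemxAl -mulmxA mulmx_trdot.
by rewrite mul_mx_scalar scalerA mulrAC.
Qed.

Lemma householder_tr u : (householder u)^T = householder u.
Proof. by rewrite /householder linearB /= trmx1 linearZ /= trmx_mul trmxK. Qed.

Lemma householder_sqr u : u != 0 -> householder u *m householder u = 1%:M.
Proof.
rewrite -dotxx_eq0 => u0.
rewrite {2}/householder mulmxBr mulmx1 -scalemxAr mulmxA householderE.
rewrite -[2 * dot u u / dot u u]mulrA divff // mulr1.
rewrite /householder mulmxBl -scalemxAl -addrA -opprD -scalerDr.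
have -> : u *m u^T + (u *m u^T - 2 *: (u *m u^T)) = 0 by rewrite scaler_nat mulr2n addrA subrr.
by rewrite scaler0 subr0.
Qed.

Lemma householder_scale c u : c != 0 -> householder (c *: u) = householder u.
Proof.
move=> c0; rewrite /householder; congr (_ - _).
rewrite linearZ /= -scalemxAl -scalemxAr !scalerA dotZl dotZr; congr (_ *: _).
have [->|u0] := eqVneq (dot u u) 0; first by rewrite !mulr0 invr0 mulr0 !mul0r.
by field; rewrite c0 u0.
Qed.

Lemma householder_swap u v : u != v -> enorm u = enorm v ->
  householder (u - v) *m v = u.
Proof.
move=> uv euv; have : dot u u = dot v v by rewrite -!sqr_enorm euv.
move=> duv; rewrite householderE !dotBl !dotBr (dotC v u) duv.
have n0 : dot v v - dot u v != 0.
  have := uv; rewrite -subr_eq0 -dotxx_eq0 dotBl !dotBr (dotC v u) duv; apply: contra.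
  by move=> /eqP; lra.
have -> : 2 * (dot u v - dot v v) / (dot v v - dot u v - (dot u v - dot v v)) = -1.
  by field; move: n0; apply: contra => /eqP h; apply/eqP; lra.
by rewrite scaleN1r opprK addrC subrK.
Qed.

Lemma det_householder_basis i : \det (householder (basis_vec i)) = -1.
Proof.
have -> : householder (basis_vec i) = diag_mx (\row_j (if j == i then -1 else 1)).
  apply/matrixP => j k; rewrite /householder dot_basis_vec !mxE !eqxx divr1 big_ord1 !mxE.
  rewrite !andbT; have [->|jk] := eqVneq j k; last first.
    have [ji|ji] := eqVneq j i; last by rewrite mul0r mulr0 subr0.
    by rewrite -ji eq_sym (negbTE jk) !mulr0 subr0.
  by have [ki|ki] := eqVneq k i; rewrite /= !mulr1n; ring.
rewrite det_diag (bigD1 i) //= mxE eqxx big1 ?mulr1 // => j ji.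
by rewrite mxE (negbTE ji).
Qed.

(** The reflection exchanging [u] with a multiple of a basis vector of the same length conjugates
    one reflection into the other, which reduces the determinant to that of a diagonal matrix. *)
Lemma det_householder u : u != 0 -> \det (householder u) = -1.
Proof.
move=> u0; have [i _] : exists i : 'I_d, u i ord0 != 0.
  apply/existsP; apply: contraR u0 => /existsPn h; apply/eqP/matrixP => i j.
  by rewrite ord1 mxE; apply/eqP; have := h i; rewrite negbK.
pose v := enorm u *: basis_vec i.
have eu0 : enorm u != 0 by rewrite enorm_eq0.
have Hv : \det (householder v) = -1 by rewrite householder_scale // det_householder_basis.
have euv : enorm u = enorm v by rewrite enormZ enorm_basis_vec mulr1 ger0_norm ?enorm_ge0.
have [->//|uv] := eqVneq u v.
have uv0 : u - v != 0 by rewrite subr_eq0.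
have := householder_swap uv euv; have := householder_sqr uv0.
have := householder_tr (u - v); move: (householder (u - v)) => Q trQ QQ Qv.
suff -> : householder u = Q *m householder v *m Q.
  by rewrite !det_mulmx Hv mulrAC -det_mulmx QQ det1 mul1r.
rewrite [householder v]/householder mulmxBr mulmx1 mulmxBl QQ -scalemxAr -scalemxAl.
rewrite (mulmxA Q) Qv -mulmxA -[v^T *m Q](trmxK) trmx_mul trmxK trQ Qv.
by rewrite -sqr_enorm -euv sqr_enorm.
Qed.

Lemma SO_householder2 u v : u != 0 -> v != 0 ->
  SO (householder u *m householder v).
Proof.
move=> u0 v0; split; last by rewrite det_mulmx !det_householder // mulrNN mulr1.
by rewrite trmx_mul !householder_tr -mulmxA (mulmxA (householder u)) householder_sqr // mul1mx householder_sqr.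
Qed.

Lemma orthogonal_vec u : (2 <= d)%N -> exists2 w, w != 0 & dot w u = 0.
Proof.
move=> d2; pose i := Ordinal (ltnW d2); pose j := Ordinal d2.
have ij : i != j by [].
have [ui0|ui0] := eqVneq (u i ord0) 0.
  exists (basis_vec i); last by rewrite dot_basis_vec.
  by rewrite -enorm_eq0 enorm_basis_vec oner_neq0.
exists (u j ord0 *: basis_vec i - u i ord0 *: basis_vec j).
  apply: contraNneq ui0 => /(congr1 (fun M : 'cV_d => M j ord0)).
  rewrite !mxE eqxx eq_sym (negbTE ij) /= mulr0 mulr1 add0r => /eqP.
  by rewrite oppr_eq0 => /eqP ->.
by rewrite dotBl !dotZl !dot_basis_vec mulrC subrr.
Qed.

(** One reflection carries [x] to [y]; a second one, in a direction orthogonal to [x], fixes [x] and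
    restores determinant 1. In dimension at least 2 such a direction exists. *)
Lemma SO_transitive x y : (2 <= d)%N -> enorm x = enorm y ->
  exists2 g : 'M[R]_d, SO g & g *m x = y.
Proof.
move=> d2 exy; have [->|xy] := eqVneq x y.
  by exists 1%:M; rewrite ?mul1mx //; split; rewrite ?det1 // trmx1 mul1mx.
have [w w0 wx] := orthogonal_vec x d2.
exists (householder (y - x) *m householder w).
  by apply: SO_householder2 => //; rewrite subr_eq0 eq_sym.
by rewrite -mulmxA (householderE w) wx mulr0 mul0r scale0r subr0 householder_swap // eq_sym.
Qed.

End Reflections.

(** * Means over rotations and their radial symmetry *)

Section RotationMeans.
Context {R : realType} {d : nat}.
Notation mxT := (borel_mx R d).
Local Notation SO := (@SO R d).
Variable mu : probability mxT R.
Hypothesis haar_mu : is_haar_SO mu.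
Implicit Types f g : 'M[R]_d -> R.

Let mSO : measurable (SO : set mxT) := measurable_SO.
Let muSO : mu (SO : set mxT) = 1%E := proj1 haar_mu.

Lemma integral_SO (h : mxT -> \bar R) : measurable_fun setT h ->
  (forall rho, 0 <= h rho)%E ->
  (\int[mu]_(rho in (SO : set mxT)) h rho = \int[mu]_rho h rho)%E.
Proof.
move=> mh h0; rewrite [RHS](@ge0_negligible_integral _ _ _ mu setT (~` SO)) //.
- by rewrite setTD setCK.
- exact: measurableC.
- by apply: etrans (probability_setC mu mSO) _; rewrite [X in (_ - X)%E]muSO subee.
Qed.

Lemma rot_mean_fullE f : measurable_fun setT (f : mxT -> R) -> (forall rho, 0 <= f rho) ->
  rot_mean mu f = (\int[mu]_rho (f rho)%:E)%E.
Proof.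
move=> mf f0; apply: (@integral_SO (EFin \o f)); first exact/measurable_EFinP.
by move=> x; rewrite lee_fin.
Qed.

Lemma rot_mean_ge0 f : (forall rho, 0 <= f rho) -> (0 <= rot_mean mu f)%E.
Proof. by move=> f0; apply: integral_ge0 => x _; rewrite lee_fin. Qed.

Lemma rot_mean_le f g : measurable_fun setT (f : mxT -> R) ->
  measurable_fun setT (g : mxT -> R) -> (forall rho, 0 <= f rho) ->
  (forall rho, SO rho -> f rho <= g rho) -> (rot_mean mu f <= rot_mean mu g)%E.
Proof.
move=> mf mg f0 fg; apply: ge0_le_integral => //.
- by move=> x _; rewrite lee_fin.
- by apply: measurable_funTS; exact/measurable_EFinP.
- by apply: measurable_funTS; exact/measurable_EFinP.
Qed.

Lemma rot_mean_cst (c : R) : rot_mean mu (fun=> c) = c%:E.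
Proof. by rewrite /rot_mean integral_cst // [X in (_ * X)%E]muSO mule1. Qed.

Lemma rot_meanZ (c : R) f : measurable_fun setT (f : mxT -> R) ->
  (forall rho, 0 <= f rho) -> 0 <= c ->
  rot_mean mu (fun rho => c * f rho) = (c%:E * rot_mean mu f)%E.
Proof.
move=> mf f0 c0; rewrite /rot_mean.
under eq_integral do rewrite EFinM.
rewrite ge0_integralZl //; first by
  apply: measurable_funTS; exact/measurable_EFinP.
by move=> x _; rewrite lee_fin.
Qed.

Lemma rot_mean_sum (I : Type) (s : seq I) (P : pred I) (f : I -> 'M[R]_d -> R) :
  (forall i, measurable_fun setT (f i : mxT -> R)) ->
  (forall i rho, 0 <= f i rho) ->
  rot_mean mu (fun rho => \sum_(i <- s | P i) f i rho) =
  (\sum_(i <- s | P i) rot_mean mu (f i))%E.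
Proof.
move=> mf f0; rewrite /rot_mean -[RHS]big_filter -ge0_integral_sum //.
- by apply: eq_integral => x _; rewrite big_filter sumEFin.
- by move=> i; apply: measurable_funTS; exact/measurable_EFinP.
- by move=> i x _; rewrite lee_fin.
Qed.

(** Tonelli's theorem when both partial means are constant on SO(d): the total mass is 1, so the two
    iterated integrals are these constants. *)
Lemma rot_mean_swap (h : mxT -> mxT -> R) (c1 c2 : \bar R) :
  measurable_fun setT (fun p : mxT * mxT => h p.1 p.2) -> (forall r1 r2, 0 <= h r1 r2) ->
  (forall r1, SO r1 -> rot_mean mu (h r1) = c1) ->
  (forall r2, SO r2 -> rot_mean mu (fun r1 => h r1 r2) = c2) -> c1 = c2.
Proof.
move=> mh h0 hc1 hc2.
have mE : measurable_fun setT (EFin \o (fun p : mxT * mxT => h p.1 p.2)).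
  by apply/measurable_EFinP.
have h0' p : (0 <= (EFin \o (fun p : mxT * mxT => h p.1 p.2)) p)%E by rewrite lee_fin.
pose H1 := fun r1 : mxT => (\int[mu]_r2 (h r1 r2)%:E)%E.
pose H2 := fun r2 : mxT => (\int[mu]_r1 (h r1 r2)%:E)%E.
have mH1 : measurable_fun setT H1.
  exact: (@measurable_fun_fubini_tonelli_F _ _ mxT mxT R mu _ mE h0').
have mH2 : measurable_fun setT H2.
  exact: (@measurable_fun_fubini_tonelli_G _ _ mxT mxT R mu _ mE h0').
have H10 r : (0 <= H1 r)%E by apply: integral_ge0 => y0 _; rewrite lee_fin.
have H20 r : (0 <= H2 r)%E by apply: integral_ge0 => y0 _; rewrite lee_fin.
have H12 : (\int[mu]_r H1 r = \int[mu]_r H2 r)%E.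
  exact: (@fubini_tonelli _ _ mxT mxT R mu mu _ mE h0').
have icst (c : \bar R) : (\int[mu]_(r in (SO : set mxT)) c = c)%E.
  by rewrite integral_cst // [X in (_ * X)%E]muSO mule1.
rewrite -(icst c1) -(icst c2).
transitivity (\int[mu]_(r in (SO : set mxT)) H1 r)%E.
  apply: eq_integral => r /[!inE] sr; rewrite -(hc1 r sr); apply: rot_mean_fullE => //.
  exact: (measurableT_comp mh (measurable_pair1 r)).
rewrite integral_SO // H12 -integral_SO //.
apply: eq_integral => r /[!inE] sr; rewrite -(hc2 r sr); apply/esym/rot_mean_fullE => //.
exact: (measurableT_comp mh (measurable_pair2 r)).
Qed.

(* Averaging [F (rho'^T *m rho *m z)] over [rho'] and [rho] in either order shows
   that the left-invariant [mu] is also right-invariant. *)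
Lemma rot_mean_radial (F : 'cV[R]_d -> R) (x y : 'cV[R]_d) : (2 <= d)%N ->
  (forall z, 0 <= F z) ->
  (forall z, measurable_fun setT (fun rho : mxT => F ((rho : 'M[R]_d) *m z))) ->
  (forall z, measurable_fun setT (fun rho : mxT => F ((rho : 'M[R]_d)^T *m z))) ->
  (forall z, measurable_fun setT
     (fun p : mxT * mxT => F ((p.1 : 'M[R]_d)^T *m ((p.2 : 'M[R]_d) *m z)))) ->
  enorm x = enorm y ->
  rot_mean mu (fun rho => F (rho *m x)) = rot_mean mu (fun rho => F (rho *m y)).
Proof.
move=> d2 F0 mF mFt mF2 exy.
have inv_tr z (g : 'M[R]_d) : SO g ->
    rot_mean mu (fun rho => F (rho^T *m (g *m z))) = rot_mean mu (fun rho => F (rho^T *m z)).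
  move=> sg; apply: etrans (rot_mean_translate haar_mu (SO_tr sg) (mFt z) _); last by [].
  by congr rot_mean; apply/funext => rho; rewrite trmx_mul trmxK -mulmxA.
have E z : rot_mean mu (fun rho => F (rho *m z)) = rot_mean mu (fun rho => F (rho^T *m z)).
  apply: (@rot_mean_swap (fun r1 r2 => F ((r1 : 'M[R]_d)^T *m ((r2 : 'M[R]_d) *m z)))).
  - exact: mF2.
  - by move=> r1 r2; exact: F0.
  - move=> r1 sr1; apply: etrans (rot_mean_translate haar_mu (SO_tr sr1) (mF z) _); last by [].
    by congr rot_mean; apply/funext => rho; rewrite mulmxA.
  - by move=> r2 sr2; exact: inv_tr.
have [g sg <-] := SO_transitive d2 exy.
by rewrite !E inv_tr.
Qed.

End RotationMeans.

(** * Small values of a rotated coordinate *)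

Lemma nat_dist_ge1 (R : realType) (m n : nat) : m != n -> 1 <= `|m%:R - n%:R| :> R.
Proof.
wlog mn : m n / (m < n)%N => [h|_].
  by case: (ltngtP m n) => // mn _; [|rewrite distrC]; apply: h => //; rewrite ltn_eqF.
by rewrite distrC -natrB ?(ltnW mn) // normr_nat ler1n subn_gt0.
Qed.

Section SmallBall.
Context {R : realType} {d : nat}.
Notation mxT := (borel_mx R d).
Local Notation SO := (@SO R d).
Variable mu : probability mxT R.
Hypothesis haar_mu : is_haar_SO mu.

Lemma measurable_bool_nat (b : mxT -> bool) : measurable_fun setT b ->
  measurable_fun setT (fun rho => (b rho)%:R : R).
Proof.
move=> mb; rewrite (_ : (fun _ => _) = (fun c : bool => c%:R : R) \o b) //.
by apply: measurableT_comp.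
Qed.

Lemma measurable_slab (v a : 'cV[R]_d) (r : R) :
  measurable_fun setT (fun rho : mxT => (`|dot ((rho : 'M[R]_d) *m v) a| <= r)%R%:R : R).
Proof.
apply: measurable_bool_nat; apply: measurable_fun_ler => //.
apply: measurableT_comp => //; exact: measurable_dot_rot.
Qed.

(* [(x, y)] rotated by the angle [2 arctan t]: the first coordinate cannot stay
   below [r] for two well separated values of [t] if the second one is large. *)
Lemma rotated_coords_separate (x y r c t s : R) : 0 <= t <= 1 -> 0 <= s <= 1 ->
  `|((1 - t ^+ 2) * x - 2 * t * y) / (1 + t ^+ 2)| <= r ->
  c <= `|(2 * t * x + (1 - t ^+ 2) * y) / (1 + t ^+ 2)| ->
  `|((1 - s ^+ 2) * x - 2 * s * y) / (1 + s ^+ 2)| <= r ->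
  `|s - t| * c <= 4 * r.
Proof.
move=> t01 s01.
set X := _ / (1 + t ^+ 2); set Y := (_ + _) / _; set Z := _ / (1 + s ^+ 2) => hX hY hZ.
have t2 : 0 <= t ^+ 2 <= 1 by rewrite sqr_ge0 expr_le1 //; case/andP: t01.
have s2 : 0 <= s ^+ 2 <= 1 by rewrite sqr_ge0 expr_le1 //; case/andP: s01.
have nt : 1 + t ^+ 2 != 0 by apply: lt0r_neq0; lra.
have ns : 1 + s ^+ 2 != 0 by apply: lt0r_neq0; lra.
(* With alpha, beta the angles belonging to [t], [s], this is Z = cos(beta - alpha) X - sin(beta -
   alpha) Y, cleared of denominators and solved for the term in Y. *)
have E : 2 * (s - t) * (1 + t * s) * Y =
    ((1 - t ^+ 2) * (1 - s ^+ 2) + 4 * t * s) * X - Z * ((1 + t ^+ 2) * (1 + s ^+ 2)).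
  by rewrite /X /Y /Z; field; rewrite ns nt.
clearbody X Y Z.
have r0 : 0 <= r by apply: le_trans hX.
have ts : 0 <= t * s <= 1 by nra.
have B1 : `|2 * (s - t) * (1 + t * s) * Y| <= 8 * r.
  rewrite E; apply: le_trans (ler_normB _ _) _.
  rewrite !normrM (@ger0_norm _ (_ + 4 * t * s)); last by nra.
  rewrite (@ger0_norm _ (1 + t ^+ 2)); last by lra.
  rewrite (@ger0_norm _ (1 + s ^+ 2)); last by lra.
  have h1 : (1 - t ^+ 2) * (1 - s ^+ 2) + 4 * t * s <= 4 by nra.
  have h2 : (1 + t ^+ 2) * (1 + s ^+ 2) <= 4 by nra.
  have h3 : 0 <= (1 - t ^+ 2) * (1 - s ^+ 2) + 4 * t * s by nra.
  have h4 : 0 <= (1 + t ^+ 2) * (1 + s ^+ 2) by nra.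
  have h5 := ler_pM h3 (normr_ge0 _) h1 hX; have h6 := ler_pM (normr_ge0 _) h4 hZ h2.
  lra.
have B2 : 2 * (`|s - t| * c) <= `|2 * (s - t) * (1 + t * s) * Y|.
  rewrite !normrM (@ger0_norm _ 2) // (@ger0_norm _ (1 + t * s)); last by lra.
  rewrite -!mulrA ler_pM2l // ler_wpM2l //.
  have h : 1 <= 1 + t * s by lra.
  by apply: (le_trans hY); rewrite ler_peMl.
lra.
Qed.

(** Rotating in the plane of [i] and [j] yields about c / (5 r) pairwise disjoint copies of the
    event, all of equal probability by invariance, so each has probability at most the inverse of
    their number. *)
Lemma rot_coord_mean (i j : 'I_d) (v : 'cV[R]_d) (r c : R) : i != j -> 0 < r -> 5 * r <= c ->
  (rot_mean mu (fun rho => ((`|dot (rho *m v) (basis_vec i)| <= r)%R%:R *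
     (c <= `|dot (rho *m v) (basis_vec j)|)%R%:R)%R) <= (10 * r / c)%:E)%E.
Proof.
move=> ij r0 rc.
have c0 : 0 < c by lra.
pose f (rho : 'M[R]_d) : R := ((`|dot (rho *m v) (basis_vec i)| <= r)%R%:R *
     (c <= `|dot (rho *m v) (basis_vec j)|)%R%:R).
have mf : measurable_fun setT (f : mxT -> R).
  apply: measurable_funM; first exact: measurable_slab.
  apply: measurable_bool_nat; apply: measurable_fun_ler => //.
  by apply: measurableT_comp => //; exact: measurable_dot_rot.
have f0 rho : 0 <= f rho by rewrite mulr_ge0.
pose N := Num.truncn (c / (5 * r)).
have cr1 : 1 <= c / (5 * r) by rewrite ler_pdivlMr ?mul1r ?mulr_gt0.
have N1 : (0 < N)%N by rewrite truncn_gt0.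
have Nle : N%:R <= c / (5 * r) by rewrite truncn_le // ltW // (lt_le_trans ltr01).
have Nge : c / (10 * r) <= N%:R.
  have := truncnS_gt (c / (5 * r)); rewrite -/N -[N.+1%:R]natr1 => h.
  have : (1 : R) <= N%:R by rewrite ler1n.
  have -> : c / (10 * r) = (c / (5 * r)) / 2 by field; apply: lt0r_neq0.
  lra.
(* Two parameters of the same event differ by at most 4 r / c, by [rotated_coords_separate]; a
   spacing of 5 r / c makes the events disjoint. *)
pose eps := 5 * r / c.
have eps0 : 0 < eps by rewrite divr_gt0 // mulr_gt0.
(* The reflections in e_i and in e_i + t e_j compose to the rotation of the plane by 2 arctan t,
   with rational entries in t. *)
pose u (k : 'I_N) := basis_vec i + (k%:R * eps) *: basis_vec j : 'cV[R]_d.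
pose g (k : 'I_N) := householder (u k) *m householder (basis_vec i).
have bi0 : basis_vec i != 0 :> 'cV[R]_d by rewrite -enorm_eq0 enorm_basis_vec oner_neq0.
have dij : dot (basis_vec i) (basis_vec j) = 0 :> R.
  by rewrite dot_basis_vec mxE (negbTE ij).
have dji : dot (basis_vec j) (basis_vec i) = 0 :> R by rewrite dotC.
have dii k : dot (basis_vec k) (basis_vec k) = 1 :> R by rewrite dot_basis_vec mxE !eqxx.
have uu k : dot (u k) (u k) = 1 + (k%:R * eps) ^+ 2.
  by rewrite /u !dotDl !dotDr !dotZl !dotZr dij dji !dii; ring.
have u0 k : u k != 0.
  by rewrite -dotxx_eq0 uu; apply: lt0r_neq0; rewrite ltr_pwDl // sqr_ge0.
have sg k : SO (g k) by apply: SO_householder2.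
have key k : rot_mean mu (fun rho => f (g k *m rho)) = rot_mean mu f.
  exact: rot_mean_translate.
have gi k w : dot (g k *m w) (basis_vec i) =
   ((1 - (k%:R * eps) ^+ 2) * dot w (basis_vec i) - 2 * (k%:R * eps) * dot w (basis_vec j)) / (1 + (k%:R * eps) ^+ 2).
  have n0 : 1 + (k%:R * eps) ^+ 2 != 0 by rewrite -uu dotxx_eq0.
  rewrite /g -mulmxA !householderE uu /u !(dotNl, dotNr, dotDl, dotDr, dotZl, dotZr).
  rewrite ?dij ?dji !dii (dotC (basis_vec i) w) (dotC (basis_vec j) w).
  by field.
have gj k w : dot (g k *m w) (basis_vec j) =
   (2 * (k%:R * eps) * dot w (basis_vec i) + (1 - (k%:R * eps) ^+ 2) * dot w (basis_vec j)) / (1 + (k%:R * eps) ^+ 2).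
  have n0 : 1 + (k%:R * eps) ^+ 2 != 0 by rewrite -uu dotxx_eq0.
  rewrite /g -mulmxA !householderE uu /u !(dotNl, dotNr, dotDl, dotDr, dotZl, dotZr).
  rewrite ?dij ?dji !dii (dotC (basis_vec i) w) (dotC (basis_vec j) w).
  by field.
have t01 (k : 'I_N) : 0 <= k%:R * eps <= 1.
  apply/andP; split; first by rewrite mulr_ge0 // ltW.
  have -> : eps = (c / (5 * r))^-1 by rewrite invf_div.
  rewrite ler_pdivrMr ?divr_gt0 ?mulr_gt0 // mul1r; apply: le_trans Nle.
  by rewrite ler_nat ltnW.
have disj rho : \sum_k f (g k *m rho) <= 1.
  have [[k fk]|no] := pselect (exists k, f (g k *m rho) != 0); last first.
    rewrite big1 // => k _; apply/eqP; apply: contrapT => /negP h; apply: no; by exists k.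
  rewrite (bigD1 k) //= big1 ?addr0; first by rewrite /f -natrM lern1; case: (_ <= r); case: (c <= _).
  move=> l lk; apply/eqP; apply: contrapT => /negP fl.
  have fP m : f (g m *m rho) != 0 -> `|dot (g m *m (rho *m v)) (basis_vec i)| <= r /\
      c <= `|dot (g m *m (rho *m v)) (basis_vec j)|.
    rewrite /f !mulmxA; case: (_ <= r); case: (c <= _) => //=; by rewrite ?mulr0 ?mul0r eqxx.
  have [] := fP _ fk; have [] := fP _ fl; rewrite !gi !gj => l1 _ k1 k2.
  have := rotated_coords_separate (t01 k) (t01 l) k1 k2 l1.
  rewrite -mulrBl normrM (gtr0_norm eps0) -mulrA.
  have -> : eps * c = 5 * r by rewrite divfK // lt0r_neq0.
  rewrite leNgt => /negP; apply.
  have := @nat_dist_ge1 R l k lk.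
  move=> h; apply: (@lt_le_trans _ _ (5 * r)); first by rewrite ltr_pM2r // ltr_nat.
  by rewrite ler_peMl // ltW // mulr_gt0.
have E1 : (N%:R%:E * rot_mean mu f <= 1%:E)%E.
  have -> : (N%:R%:E * rot_mean mu f = rot_mean mu (fun rho => (\sum_k f (g k *m rho))%R))%E.
    rewrite rot_mean_sum //; last first.
      by move=> k; exact: measurableT_comp mf (measurable_mulmx_left _).
    under eq_bigr do rewrite key.
    by rewrite sumr_const card_ord mule_natl.
  rewrite -(rot_mean_cst haar_mu 1); apply: rot_mean_le => //.
    apply: measurable_sum => k; exact: measurableT_comp mf (measurable_mulmx_left _).
  by move=> rho; apply: sumr_ge0.
have N0 : (0 : R) < N%:R by rewrite ltr0n.
apply: (@le_trans _ _ (N%:R^-1%:E * 1%:E)%E); first by rewrite lee_pdivlMl.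
rewrite -EFinM lee_fin mulr1 -[leRHS]invrK lef_pV2 ?posrE ?invr_gt0 ?divr_gt0 ?mulr_gt0 //.
by rewrite invf_div.
Qed.

Lemma exists_large_coord (w : 'cV[R]_d) : (0 < d)%N ->
  exists i, enorm w / d%:R <= `|w i ord0|.
Proof.
move=> d0; apply: contrapT => no.
have n0 : w != 0.
  apply: contra_notN no => /eqP ->; exists (Ordinal d0).
  by rewrite enorm0 mul0r.
have h i : `|w i ord0| < enorm w / d%:R by rewrite ltNge; apply/negP => h; apply: no; exists i.
have dR : (0 : R) < d%:R by rewrite ltr0n.
have [i0 hi0] : exists i0 : 'I_d, forall i, `|w i ord0| <= `|w i0 ord0|.
  pose i1 := [arg max_(i > Ordinal d0) `|w i ord0|]%O.
  by exists i1 => i; rewrite /i1; case: arg_maxP => // k _; apply.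
have := enorm_le_coord (normr_ge0 _) hi0.
by rewrite leNgt -ltr_pdivlMl // mulrC h.
Qed.

(** By transitivity [a] may be taken along an axis [i]. Some coordinate of the rotated [v] is at
    least |v| / d; unless [r] is large it differs from the small coordinate [i], and
    [rot_coord_mean] applies. Summing over its possible positions costs a second factor d. *)
Lemma slab_mean (a v : 'cV[R]_d) (r : R) : (2 <= d)%N -> a != 0 -> v != 0 -> 0 < r ->
  (rot_mean mu (fun rho => (`|dot (rho *m v) a| <= r)%R%:R%R) <=
   (10 * d%:R ^+ 2 * r / (enorm a * enorm v))%:E)%E.
Proof.
move=> d2 a0 v0 r0.
have d0 : (0 < d)%N by exact: ltnW.
pose i := Ordinal d0.
have ea : 0 < enorm a by rewrite enorm_gt0.
have ev : 0 < enorm v by rewrite enorm_gt0.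
have dR : (0 : R) < d%:R by rewrite ltr0n.
have dR1 : (1 : R) <= d%:R by rewrite ler1n.
pose r' := r / enorm a; pose c := enorm v / d%:R.
have r'0 : 0 < r' by rewrite divr_gt0.
have c0 : 0 < c by rewrite divr_gt0.
have [g sg ga] : exists2 g : 'M[R]_d, SO g & g *m (enorm a *: basis_vec i) = a.
  by apply: SO_transitive => //; rewrite enormZ enorm_basis_vec mulr1 ger0_norm // ltW.
have -> : rot_mean mu (fun rho => (`|dot (rho *m v) a| <= r)%R%:R%R) =
    rot_mean mu (fun rho => (`|dot (rho *m v) (basis_vec i)| <= r')%R%:R%R).
  rewrite -(rot_mean_translate haar_mu sg (measurable_slab v a r)) //.
  congr rot_mean; apply/funext => rho; congr (nat_of_bool _)%:R.
  by rewrite -{1}ga -mulmxA SO_dot // dotZr normrM (gtr0_norm ea) mulrC ler_pdivlMr.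
(* In the first case the claimed bound is at least 1. *)
have [big|small] := ltP c (5 * r').
  apply: (@le_trans _ _ 1%:E).
    rewrite -(rot_mean_cst haar_mu 1); apply: rot_mean_le => //; first exact: measurable_slab.
    by move=> rho _; rewrite lern1 leq_b1.
  rewrite lee_fin ler_pdivlMr ?mulr_gt0 // mul1r.
  move: big; rewrite /c /r' ltr_pdivrMr // mulrA mulrAC ltr_pdivlMr // => h.
  have : 5 * r * d%:R <= 10 * d%:R ^+ 2 * r.
    have h1 : r * d%:R <= r * (d%:R * d%:R) by rewrite ler_pM2l // ler_peMl // ltW.
    have h2 : 0 < r * (d%:R * d%:R) by rewrite !mulr_gt0.
    by rewrite expr2; lra.
  by apply: le_trans; rewrite mulrC; exact: ltW.
pose f (j : 'I_d) (rho : 'M[R]_d) : R := (`|dot (rho *m v) (basis_vec i)| <= r')%R%:R *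
     (c <= `|dot (rho *m v) (basis_vec j)|)%R%:R.
have mf j : measurable_fun setT (f j : mxT -> R).
  apply: measurable_funM; first exact: measurable_slab.
  apply: measurable_bool_nat; apply: measurable_fun_ler => //.
  by apply: measurableT_comp => //; exact: measurable_dot_rot.
have f0 j rho : 0 <= f j rho by rewrite mulr_ge0.
apply: (@le_trans _ _ (rot_mean mu (fun rho => (\sum_(j | j != i) f j rho)%R))).
  apply: rot_mean_le => //; first exact: measurable_slab.
    under eq_fun do rewrite -big_filter.
    by apply: measurable_sum.
  move=> rho srho; have [h|] /= := leP `|dot (rho *m v) (basis_vec i)| r'; last first.
    by move=> _; exact: sumr_ge0.
  have [j hj] := exists_large_coord (rho *m v) d0.
  rewrite -dot_basis_vec dotC SO_enorm // -/c in hj.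
  have ji : j != i.
    apply: contraTneq hj => ->; rewrite -ltNge; apply: le_lt_trans h _.
    by apply: lt_le_trans small; rewrite ltr_pMl // ltr1n.
  by rewrite (bigD1 j) //= {1}/f h hj mulr1 lerDl sumr_ge0.
rewrite rot_mean_sum //.
apply: (@le_trans _ _ (\sum_(j | j != i) (10 * r' / c)%:E)%E).
  by apply: lee_sum => j ji; apply: rot_coord_mean => //; rewrite eq_sym.
rewrite sumEFin lee_fin.
apply: (@le_trans _ _ (\sum_(j < d) (10 * r' / c))).
  rewrite [leRHS](bigID (fun j => j != i)) /= lerDl sumr_ge0 // => k _.
  by apply: ltW; rewrite divr_gt0 // mulr_gt0.
rewrite sumr_const card_ord -mulr_natl /r' /c le_eqVlt; apply/orP; left; apply/eqP.
by field; rewrite !lt0r_neq0.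
Qed.

End SmallBall.

(** * From distance counts to positive measure *)

Section Counting.
Context {R : realType}.

Lemma sum_cauchy_schwarz (I : finType) (P : pred I) (a b : I -> R) :
  (\sum_(i | P i) a i * b i) ^+ 2 <=
  (\sum_(i | P i) a i ^+ 2) * (\sum_(i | P i) b i ^+ 2).
Proof.
set A := \sum_(i | P i) a i * b i; set B := \sum_(i | P i) b i ^+ 2.
have B0 : 0 <= B by apply: sumr_ge0 => i _; exact: sqr_ge0.
have [B00|Bn0] := eqVneq B 0.
  have b0 i : P i -> b i = 0.
    move=> Pi; have /psumr_eq0P : B = 0 by []; move=> /(_ (fun i _ => sqr_ge0 _) i Pi) /eqP.
    by rewrite sqrf_eq0 => /eqP.
  by rewrite /A big1 ?expr0n ?B00 ?mulr0 // => i Pi; rewrite b0 // mulr0.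
have Bp : 0 < B by rewrite lt0r Bn0.
have : 0 <= \sum_(i | P i) (B * a i - A * b i) ^+ 2 by apply: sumr_ge0 => i _; exact: sqr_ge0.
have -> : \sum_(i | P i) (B * a i - A * b i) ^+ 2 =
    B * (B * (\sum_(i | P i) a i ^+ 2) - A ^+ 2).
  transitivity (\sum_(i | P i) (B ^+ 2 * a i ^+ 2 - 2 * A * B * (a i * b i) + A ^+ 2 * b i ^+ 2)).
    by apply: eq_bigr => i _; ring.
  rewrite big_split /= sumrB -!mulr_sumr -/A -/B; ring.
by rewrite pmulr_rge0 // subr_ge0 mulrC.
Qed.

Lemma compact_sub_open (D U : set R) : compact D -> open U -> D `<=` U ->
  exists2 e : R, 0 < e & forall x y, D x -> `|x - y| < e -> U y.
Proof.
move=> cD oU DU.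
have /compact_near_coveringP ncD := cD.
have := ncD R (0^'+) (fun e x => forall y, `|x - y| < e -> U y) _.
have H : forall x, D x -> \forall x' \near x & i \near 0^'+, (fun e x => forall y, `|x - y| < e -> U y) i x'.
  move=> x Dx; have [r /= r0 rU] : nbhs_ball x U.
    by apply/nbhs_ballP; apply: open_nbhs_nbhs; split => //; exact: DU.
  exists (ball x (r / 2), [set e | 0 < e < r / 2]) => /=.
    split; first by apply: nbhsx_ballx; rewrite divr_gt0.
    near=> e; apply/andP; split; first by near: e; exact: nbhs_right_gt.
    by near: e; apply: nbhs_right_lt; rewrite divr_gt0.
  move=> [x' e] /= [xx' /andP[e0 er]] y x'y; apply: rU.
  rewrite /ball /= in xx' *; rewrite -(subrKA x'); apply: le_lt_trans (ler_normD _ _) _; lra.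
move=> /(_ _ H) near_e.
near (0 : R)^'+ => e.
exists e; first by near: e; exact: nbhs_right_gt.
move=> x y Dx; move: x Dx y.
near: e; exact: near_e.
Unshelve. all: by end_near. Qed.

Lemma lebesgue_measure_grid (U : set R) (h : R) (s : seq nat) : measurable U -> 0 < h -> uniq s ->
  (forall l, l \in s -> `[l%:R * h, l.+1%:R * h[ `<=` U) ->
  (((size s)%:R * h)%:E <= lebesgue_measure U)%E.
Proof.
move=> mU h0; elim: s U mU => [|l s IH] U mU; first by rewrite mul0r.
move=> /= /andP[ls us] sU.
set I := `[l%:R * h, l.+1%:R * h[%classic.
have IU : I `<=` U by apply: sU; rewrite inE eqxx.
have -> : lebesgue_measure U = (lebesgue_measure I + lebesgue_measure (U `\` I))%E.
  rewrite -measureU //; first by rewrite setDUK.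
  - exact: measurable_itv.
  - by apply: measurableD => //; exact: measurable_itv.
  - by rewrite setDIK.
have -> : lebesgue_measure I = h%:E.
  rewrite /I lebesgue_measure_itv /= lte_fin ltr_pM2r // ltr_nat ltnSn -EFinB.
  by rewrite -natr1; congr (_%:E); ring.
rewrite -natr1 mulrDl mul1r addrC EFinD leeD //.
apply: IH => //; first by apply: measurableD => //; exact: measurable_itv.
move=> k ks x kx; split; first by apply: (sU k) => //; rewrite inE ks orbT.
move: kx; rewrite /I /= !in_itv /= => /andP[k1 k2] /andP[l1 l2].
have := le_lt_trans k1 l2; have := le_lt_trans l1 k2.
rewrite !ltr_pM2r // !ltr_nat !ltnS => lk kl.
by move: ls; rewrite (@anti_leq l k) ?ks // lk kl.
Qed.

(** If [D] were null, outer regularity would put it in an open set of measure below [c], which by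
    compactness contains a neighbourhood of [D] of some width e. At scale e / 3 the grid intervals
    next to the hits fit into that neighbourhood, yet have total length at least [c]. *)
Lemma pos_measure_of_counts (D : set R) (c : R) : 0 < c -> compact D ->
  (forall e, 0 < e -> exists (h delta : R) (s : seq nat),
     [/\ 0 < h <= e, delta <= e, uniq s,
         forall l, l \in s -> exists2 t, D t & `|t - l%:R * h| <= delta
       & c <= (size s)%:R * h]) ->
  (0 < lebesgue_measure D)%E.
Proof.
move=> c0 cD H; rewrite lt0e measure_ge0 andbT; apply/eqP => D0.
have [U [oU DU Uc]] : exists U, [/\ open U, D `<=` U & (lebesgue_measure U < c%:E)%E].
  have mD : measurable D by exact: compact_measurable.
  have Dfin : (lebesgue_measure D < +oo)%E by rewrite D0.
  have [U [oU DU UD]] := lebesgue_regularity_outer mD Dfin c0.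
  exists U; split => //; apply: le_lt_trans UD.
  have -> : lebesgue_measure U = (lebesgue_measure D + lebesgue_measure (U `\` D))%E.
    rewrite -measureU //; first by rewrite setDUK.
    - by apply: measurableD => //; exact: open_measurable.
    - by rewrite setDIK.
  by rewrite D0 add0e.
have [e e0 eU] := compact_sub_open cD oU DU.
have [|h [delta [s [/andP[h0 he] de us sD cs]]]] := H (e / 3); first by rewrite divr_gt0.
have : (c%:E <= lebesgue_measure U)%E.
  apply: (@le_trans _ _ ((size s)%:R * h)%:E); first by rewrite lee_fin.
  apply: lebesgue_measure_grid => //; first exact: open_measurable.
  move=> l /sD[t Dt td] x /=; rewrite in_itv /= => /andP[x1 x2].
  apply: (eU t x Dt).
  have : `|l%:R * h - x| <= h.
    by rewrite ler_norml; move: x2; rewrite -natr1 mulrDl mul1r => x2; apply/andP; split; lra.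
  move=> lx; rewrite -(subrKA (l%:R * h)); apply: le_lt_trans (ler_normD _ _) _; lra.
by rewrite leNgt Uc.
Qed.

(** Every value [tau e] is within [J * h] of at least [J] grid points, so the counts add up to at
    least [J] times the total weight. Only grid points that are hit contribute, and Cauchy-Schwarz
    over them bounds their number from below. *)
Lemma count_hits (E : finType) (w tau : E -> R) (h C : R) (J T : nat) :
  0 < h -> (0 < J)%N -> 0 <= C -> (forall e, 0 <= w e) ->
  (forall e, 0 <= tau e < (T%:R - J%:R) * h) ->
  h * \sum_(l < T) (\sum_(e | `|tau e - l%:R * h| <= J%:R * h) w e) ^+ 2 <= C * (J%:R * h) ^+ 2 ->
  exists s : seq nat, [/\ uniq s,
     forall l, l \in s -> exists2 e, 0 < w e & `|tau e - l%:R * h| <= J%:R * h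
   & (\sum_e w e) ^+ 2 <= C * ((size s)%:R * h)].
Proof.
move=> h0 J0 C0 w0 tauT HC.
pose nu (l : 'I_T) := \sum_(e | `|tau e - l%:R * h| <= J%:R * h) w e.
have nu0 l : 0 <= nu l by apply: sumr_ge0.
pose S := [set l | 0 < nu l]%SET.
exists [seq nat_of_ord l | l <- enum S]; split.
- by rewrite map_inj_uniq ?enum_uniq //; exact: val_inj.
- move=> _ /mapP[l lS ->]; move: lS; rewrite mem_enum inE => nul.
  apply: contrapT => no; move: nul; rewrite /nu big1 ?ltxx // => e he.
  by apply/eqP; rewrite eq_le w0 andbT leNgt; apply/negP => we; apply: no; exists e.
rewrite size_map -cardE.
have hits e : J%:R <= \sum_(l < T) (`|tau e - l%:R * h| <= J%:R * h)%R%:R :> R.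
  (* The grid points used are those with index from k0 + 1 to k0 + J, just above [tau e]; the margin
     [J] in the hypothesis on [tau] keeps them below [T]. *)
  pose k0 := Num.truncn (tau e / h).
  have [t0 tT] := andP (tauT e).
  have th0 : 0 <= tau e / h by rewrite divr_ge0 // ltW.
  have k1 : k0%:R * h <= tau e by rewrite -ler_pdivlMr // truncn_le.
  have k2 : tau e < k0.+1%:R * h by rewrite -ltr_pdivrMr // truncnS_gt.
  have kT : (k0.+1 + J <= T)%N.
    rewrite addSn -(ltr_nat R) natrD -(ltr_pM2r h0); apply: le_lt_trans (_ : tau e + J%:R * h < _).
      by rewrite mulrDl lerD2r.
    by move: tT; rewrite mulrBl ltrBrDr.
  rewrite -(big_mkord xpredT (fun l : nat => (`|tau e - l%:R * h| <= J%:R * h)%R%:R : R)).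
  rewrite (@big_cat_nat _ _ _ k0.+1) /= ?(leq_trans _ kT) ?leq_addr //.
  rewrite (@big_cat_nat _ _ _ (k0.+1 + J) k0.+1) /= ?leq_addr //.
  apply: (@le_trans _ _ (\sum_(k0.+1 <= l < k0.+1 + J) 1)).
    by rewrite sumr_const_nat addKn.
  rewrite addrCA -[leLHS]addr0 lerD ?addr_ge0 ?sumr_ge0 //.
  rewrite le_eqVlt; apply/orP; left; apply/eqP; apply: eq_big_nat => l /andP[l1 l2].
  have -> //: `|tau e - l%:R * h| <= J%:R * h.
  have h1 : k0.+1%:R * h <= l%:R * h by rewrite ler_pM2r // ler_nat.
  have h2 : l%:R * h <= (k0%:R + J%:R) * h by rewrite ler_pM2r // -natrD ler_nat.
  rewrite ler0_norm; last by lra.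
  by rewrite mulrDl in h2; lra.
have S1 : J%:R * \sum_e w e <= \sum_(l < T) nu l.
  rewrite (eq_bigr (fun l : 'I_T => \sum_e (`|tau e - l%:R * h| <= J%:R * h)%R%:R * w e)); last first.
    move=> l _; rewrite /nu big_mkcond /=; apply: eq_bigr => e _.
    by case: ifP => _; rewrite ?mul1r ?mul0r.
  rewrite exchange_big mulr_sumr; apply: ler_sum => e _.
  by rewrite -mulr_suml ler_wpM2r.
have S2 : \sum_(l < T) nu l = \sum_(l in S) 1 * nu l.
  rewrite (bigID (mem S)) /= [X in _ + X]big1 ?addr0.
    by apply: eq_bigr => l _; rewrite mul1r.
  by move=> l; rewrite inE -leNgt => nl; apply/eqP; rewrite eq_le nl nu0.
have S3 : (\sum_(l < T) nu l) ^+ 2 <= #|S|%:R * \sum_(l < T) nu l ^+ 2.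
  rewrite S2; apply: le_trans (sum_cauchy_schwarz _ _ _) _.
  under eq_bigr do rewrite expr1n.
  rewrite sumr_const ler_wpM2l // [leRHS](bigID (mem S)) /= lerDl sumr_ge0 // => l _.
  exact: sqr_ge0.
have Wge : 0 <= \sum_e w e by exact: sumr_ge0.
have JR : (0 : R) < J%:R by rewrite ltr0n.
have S4 : (J%:R * \sum_e w e) ^+ 2 <= (\sum_(l < T) nu l) ^+ 2.
  by rewrite ler_sqr ?nnegrE ?sumr_ge0 // mulr_ge0 // ltW.
rewrite -(ler_pM2l (_ : 0 < h * J%:R ^+ 2)); last by rewrite mulr_gt0 // exprn_gt0.
have H1 := ler_wpM2l (ltW h0) (le_trans S4 S3).
rewrite -[leLHS]mulrA -exprMn; apply: le_trans H1 _.
rewrite mulrCA; apply: le_trans (ler_wpM2l _ HC) _ => //.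
by rewrite le_eqVlt; apply/orP; left; apply/eqP; ring.
Qed.

End Counting.

(** * A finite Frostman lemma *)

Section HausdorffCovers.
Context {R : realType} {d : nat}.
Implicit Types (E U : set 'cV[R]_d).

Lemma diam_le U (r : R) : (forall x y, U x -> U y -> enorm (x - y) <= r) -> (diam U <= r%:E)%E.
Proof.
move=> h; apply: ge_ereal_sup => _ [x Ux [y Uy <-]].
by rewrite lee_fin h.
Qed.

Lemma diam_pow_le U (r s : R) : 0 <= r -> 0 <= s ->
  (forall x y, U x -> U y -> enorm (x - y) <= r) -> (diam_pow s U <= (r `^ s)%:E)%E.
Proof.
move=> r0 s0 h; rewrite /diam_pow; case: eqVneq => [_|/set0P[x Ux]].
  by rewrite lee_fin powR_ge0.
rewrite -poweR_EFin; apply: gt0_ler_poweR => //.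
- rewrite in_itv /= leey andbT; apply: ereal_sup_ubound; exists x => //; exists x => //.
  by rewrite subrr enorm0.
- by rewrite in_itv /= lee_fin r0 leey.
- exact: diam_le.
Qed.

Lemma diam_pow_ge0 (s : R) U : (0 <= diam_pow s U)%E.
Proof. by rewrite /diam_pow; case: ifP => // _; exact: poweR_ge0. Qed.

Lemma hausdorff_content_le (s delta : R) E (m : nat) (U : nat -> set 'cV[R]_d) (r : nat -> R) :
  0 <= s -> 0 <= delta -> E `<=` \bigcup_(i in `I_m) U i ->
  (forall i, (i < m)%N -> 0 <= r i <= delta) ->
  (forall i x y, (i < m)%N -> U i x -> U i y -> enorm (x - y) <= r i) ->
  (hausdorff_content s delta E <= (\sum_(i < m) r i `^ s)%:E)%E.
Proof.
move=> s0 delta0 EU rd Ur.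
pose U' i := if (i < m)%N then U i else set0.
apply: (@le_trans _ _ (\sum_(0 <= i <oo) diam_pow s (U' i))%E).
  apply: ereal_inf_lbound; exists U' => //; split.
    by move=> x /EU[i im Uix]; exists i => //; rewrite /U' (_ : (i < m)%N).
  move=> i; apply: diam_le => x y; rewrite /U'; case: ifP => // im Ux Uy.
  by apply: le_trans (Ur _ _ _ im Ux Uy) _; case/andP: (rd i im).
rewrite (@nneseries_split _ _ 0 m) //; last by move=> k _; exact: diam_pow_ge0.
rewrite add0n eseries0; last by move=> i mi _; rewrite /U' ltnNge mi /diam_pow eqxx.
rewrite adde0 big_mkord -sumEFin; apply: lee_sum => i _.
rewrite /U' ltn_ord; apply: diam_pow_le => //; first by case/andP: (rd i (ltn_ord i)).
by move=> x y; exact: Ur.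
Qed.

Lemma hausdorff_content_le_fin (s delta : R) E (I : finType) (U : I -> set 'cV[R]_d) (r : I -> R) :
  0 <= s -> 0 <= delta -> (forall x, E x -> exists i, U i x) ->
  (forall i, 0 <= r i <= delta) ->
  (forall i x y, U i x -> U i y -> enorm (x - y) <= r i) ->
  (hausdorff_content s delta E <= (\sum_i r i `^ s)%:E)%E.
Proof.
move=> s0 delta0 EU rd Ur.
pose U' (i : nat) : set 'cV[R]_d := if insub i is Some j then U (@enum_val _ (mem I) j) else set0.
pose r' (i : nat) : R := if insub i is Some j then r (@enum_val _ (mem I) j) else 0.
rewrite (eq_bigl (mem I)) // big_enum_val /=.
have U'E (j : 'I_#|I|) : U' j = U (enum_val j) by rewrite /U' valK.
have r'E (j : 'I_#|I|) : r' j = r (enum_val j) by rewrite /r' valK.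
under eq_bigr do rewrite -r'E.
apply: (@hausdorff_content_le _ _ _ _ U') => //.
- move=> x /EU[i Uix]; exists (enum_rank i) => /=; first exact: ltn_ord.
  by rewrite U'E enum_rankK.
- by move=> i im; rewrite (r'E (Ordinal im)).
- by move=> i x y im; rewrite (U'E (Ordinal im)) (r'E (Ordinal im)); exact: Ur.
Qed.

Lemma hausdorff_measure_eq0 (s : R) E :
  (forall delta e : R, 0 < delta -> 0 < e -> (hausdorff_content s delta E <= e%:E)%E) ->
  hausdorff_measure s E = 0%E.
Proof.
move=> h; apply/eqP; rewrite eq_le; apply/andP; split.
  apply: ge_ereal_sup => _ [delta d0 <-].
  by apply/lee_addgt0Pr => e e0; rewrite add0e; exact: h.
apply: le_trans (_ : (hausdorff_content s 1 E <= _)%E); last first.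
  by apply: ereal_sup_ubound; exists 1 => //=.
apply: le_ereal_inf_tmp => _ [U _ <-]; apply: nneseries_ge0 => n _ _.
exact: diam_pow_ge0.
Qed.

(** If the contents vanished for every delta, so would the measure. Hence some content is positive
    for some delta, and a cover containing a set of larger diameter already has a term of size at
    least delta to the power [s]. This removes the diameter restriction on covers. *)
Lemma hausdorff_dim_gt_cover E (s : R) : 0 <= s -> (s%:E < hausdorff_dim E)%E ->
  exists2 c : R, 0 < c & forall (m : nat) (U : nat -> set 'cV[R]_d) (r : nat -> R),
    E `<=` \bigcup_(i in `I_m) U i -> (forall i, (i < m)%N -> 0 <= r i) ->
    (forall i x y, (i < m)%N -> U i x -> U i y -> enorm (x - y) <= r i) ->
    c <= \sum_(i < m) r i `^ s.
Proof.
move=> s0 sdim.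
have [delta [delta0 pos]] : exists delta : R, 0 < delta /\ (0 < hausdorff_content s delta E)%E.
  apply: contrapT => no.
  have H0 : hausdorff_measure s E = 0%E.
    apply: hausdorff_measure_eq0 => delta e d0 e0.
    apply: (@le_trans _ _ 0%E); last by rewrite lee_fin ltW.
    by rewrite leNgt; apply/negP => h; apply: no; exists delta.
  move: sdim; rewrite ltNge => /negP; apply; apply: ereal_inf_lbound.
  by exists s.
have [c0 c00 c0le] : exists2 c : R, 0 < c & (c%:E <= hausdorff_content s delta E)%E.
  case: (hausdorff_content s delta E) pos => [r r0|_|//]; first by exists r.
  by exists 1 => //; rewrite leey.
exists (Num.min c0 (delta `^ s)); first by rewrite lt_min c00 powR_gt0.
move=> m U r EU r0 Ur.
have [/forallP small|/forallPn[i]] := boolP [forall i : 'I_m, r i <= delta].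
  rewrite ge_min; apply/orP; left; rewrite -lee_fin; apply: le_trans c0le _.
  apply: (hausdorff_content_le _ _ EU) => //; first exact: ltW.
  by move=> i im; rewrite r0 //= (small (Ordinal im)).
rewrite -ltNge => big; rewrite ge_min; apply/orP; right.
apply: (@le_trans _ _ (r i `^ s)).
  by apply: ge0_ler_powR => //; rewrite ?nnegrE ?ltW // (lt_trans delta0).
rewrite (bigD1 i) //= lerDl; apply: sumr_ge0 => j _; exact: powR_ge0.
Qed.

Lemma hausdorff_dim_gt_fincover E (s : R) : 0 <= s -> (s%:E < hausdorff_dim E)%E ->
  exists2 c : R, 0 < c & forall (I : finType) (A : {set I}) (U : I -> set 'cV[R]_d) (r : I -> R),
    (forall x, E x -> exists2 i, i \in A & U i x) -> (forall i, i \in A -> 0 <= r i) ->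
    (forall i x y, i \in A -> U i x -> U i y -> enorm (x - y) <= r i) ->
    c <= \sum_(i in A) r i `^ s.
Proof.
move=> s0 /(hausdorff_dim_gt_cover s0)[c c0 H]; exists c => // I A U r EU r0 Ur.
pose U' (i : nat) : set 'cV[R]_d := if insub i is Some j then U (@enum_val _ (mem A) j) else set0.
pose r' (i : nat) : R := if insub i is Some j then r (@enum_val _ (mem A) j) else 0.
rewrite big_enum_val /=.
have U'E (j : 'I_#|A|) : U' j = U (enum_val j) by rewrite /U' valK.
have r'E (j : 'I_#|A|) : r' j = r (enum_val j) by rewrite /r' valK.
under eq_bigr do rewrite -r'E.
apply: (H _ U').
- move=> x /EU[i iA Uix]; exists (enum_rank_in iA i) => /=; first exact: ltn_ord.
  by rewrite U'E enum_rankK_in.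
- by move=> i im; rewrite (r'E (Ordinal im)) r0 // enum_valP.
- move=> i x y im; rewrite (U'E (Ordinal im)) (r'E (Ordinal im)) => Ux Uy.
  by apply: (Ur _ _ _ _ Ux Uy); rewrite enum_valP.
Qed.

End HausdorffCovers.

(** * Construction of Frostman weights *)

Section Frostman.
Context {R : realType}.

(** The weight of each point in turn is raised until some constraint through it becomes tight. A
    tight constraint stays tight, since a later point in it has no slack left to use. This finite
    procedure takes the place of a limit of measures in Frostman's lemma. *)
Lemma greedy_weights (I Q : finType) (B : Q -> pred I) (cap : Q -> R) :
  (forall q, 0 <= cap q) -> (forall k, exists q, B q k) ->
  exists w : I -> R, [/\ forall k, 0 <= w k, forall q, \sum_(k | B q k) w k <= cap q
    & forall k, exists2 q, B q k & \sum_(k | B q k) w k = cap q].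
Proof.
move=> cap0 cov.
suff : forall s : seq I, exists w : I -> R, [/\ forall k, 0 <= w k, forall q, \sum_(k | B q k) w k <= cap q
    & forall k, k \in s -> exists2 q, B q k & \sum_(k | B q k) w k = cap q].
  move=> /(_ (enum I))[w [w0 wc wt]]; exists w; split => // k.
  by apply: wt; rewrite mem_enum.
elim => [|k s [w [w0 wc wt]]].
  exists (fun=> 0); split => // q; by rewrite big1.
have [q1 q1k] := cov k.
pose slack q := cap q - \sum_(l | B q l) w l.
pose q0 := [arg min_(q < q1 | B q k) slack q]%O.
have [q0k q0min] : B q0 k /\ forall q, B q k -> slack q0 <= slack q.
  by rewrite /q0; case: arg_minP.
pose w' l := w l + (l == k)%:R * slack q0.
have sumw' q : \sum_(l | B q l) w' l = \sum_(l | B q l) w l + (B q k)%:R * slack q0.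
  rewrite big_split /=; congr (_ + _); rewrite -mulr_suml; congr (_ * _).
  have [Bk|Bk] := boolP (B q k).
    by rewrite (bigD1 k) //= eqxx big1 ?addr0 // => l /andP[_ /negbTE ->].
  by rewrite big1 // => l Bl; case: eqP => // lk; rewrite lk (negbTE Bk) in Bl.
have sl0 q : 0 <= slack q by rewrite subr_ge0.
exists w'; split.
- by move=> l; rewrite addr_ge0 // mulr_ge0.
- move=> q; rewrite sumw'; have [Bk|_] := boolP (B q k); last by rewrite mul0r addr0.
  by rewrite mul1r -lerBrDl; exact: q0min.
- move=> l; rewrite inE => /orP[/eqP ->|/wt[q Bq Eq]].
    by exists q0 => //; rewrite sumw' q0k mul1r addrC subrK.
  exists q => //; rewrite sumw' Eq.
  have [Bk|_] := boolP (B q k); last by rewrite mul0r addr0.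
  have : slack q = 0 by rewrite /slack Eq subrr.
  move=> s0; have := q0min q Bk; rewrite s0 => h.
  by rewrite (@le_anti _ _ (slack q0) 0) ?mulr0 ?addr0 // h sl0.
Qed.

(** Vitali selection: take a member of largest radius, discard whatever meets it, and repeat. *)
Lemma vitali_subfamily (T : finType) (meets : rel T) (rad : T -> R) (A : {set T}) :
  reflexive meets -> symmetric meets ->
  exists D : {set T}, [/\ D \subset A,
    forall x y, x \in D -> y \in D -> x != y -> ~~ meets x y
  & forall x, x \in A -> exists y, [/\ y \in D, meets x y & rad x <= rad y]].
Proof.
move=> mxx msym; have [n] := ubnP #|A|; elim: n A => // n IH A; rewrite ltnS => An.
have [->|/finset.set0Pn[x0 Ax0]] := eqVneq A finset.set0.
  by exists finset.set0; split => // [x y|x]; rewrite inE.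
pose z := [arg max_(x > x0 | x \in A) rad x]%O.
have [Az zmax] : z \in A /\ forall x, x \in A -> rad x <= rad z.
  by rewrite /z; case: arg_maxP.
pose A' := [set x in A | ~~ meets x z]%SET.
have [] := IH A'.
  apply: leq_trans An; apply: proper_card; apply/fintype.properP; split.
    by apply/fintype.subsetP => x; rewrite inE => /andP[].
  by exists z => //; rewrite inE mxx andbF.
move=> D [DA disj cov].
exists (z |: D)%SET; split.
- rewrite finset.subUset finset.sub1set Az /=; apply: fintype.subset_trans DA _.
  by apply/fintype.subsetP => x; rewrite inE => /andP[].
- move=> x y /finset.setU1P[->|Dx] /finset.setU1P[->|Dy]; rewrite ?eqxx //.
  + by have := fintype.subsetP DA _ Dy; rewrite inE msym => /andP[].
  + by have := fintype.subsetP DA _ Dx; rewrite inE => /andP[].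
  + exact: disj.
- move=> x Ax; have [mxz|nxz] := boolP (meets x z).
    by exists z; rewrite finset.setU11 mxz zmax.
  have [|y [Dy mxy rxy]] := cov x; first by rewrite inE Ax.
  by exists y; rewrite finset.setU1r.
Qed.

Lemma finite_net d (E : set 'cV[R]_d) (e : R) : compact E -> 0 < e ->
  exists (N : nat) (x : 'I_N -> 'cV[R]_d), (forall i, E (x i)) /\
    (forall y, E y -> exists i, enorm (y - x i) <= e).
Proof.
move=> cE e0.
pose r := e / d.+1%:R.
have r0 : 0 < r by rewrite divr_gt0.
move: cE; rewrite compact_cover => /(_ 'cV[R]_d E (fun x => ball x r)).
case=> [x _||D DE cov]; first exact: ball_open.
  by move=> x Ex; exists x => //; exact: ballxx.
exists (size (finmap.enum_fset D)), (fun i => nth 0 (finmap.enum_fset D) i); split.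
  move=> i; have := DE (nth 0 (finmap.enum_fset D) i); rewrite inE; apply.
  by rewrite mem_nth.
move=> y /cov[x /= xD xy]; have iD : (index x (finmap.enum_fset D) < size (finmap.enum_fset D))%N.
  by rewrite index_mem.
exists (Ordinal iD) => /=; rewrite nth_index //.
apply: le_trans (enorm_le_norm _) _.
move: xy; rewrite -ball_normE /= distrC => /ltW h.
apply: le_trans (ler_wpM2l _ h) _ => //.
by rewrite /r mulrCA ler_piMr ?ltW // ltr_pdivrMr // mul1r ltr_nat.
Qed.

(** On a net of mesh 2^-n, weights are made maximal subject to mass at most rad^s in each dyadic
    ball; every net point then lies in a saturated ball. A Vitali selection of saturated balls has
    fourfold enlargements covering [E], so the positive content of [E] bounds the total mass from
    below, and the weights can be normalised. *)
Lemma frostman d (E : set 'cV[R]_d) (s : R) : compact E -> 0 < s ->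
  (s%:E < hausdorff_dim E)%E ->
  exists2 C : R, 0 < C & forall n : nat,
    exists (N : nat) (x : 'I_N -> 'cV[R]_d) (w : 'I_N -> R),
    [/\ forall i, E (x i), forall i, 0 <= w i, \sum_i w i = 1 &
      forall (P : pred 'I_N) (r : R), 2^-1 ^+ n <= r ->
        (forall i j, P i -> P j -> enorm (x i - x j) <= r) ->
        \sum_(i | P i) w i <= C * r `^ s].
Proof.
move=> cE s0 /(hausdorff_dim_gt_fincover (ltW s0))[c c0 H].
(* The enlarged balls have radius 4 rad, hence diameter at most 8 rad. *)
pose c' := c / 8 `^ s.
have c'0 : 0 < c' by rewrite divr_gt0 // powR_gt0.
(* The 1 serves radii above 1, where total mass 1 suffices; the other term pays for rounding the
   radius to a power of two and for the normalisation. *)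
exists (Num.max 1 (2 `^ s / c')); first by rewrite lt_max ltr01.
move=> n.
have h0 j : 0 < (2^-1 : R) ^+ j by rewrite exprn_gt0 // invr_gt0.
have [N [x [xE net]]] := finite_net cE (h0 n).
pose Q := ('I_N * 'I_n.+1)%type.
pose rad (q : Q) : R := 2^-1 ^+ q.2.
pose B (q : Q) (k : 'I_N) := enorm (x k - x q.1) <= rad q.
pose cap (q : Q) := rad q `^ s.
have rad0 q : 0 < rad q by exact: h0.
have cov k : exists q, B q k.
  by exists (k, ord0); rewrite /B subrr enorm0 ltW.
have [w [w0 wc wt]] := @greedy_weights _ _ B cap (fun q => powR_ge0 _ _) cov.
pose A := [set q | \sum_(k | B q k) w k == cap q]%SET.
pose meets (q q' : Q) := [exists k, B q k && B q' k].
have [||D [DA disj Dcov]] := @vitali_subfamily Q meets rad A.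
- by move=> q; apply/existsP; exists q.1; rewrite /B subrr enorm0 ltW.
- by move=> q q'; apply: eq_existsb => k; rewrite andbC.
have W : c' <= \sum_k w k.
  have Wd : \sum_(q in D) rad q `^ s <= \sum_k w k.
    rewrite (eq_bigr (fun q => \sum_k (B q k)%:R * w k)); last first.
      move=> q /(fintype.subsetP DA); rewrite inE => /eqP; rewrite -/(cap q) => <-.
      by rewrite big_mkcond; apply: eq_bigr => k _; case: ifP => _; rewrite ?mul1r ?mul0r.
    rewrite exchange_big; apply: ler_sum => k _; rewrite -mulr_suml ler_piMl //.
    have [[q [Dq Bq]]|no] := pselect (exists q, q \in D /\ B q k); last first.
      rewrite big1 // => q Dq; case: (boolP (B q k)) => // Bq; exfalso; apply: no; by exists q.
    rewrite (bigD1 q) //= Bq big1 ?addr0 // => q' /andP[Dq' qq'].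
    have := disj _ _ Dq' Dq qq'; rewrite /meets => /existsPn /(_ k).
    by rewrite Bq andbT => /negbTE ->.
  apply: le_trans Wd; rewrite ler_pdivrMr ?powR_gt0 // mulr_suml.
  under eq_bigr do rewrite -powRM ?(ltW (rad0 _)) //.
  apply: (H _ D (fun q => [set y | enorm (y - x q.1) <= 4 * rad q])).
  - move=> y /net[k yk]; have [q Bq Aq] := wt k.
    have [|q' [Dq' /existsP[k' /andP[Bk Bk']] rq]] := Dcov q; first by rewrite inE Aq.
    exists q' => //=.
    (* Four steps, each at most [rad q']: to the net point [x k], to the centre of [q], to the
       common point [x k'], to the centre of [q']. *)
    apply: le_trans (enorm_dist3 _ (x k) _) _.
    have := enorm_dist3 (x k) (x k') (x q'.1); have := enorm_dist3 (x k) (x q.1) (x k').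
    have nrad : 2^-1 ^+ n <= rad q.
      by rewrite /rad ler_wiXn2l // ?invr_ge0 ?invf_le1 ?ler1n // -ltnS.
    move: Bq Bk Bk'; rewrite /B (enormB (x k') (x q.1)); lra.
  - by move=> q _; rewrite mulr_ge0 // ltW.
  - move=> q y z _ /= hy hz; apply: le_trans (enorm_dist3 _ (x q.1) _) _.
    by rewrite (enormB (x q.1)); lra.
pose T := \sum_k w k.
have T0 : 0 < T by exact: lt_le_trans W.
exists N, x, (fun k => w k / T); split => //.
- by move=> k; rewrite divr_ge0 // ltW.
- by rewrite -mulr_suml divff // lt0r_neq0.
move=> P r nr Pr; rewrite -mulr_suml.
have [/existsP[i Pi]|/existsPn noP] := boolP [exists i, P i]; last first.
  rewrite big1 ?mul0r ?mulr_ge0 ?powR_ge0 ?le_max ?ler01 // => i Pi.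
  by have := noP i; rewrite Pi.
have r0 : 0 < r by apply: lt_le_trans nr.
have [r1|r1] := leP r 1; last first.
  apply: (@le_trans _ _ 1); first rewrite ler_pdivrMr // mul1r.
    by rewrite /T [leRHS](bigID P) /= lerDl sumr_ge0.
  apply: (@le_trans _ _ (1 * 1)); first by rewrite mulr1.
  apply: ler_pM => //; first by rewrite le_max lexx.
  apply: (@le_trans _ _ (1 `^ s)); first by rewrite powR1.
  by apply: ge0_ler_powR; rewrite ?nnegrE ?ltW.
(* The set [P] lies in the dyadic ball of radius 2^-j, between r and 2 r, about any of its
   points. *)
have [j [jn rj jr]] : exists j, [/\ (j <= n)%N, r <= 2^-1 ^+ j & 2^-1 ^+ j <= 2 * r].
  have ex : exists j, (j <= n)%N && (r <= 2^-1 ^+ j) by exists 0%N; rewrite expr0.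
  have bd j : (j <= n)%N && (r <= 2^-1 ^+ j) -> (j <= n)%N by case/andP.
  case: (ex_maxnP ex bd) => j /andP[jn rj] jmax.
  exists j; split => //; rewrite leNgt; apply/negP => lt.
  have jn' : (j < n)%N.
    rewrite ltn_neqAle jn andbT; apply: contraTneq lt => ->; rewrite -leNgt.
    by apply: le_trans nr _; rewrite ler_peMl ?ler1n // ltW.
  have := jmax j.+1; rewrite jn' ltnn => h; suff : false by []; apply: h.
  by rewrite exprS ler_pdivlMl // ltW.
pose q : Q := (i, inord j).
have qr : rad q = 2^-1 ^+ j by rewrite /rad inordK.
rewrite ler_pdivrMr //.
apply: (@le_trans _ _ (2 `^ s / c' * r `^ s * T)); last first.
  by rewrite ler_wpM2r ?(ltW T0) // ler_wpM2r ?powR_ge0 // le_max lexx orbT.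
apply: (@le_trans _ _ (cap q)).
  apply: le_trans (wc q); rewrite [leRHS](bigID P) /= -[leLHS]addr0 lerD ?sumr_ge0 //.
  rewrite le_eqVlt; apply/orP; left; apply/eqP; apply: eq_bigl => k.
  by case: (boolP (P k)) => Pk; rewrite ?andbF // andbT /B qr (le_trans (Pr _ _ Pk Pi)).
rewrite /cap qr; apply: (@le_trans _ _ ((2 * r) `^ s)).
  apply: ge0_ler_powR => //; rewrite ?nnegrE; [exact: ltW|exact: ltW (h0 j)|].
  by rewrite mulr_ge0 // ltW.
rewrite powRM ?(ltW r0) //.
have -> : 2 `^ s / c' * r `^ s * T = 2 `^ s * r `^ s * (T / c') by ring.
by rewrite ler_peMr ?mulr_ge0 ?powR_ge0 // ler_pdivlMr // mul1r.
Qed.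

End Frostman.

(** * The norm of a convex body *)

Section BodyNorm.
Context {R : realType} {d : nat}.
Implicit Types (x y : 'cV[R]_d).
Variable K : set 'cV[R]_d.
Hypothesis bodyK : convex_body K.
Hypothesis symK : origin_symmetric K.

Lemma convex_body_conv x y (a : R) : K x -> K y -> 0 <= a <= 1 ->
  K (a *: x + (1 - a) *: y).
Proof.
move=> Kx Ky a01; case: bodyK => cK _ _.
have h := cK x y (Itv01 (proj1 (andP a01)) (proj2 (andP a01))) (mem_set Kx) (mem_set Ky).
by move: h; rewrite inE.
Qed.

(** If [x0] is interior, a small [y] is the midpoint of [x0 + y] and [y - x0], both in [K] by
    symmetry. *)
Lemma convex_body_ball : exists2 r, 0 < r & forall x, enorm x <= r -> K x.
Proof.
case: bodyK => _ _ [x0 /nbhs_interior/nbhs_singleton].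
rewrite /interior => /nbhs_ballP[e /= e0 eK].
exists (e / 2); first by rewrite divr_gt0.
move=> y hy; have ye : `|y| < e.
  by apply: le_lt_trans (norm_le_enorm _) _; apply: le_lt_trans hy _; rewrite ltr_pdivrMr // ltr_pMr ?ltr1n.
have K1 : K (x0 + y) by apply: eK; rewrite -ball_normE /= opprD addNKr normrN.
have K2 : K (x0 - y) by apply: eK; rewrite -ball_normE /= opprB addrC subrK.
have := convex_body_conv K1 (symK K2) (_ : 0 <= 2^-1 <= 1).
have -> : 2^-1 *: (x0 + y) + (1 - 2^-1) *: - (x0 - y) = y.
  by apply/matrixP => i j; rewrite !mxE; lra.
by apply; lra.
Qed.

Lemma convex_body_bounded : exists2 r, 0 < r & forall x, K x -> enorm x <= r.
Proof.
case: bodyK => _ [M [_ HM]] _.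
exists (d.+1%:R * (`|M| + 1)); first by rewrite mulr_gt0 // ltr_pwDr.
move=> x Kx; have := HM (`|M| + 1) _ x Kx => h.
apply: le_trans (enorm_le_norm _) _; apply: ler_pM => //; first by rewrite ler_nat.
by apply: h; rewrite ltr_pwDr // ler_norm.
Qed.

Lemma convex_body0 : K 0.
Proof. by have [r r0] := convex_body_ball; apply; rewrite enorm0 ltW. Qed.

Lemma convex_body_shrink x (a : R) : 0 <= a <= 1 -> K x -> K (a *: x).
Proof.
move=> a01 Kx; have := convex_body_conv Kx convex_body0 a01.
by rewrite scaler0 addr0.
Qed.

Let scales x := [set t : R | 0 < t /\ exists2 y, K y & x = t *: y].

Lemma scales_lbound x : lbound (scales x) 0.
Proof. by move=> t [/ltW]. Qed.

Lemma scales_ball r x t : 0 < r -> (forall x, enorm x <= r -> K x) ->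
  0 < t -> enorm x <= r * t -> scales x t.
Proof.
move=> r0 rK t0 xt; split => //; exists (t^-1 *: x).
  by apply: rK; rewrite enormZ gtr0_norm ?invr_gt0 // ler_pdivrMl // mulrC.
by rewrite scalerA divff ?scale1r // lt0r_neq0.
Qed.

Lemma scales_nonempty x : scales x !=set0.
Proof.
have [r r0 rK] := convex_body_ball.
exists (enorm x / r + 1); apply: (scales_ball r0 rK).
  by rewrite ltr_pwDr // divr_ge0 ?enorm_ge0 // ltW.
by rewrite mulrDr mulrCA divff ?lt0r_neq0 // mulr1 lerDl mulr1 ltW.
Qed.

Lemma body_norm_ge0 x : 0 <= body_norm K x.
Proof. by apply: lb_le_inf; [exact: scales_nonempty | exact: scales_lbound]. Qed.

Lemma body_norm_le x t : scales x t -> body_norm K x <= t.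
Proof. by move=> st; apply: ge_inf => //; exists 0; exact: scales_lbound. Qed.

Lemma scales_up x s t : scales x s -> s <= t -> scales x t.
Proof.
move=> [s0 [y Ky ->]] st; have t0 : 0 < t by exact: lt_le_trans st.
split => //; exists ((s / t) *: y).
  apply: convex_body_shrink => //; apply/andP; split.
    by rewrite divr_ge0 // ltW.
  by rewrite ler_pdivrMr // mul1r.
by rewrite scalerA mulrCA divff ?mulr1 // lt0r_neq0.
Qed.

Lemma body_norm_lt x t : body_norm K x < t -> scales x t.
Proof.
move=> /(inf_lt (scales_nonempty x))[s sx st].
exact: scales_up sx (ltW st).
Qed.

Lemma body_norm_le_enorm r x : 0 < r -> (forall x, enorm x <= r -> K x) ->
  body_norm K x <= enorm x / r.
Proof.
move=> r0 rK; apply/ler_addgt0Pr => e e0.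
apply: body_norm_le; apply: (scales_ball r0 rK).
  by rewrite ltr_pwDr // divr_ge0 ?enorm_ge0 // ltW.
by rewrite mulrDr mulrCA divff ?lt0r_neq0 // mulr1 lerDl mulr_ge0 // ltW.
Qed.

Lemma enorm_le_body_norm r x : 0 < r -> (forall x, K x -> enorm x <= r) ->
  enorm x <= r * body_norm K x.
Proof.
move=> r0 Kr; rewrite mulrC -ler_pdivrMr //; apply: lb_le_inf; first exact: scales_nonempty.
move=> t [t0 [y Ky ->]]; rewrite enormZ gtr0_norm // ler_pdivrMr //.
by rewrite ler_pM2l // Kr.
Qed.

Lemma body_norm0 : body_norm K 0 = 0.
Proof.
have [r r0 rK] := convex_body_ball.
apply/eqP; rewrite eq_le body_norm_ge0 andbT.
by have := body_norm_le_enorm 0 r0 rK; rewrite enorm0 mul0r.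
Qed.

Lemma body_normN x : body_norm K (- x) = body_norm K x.
Proof.
rewrite /body_norm; congr inf; apply/seteqP; split => t /= [t0 [y Ky e]]; split => //; exists (- y).
- exact: symK.
- by rewrite scalerN -e opprK.
- exact: symK.
- by rewrite scalerN -e.
Qed.

Lemma body_norm_posZ x (a : R) : 0 < a -> body_norm K (a *: x) = a * body_norm K x.
Proof.
have le (b : R) y : 0 < b -> body_norm K (b *: y) <= b * body_norm K y.
  move=> b0; apply/ler_addgt0Pr => e e0.
  have [|t0 [z Kz ez]] := @body_norm_lt y (body_norm K y + e / b); first by rewrite ltrDl divr_gt0.
  apply: body_norm_le; split; first by rewrite ltr_pwDr // mulr_ge0 ?body_norm_ge0 // ltW.
  exists z => //; rewrite {1}ez scalerA mulrDr [b * (e / b)]mulrCA divff ?mulr1 //.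
  by rewrite lt0r_neq0.
move=> a0; apply/eqP; rewrite eq_le le //=.
have := le a^-1 (a *: x); rewrite invr_gt0 => /(_ a0).
by rewrite scalerA mulVf ?scale1r ?lt0r_neq0 // ler_pdivlMl.
Qed.

Lemma body_normZ x (a : R) : body_norm K (a *: x) = `|a| * body_norm K x.
Proof.
have [a0|a0|->] := ltgtP a 0; last by rewrite scale0r normr0 mul0r body_norm0.
  by rewrite ltr0_norm // -body_norm_posZ ?oppr_gt0 // scaleNr body_normN.
by rewrite gtr0_norm // body_norm_posZ.
Qed.

Lemma ler_body_normD x y : body_norm K (x + y) <= body_norm K x + body_norm K y.
Proof.
apply/ler_addgt0Pr => e e0.
have e2 : 0 < e / 2 by rewrite divr_gt0.
have [|t0 [z Kz ez]] := @body_norm_lt x (body_norm K x + e / 2); first by rewrite ltrDl.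
have [|s0 [u Ku eu]] := @body_norm_lt y (body_norm K y + e / 2); first by rewrite ltrDl.
set t := _ + e / 2 in t0 ez; set s := _ + e / 2 in s0 eu.
have ts : 0 < t + s by rewrite addr_gt0.
have -> : body_norm K x + body_norm K y + e = t + s by rewrite /t /s; lra.
apply: body_norm_le; split => //; exists ((t / (t + s)) *: z + (1 - t / (t + s)) *: u).
  apply: convex_body_conv => //; apply/andP; split; first by rewrite divr_ge0 // ltW.
  by rewrite ler_pdivrMr // mul1r lerDl ltW.
have -> : 1 - t / (t + s) = s / (t + s) by field; rewrite lt0r_neq0.
rewrite scalerDr !scalerA !(mulrCA (t + s)) divff ?mulr1 ?lt0r_neq0 //.
by rewrite -ez -eu.
Qed.

Lemma body_norm_dist r x y : 0 < r -> (forall x, enorm x <= r -> K x) ->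
  `|body_norm K x - body_norm K y| <= enorm (x - y) / r.
Proof.
move=> r0 rK.
have le u v : body_norm K u - body_norm K v <= enorm (u - v) / r.
  rewrite lerBlDr; apply: le_trans (_ : body_norm K (u - v) + body_norm K v <= _).
    by rewrite -{1}(subrK v u) ler_body_normD.
  by rewrite lerD2r body_norm_le_enorm.
by rewrite ler_norml le andbT lerNl opprB enormB le.
Qed.

End BodyNorm.

Lemma compact_difference_image {R : realType} {d : nat} (f : 'cV[R]_d -> R) (C : R)
    (E : set 'cV[R]_d) : (forall x y, `|f x - f y| <= C * enorm (x - y)) ->
  compact E -> compact [set f (x - y) | x in E & y in E].
Proof.
move=> fC cE.
have C0 : 0 <= `|C| * d.+1%:R by rewrite mulr_ge0.
have fc : continuous f.
  move=> x; apply/(@cvgrPdist_lt R R 'cV[R]_d (nbhs x)) => e e0.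
  have ep : 0 < e / (`|C| * d.+1%:R + 1) by rewrite divr_gt0 // ltr_pwDr.
  near=> y; apply: le_lt_trans (fC _ _) _.
  apply: (@le_lt_trans _ _ ((`|C| * d.+1%:R) * `|x - y|)).
    apply: (@le_trans _ _ (`|C| * enorm (x - y))); first by rewrite ler_wpM2r ?enorm_ge0 ?ler_norm.
    rewrite -mulrA ler_wpM2l //; apply: le_trans (enorm_le_norm _) _.
    by rewrite ler_wpM2r // ler_nat.
  have : `|x - y| < e / (`|C| * d.+1%:R + 1).
    by near: y; apply: cvgr_dist_lt.
  rewrite ltr_pdivlMr ?ltr_pwDr // mulrDr mulr1 mulrC => h.
  by apply: le_lt_trans h; rewrite lerDl.
have -> : [set f (x - y) | x in E & y in E] = (fun p : 'cV[R]_d * 'cV[R]_d => f (p.1 - p.2)) @` (E `*` E).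
  apply/seteqP; split => [_ [x Ex [y Ey <-]]|_ [[x y] [Ex Ey] <-]]; first by exists (x, y).
  by exists x => //; exists y.
apply: continuous_compact; last exact: compact_setX.
apply: continuous_subspaceT => p.
apply: continuous_comp; last exact: fc.
apply: cvgB; [exact: cvg_fst | exact: cvg_snd].
Unshelve. all: by end_near. Qed.

(** * Reduction to second moments of distance counts *)

Lemma exists_half_pow_le {R : realType} (e : R) : 0 < e -> exists m : nat, 2^-1 ^+ m <= e.
Proof.
move=> e0; exists (Num.truncn e^-1).+1.
rewrite exprVn -[leRHS]invrK lef_pV2 ?posrE ?invr_gt0 ?exprn_gt0 //.
apply: le_trans (ltW (truncnS_gt _)) _.
by rewrite -natrX ler_nat ltnW // ltn_expl.
Qed.

Section DistanceReduction.
Context {R : realType} {d : nat}.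
Notation mxT := (borel_mx R d).
Local Notation SO := (@SO R d).
Variable mu : probability mxT R.
Hypothesis haar_mu : is_haar_SO mu.

Lemma rot_mean_comb_le (I : finType) (a c : I -> R) (f : I -> 'M[R]_d -> R) :
  (forall i, 0 <= a i) -> (forall i, measurable_fun setT (f i : mxT -> R)) ->
  (forall i rho, 0 <= f i rho) -> (forall i, (rot_mean mu (f i) <= (c i)%:E)%E) ->
  (rot_mean mu (fun rho => (\sum_i a i * f i rho)%R) <= (\sum_i a i * c i)%:E)%E.
Proof.
move=> a0 mf f0 fc; rewrite rot_mean_sum.
- rewrite -sumEFin; apply: lee_sum => i _.
  by rewrite rot_meanZ // EFinM lee_wpmul2l // lee_fin.
- by move=> i; exact: measurable_funM.
- by move=> i rho; exact: mulr_ge0.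
Qed.

Lemma distance_set_rotateE (K E : set 'cV[R]_d) (rho : 'M[R]_d) :
  distance_set K (rotate rho E) = [set body_norm K (rho *m (x - y)) | x in E & y in E].
Proof.
apply/seteqP; split => [_ [_ [x Ex <-] [_ [y Ey <-] <-]]|_ [x Ex [y Ey <-]]].
  by exists x => //; exists y => //; rewrite mulmxBr.
exists (rho *m x); first by exists x.
by exists (rho *m y); [exists y|rewrite mulmxBr].
Qed.

Lemma compact_distance_rotate (K E : set 'cV[R]_d) (rho : 'M[R]_d) :
  convex_body K -> origin_symmetric K -> SO rho -> compact E ->
  compact (distance_set K (rotate rho E)).
Proof.
move=> bK sK srho cE; rewrite distance_set_rotateE.
have [r r0 rK] := convex_body_ball bK sK.
apply: (@compact_difference_image _ _ (fun x => body_norm K (rho *m x)) r^-1) => // x y.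
apply: le_trans (body_norm_dist bK sK _ _ r0 rK) _.
by rewrite -mulmxBr SO_enorm // mulrC.
Qed.

(* [v] bounds the normalised second moment of the number of weighted pairs of
   points whose distance is close to a grid point. *)
Definition distance_counts (K E : set 'cV[R]_d) (n : nat) (rho : 'M[R]_d) (v : R) : Prop :=
  exists (N : nat) (x : 'I_N -> 'cV[R]_d) (W : 'I_N * 'I_N -> R) (h : R) (J T : nat),
  [/\ [/\ forall i, E (x i), forall e, 0 <= W e & 2^-1 <= \sum_e W e],
      [/\ 0 < h, (0 < J)%N & J%:R * h <= 2^-1 ^+ n],
      forall e, 0 <= body_norm K (rho *m (x e.1 - x e.2)) < (T%:R - J%:R) * h
    & h * \sum_(l < T) (\sum_(e | `|body_norm K (rho *m (x e.1 - x e.2)) - l%:R * h| <= J%:R * h) W e) ^+ 2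
      <= v * (J%:R * h) ^+ 2].

Lemma ae_positive_distance (K E : set 'cV[R]_d) (C : R) :
  convex_body K -> origin_symmetric K -> compact E ->
  (forall n, exists Phi : 'M[R]_d -> R, [/\ measurable_fun setT (Phi : mxT -> R),
     forall rho, 0 <= Phi rho, (rot_mean mu Phi <= C%:E)%E &
     forall rho, SO rho -> distance_counts K E n rho (Phi rho)]) ->
  {ae mu, forall rho : mxT, SO rho -> (0 < lebesgue_measure (distance_set K (rotate rho E)))%E}.
Proof.
move=> bK sK cE /choice[Phi HPhi].
apply: (@ae_rotation_liminf _ _ mu Phi C); try by move=> n; case: (HPhi n).
move=> rho srho L HL.
pose L' := Num.max L 1.
have L'0 : 0 < L' by rewrite lt_max ltr01 orbT.
(* The total weight is at least 1/2, and its square is at most L' times the length that [count_hits]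
   provides. *)
apply: (@pos_measure_of_counts _ _ (4 * L')^-1).
- by rewrite invr_gt0 mulr_gt0.
- exact: compact_distance_rotate.
move=> e e0.
have [m me] := exists_half_pow_le e0.
have [n mn PhiL] := HL m.
have [_ _ _ /(_ rho srho)] := HPhi n.
case=> N [x [W [h [J [T [[xE W0 W1] [h0 J0 Jh] tauT HC]]]]]].
have [|s [us sD sW]] := @count_hits R ('I_N * 'I_N)%type W
    (fun e => body_norm K (rho *m (x e.1 - x e.2))) h L' J T h0 J0 (ltW L'0) W0 tauT.
  apply: le_trans HC _; rewrite ler_wpM2r ?sqr_ge0 //.
  by apply: le_trans PhiL _; rewrite le_max lexx.
have ne : 2^-1 ^+ n <= e.
  by apply: le_trans me; rewrite ler_wiXn2l // ?invr_ge0 ?invf_le1 ?ler1n.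
exists h, (J%:R * h), s; split => //.
- rewrite h0 /=; apply: le_trans ne; apply: le_trans Jh.
  by rewrite ler_peMl ?ler1n // ltW.
- exact: le_trans ne.
- move=> l /sD[q Wq hq]; exists (body_norm K (rho *m (x q.1 - x q.2))) => //.
  by rewrite distance_set_rotateE; exists (x q.1) => //; exists (x q.2).
- rewrite invfM ler_pdivrMr // mulrC; apply: le_trans sW.
  apply: (@le_trans _ _ (2^-1 ^+ 2)); first by rewrite expr2 -invfM -natrM.
  by rewrite ler_sqr ?nnegrE // ?(le_trans _ W1).
Qed.

End DistanceReduction.

(** A ball about the origin lies in [K], so every inequality with a nonzero normal has a positive
    right-hand side and can be scaled to 1. The norm is then the maximum of the scaled forms;
    boundedness of [K] ensures that there is at least one form. *)
Lemma polyhedral_norm {R : realType} {d : nat} (K : set 'cV[R]_d) : (0 < d)%N ->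
  convex_body K -> polyhedron K -> origin_symmetric K ->
  exists (I : finType) (c : I -> 'cV[R]_d), (forall i, c i != 0) /\
    forall x, exists i, body_norm K x = dot (c i) x.
Proof.
move=> d0 bK [n [a [b KE]]] sK.
have [r r0 rK] := convex_body_ball bK sK.
have [r' r'0 Kr'] := convex_body_bounded bK.
have b0 i : a i != 0 -> 0 < b i.
  move=> ai; have ea : 0 < enorm (a i) by rewrite enorm_gt0.
  have := rK ((r / enorm (a i)) *: a i); rewrite KE /=.
  rewrite enormZ gtr0_norm ?divr_gt0 // divfK ?lt0r_neq0 // lexx => /(_ isT) /(_ i).
  by rewrite dotZr -sqr_enorm; apply: lt_le_trans; rewrite mulr_gt0 ?divr_gt0 ?exprn_gt0.
have b00 i : 0 <= b i.
  by have := convex_body0 bK sK; rewrite KE => /(_ i); rewrite dotC dot0l.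
pose I := {i : 'I_n | a i != 0}.
pose c (i : I) := (b (val i))^-1 *: a (val i).
have scaleP x t : 0 < t -> (exists2 y, K y & x = t *: y) <-> forall i, dot (c i) x <= t.
  move=> t0; split => [[y Ky ->] i|H].
    rewrite dotZr -[leRHS]mulr1 ler_pM2l // /c dotZl ler_pdivrMl ?b0 ?(valP i) // mulr1.
    by move: Ky; rewrite KE; apply.
  exists (t^-1 *: x); last by rewrite scalerA divff ?scale1r // lt0r_neq0.
  rewrite KE => i /=; rewrite dotZr ler_pdivrMl //.
  have [->|ai] := eqVneq (a i) 0; first by rewrite dot0l mulr_ge0 // ltW.
  have := H (exist _ i ai); rewrite /c /= dotZl ler_pdivrMl ?b0 //.
  by rewrite mulrC.
have [i1 _] : exists i : I, true.
  apply: contrapT => no.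
  have [|y Ky] := proj2 (scaleP ((r' + 1) *: basis_vec (Ordinal d0)) 1 ltr01).
    by move=> i; exfalso; apply: no; exists i.
  rewrite scale1r => yE; have := Kr' _ Ky.
  by rewrite -yE enormZ enorm_basis_vec mulr1 gtr0_norm ?addr_gt0 // gerDl ler10.
exists I, c; split.
  by move=> i; rewrite scaler_eq0 invr_eq0 negb_or (lt0r_neq0 (b0 _ (valP i))) (valP i).
move=> x; pose i := [arg max_(i > i1) dot (c i) x]%O.
have imax j : dot (c j) x <= dot (c i) x.
  by rewrite /i; case: arg_maxP => // k _; apply.
exists i; have [m0|m0] := ltP 0 (dot (c i) x).
  apply/eqP; rewrite eq_le; apply/andP; split.
    by apply: body_norm_le => //; split => //; apply/scaleP.
  apply: lb_le_inf; first exact: scales_nonempty.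
  by move=> t [t0 /(scaleP x t t0)]; apply.
have x0 : x = 0.
  apply/eqP; rewrite -enorm_eq0 eq_le enorm_ge0 andbT.
  apply: le_trans (enorm_le_body_norm bK sK x r'0 Kr') _.
  rewrite pmulr_rle0 //; apply/ler_addgt0Pr => e e0; rewrite add0r.
  apply: body_norm_le => //; split => //; apply/scaleP => // j.
  by apply: le_trans (imax j) _; apply: le_trans m0 _; exact: ltW.
by rewrite x0 body_norm0 // dotC dot0l.
Qed.

Lemma weighted_cauchy_schwarz {R : realType} (I : finType) (w u : I -> R) :
  (forall i, 0 <= w i) -> \sum_i w i = 1 ->
  (\sum_i w i * u i) ^+ 2 <= \sum_i w i * u i ^+ 2.
Proof.
move=> w0 w1.
have := sum_cauchy_schwarz xpredT (fun i => Num.sqrt (w i)) (fun i => Num.sqrt (w i) * u i).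
under eq_bigr do rewrite mulrA -expr2 sqr_sqrtr //.
under [X in _ <= X * _]eq_bigr do rewrite sqr_sqrtr //.
rewrite w1 mul1r => /le_trans; apply.
by apply: ler_sum => i _; rewrite exprMn sqr_sqrtr.
Qed.

Lemma geometric_sum_le {R : realType} (q : R) (n : nat) : 0 <= q < 1 ->
  \sum_(k < n) q ^+ k <= (1 - q)^-1.
Proof.
move=> /andP[q0 q1].
rewrite -[leLHS](mulfK (_ : 1 - q != 0)); last by rewrite subr_eq0 eq_sym lt_eqF.
rewrite ler_piMl ?invr_ge0 ?subr_ge0 ?(ltW q1) //.
by rewrite mulrC -opprB mulNr -subrX1 opprB gerBl exprn_ge0.
Qed.

(** * Riesz sums of Frostman weights *)

Section Frostman_energy.
Context {R : realType} {d : nat}.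

Definition frostman_weights (C s : R) (n N : nat) (x : 'I_N -> 'cV[R]_d) (w : 'I_N -> R) : Prop :=
  [/\ forall i, 0 <= w i, \sum_i w i = 1 &
    forall (P : pred 'I_N) (r : R), 2^-1 ^+ n <= r ->
      (forall i j, P i -> P j -> enorm (x i - x j) <= r) ->
      \sum_(i | P i) w i <= C * r `^ s].

Lemma frostman_ball (C s : R) n N (x : 'I_N -> 'cV[R]_d) w : frostman_weights C s n x w ->
  forall z (r : R), 2^-1 ^+ n <= r -> \sum_(i | enorm (z - x i) <= r) w i <= C * (2 * r) `^ s.
Proof.
move=> [w0 _ H] z r nr; have n0 : 0 < (2^-1 : R) ^+ n by rewrite exprn_gt0 // invr_gt0.
apply: H => [|i j hi hj]; first by lra.
by apply: le_trans (enorm_dist3 _ z _) _; rewrite (enormB _ z); lra.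
Qed.

(** A discrete Riesz potential of order 1. The kernel is dominated by dyadic ball indicators, and
    the Frostman bound turns the sum into a geometric series of ratio 2^(1-s), convergent because s
    > 1. *)
Lemma frostman_riesz (C s : R) : 1 < s -> 0 < C ->
  exists2 C' : R, 0 < C' & forall n N (x : 'I_N -> 'cV[R]_d) w, frostman_weights C s n x w ->
    forall z, \sum_i w i * (if enorm (z - x i) <= 2^-1 ^+ n then 1 else 2^-1 ^+ n / enorm (z - x i))
      <= C' * 2^-1 ^+ n.
Proof.
move=> s1 C0; pose q : R := 2 * 2^-1 `^ s.
have hs0 : 0 < (2^-1 : R) `^ s by rewrite powR_gt0 // invr_gt0.
have q01 : 0 <= q < 1.
  rewrite mulr_ge0 ?(ltW hs0) //= /q -(mulr_powRB1 (_ : 0 <= 2^-1 :> R)) ?invr_ge0 //; last by lra.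
  rewrite mulrA divff // mul1r -[ltRHS](congr1 (fun f => f (s - 1)) (@powR1 R)).
  by apply: gt0_ltr_powR; rewrite ?nnegrE ?subr_gt0 ?invr_ge0 // invf_lt1 ?ltr1n.
pose C' := 1 + 2 * (C * 2 `^ s * (1 - q)^-1).
exists C'.
  rewrite ltr_pwDl // !mulr_ge0 ?powR_ge0 ?(ltW C0) // invr_ge0 subr_ge0 ltW //.
  by case/andP: q01.
move=> n N x w Hw z; have [w0 w1 _] := Hw.
set h := 2^-1 ^+ n.
have h0 : 0 < h by rewrite exprn_gt0 // invr_gt0.
pose b k i := (enorm (z - x i) <= 2^-1 ^+ k)%R%:R : R.
(* The smallest dyadic ball containing the point suffices: if the distance is at most 2^-k but more
   than 2^-(k+1), its inverse is below 2^(k+1). *)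
have pt i : (if enorm (z - x i) <= h then 1 else h / enorm (z - x i)) <=
    h * (1 + \sum_(k < n.+1) 2 ^+ k.+1 * b k i).
  have t0 (k : 'I_n.+1) : 0 <= 2 ^+ k.+1 * b k i by rewrite mulr_ge0 // exprn_ge0.
  have one_term (k : 'I_n.+1) : enorm (z - x i) <= 2^-1 ^+ k ->
      2 ^+ k.+1 <= 1 + \sum_(k < n.+1) 2 ^+ k.+1 * b k i.
    move=> hk; rewrite (bigD1 k) //= {1}/b hk mulr1 addrCA lerDl addr_ge0 //.
    by apply: sumr_ge0 => l _; exact: t0.
  case: ifPn => [Dh|]; last rewrite -ltNge => hD.
    apply: le_trans (ler_wpM2l (ltW h0) (one_term ord_max Dh)).
    by rewrite /h /= exprS mulrCA -exprMn mulVf // expr1n mulr1 ler1n.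
  have D0 : 0 < enorm (z - x i) by exact: lt_trans hD.
  rewrite ler_pM2l //; have [D1|D1] := leP 1 (enorm (z - x i)).
    apply: (@le_trans _ _ 1); first by rewrite invf_le1.
    by rewrite lerDl sumr_ge0.
  have ex : exists k, enorm (z - x i) <= 2^-1 ^+ k by exists 0%N; rewrite expr0 ltW.
  have bd k : enorm (z - x i) <= 2^-1 ^+ k -> (k <= n)%N.
    move=> Dk; rewrite leqNgt; apply/negP => nk; move: (lt_le_trans hD Dk); apply/negP.
    by rewrite -leNgt /h ler_wiXn2l ?invr_ge0 ?invf_le1 ?ler1n // ltnW.
  case: (ex_maxnP ex bd) => k Dk kmax.
  have kn : (k < n.+1)%N by rewrite ltnS bd.
  apply: le_trans (one_term (Ordinal kn) Dk) => /=.
  rewrite -[leRHS]invrK lef_pV2 ?posrE ?invr_gt0 ?exprn_gt0 // -exprVn leNgt.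
  by apply/negP => /ltW /kmax; rewrite ltnn.
apply: (@le_trans _ _ (\sum_i w i * (h * (1 + \sum_(k < n.+1) 2 ^+ k.+1 * b k i)))).
  by apply: ler_sum => i _; rewrite ler_wpM2l.
have -> : \sum_i w i * (h * (1 + \sum_(k < n.+1) 2 ^+ k.+1 * b k i)) =
    h * (1 + \sum_(k < n.+1) 2 ^+ k.+1 * \sum_(i | enorm (z - x i) <= 2^-1 ^+ k) w i).
  have -> : \sum_(k < n.+1) 2 ^+ k.+1 * \sum_(i | enorm (z - x i) <= 2^-1 ^+ k) w i =
      \sum_i w i * \sum_(k < n.+1) 2 ^+ k.+1 * b k i.
    transitivity (\sum_(k < n.+1) \sum_i w i * (2 ^+ k.+1 * b k i)).
      apply: eq_bigr => k _; rewrite mulr_sumr big_mkcond /=; apply: eq_bigr => i _.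
      by rewrite /b; case: ifP => _; rewrite ?mulr1 ?mulr0 // mulrC.
    by rewrite exchange_big /=; apply: eq_bigr => i _; rewrite mulr_sumr.
  rewrite -[X in _ * (X + _)]w1 -big_split /= mulr_sumr; apply: eq_bigr => i _; ring.
rewrite mulrC ler_wpM2r ?(ltW h0) // /C' lerD2l.
apply: (@le_trans _ _ (\sum_(k < n.+1) 2 * (C * 2 `^ s) * q ^+ k)).
  apply: ler_sum => k _.
  have kn : 2^-1 ^+ n <= (2^-1 : R) ^+ k.
    by rewrite ler_wiXn2l ?invr_ge0 ?invf_le1 ?ler1n // -ltnS.
  apply: le_trans (ler_wpM2l _ (frostman_ball Hw z kn)) _; first by rewrite exprn_ge0.
  have k0 : 0 <= (2^-1 : R) ^+ k by rewrite exprn_ge0 // invr_ge0.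
  rewrite powRM // -(powR_mulrn k) ?invr_ge0 // powRAC powR_mulrn ?powR_ge0 //.
  rewrite /q exprMn exprS le_eqVlt; apply/orP; left; apply/eqP; ring.
rewrite -mulr_sumr -!mulrA ler_wpM2l // ler_wpM2l ?(ltW C0) // ler_wpM2l ?powR_ge0 //.
exact: geometric_sum_le.
Qed.

End Frostman_energy.

(** * Polyhedral norms *)

Lemma real_between {R : realType} (a : R) (x : \bar R) : (a%:E < x)%E ->
  exists2 s : R, a < s & (s%:E < x)%E.
Proof.
case: x => [r| |] //; rewrite ?lte_fin => ar.
  by exists ((a + r) / 2); rewrite ?lte_fin; lra.
by exists (a + 1); rewrite ?ltry // ltrDl.
Qed.

Lemma unit_cube_dist {R : realType} {d : nat} (x y : 'cV[R]_d) :
  unit_cube x -> unit_cube y -> forall i, `|(x - y) i ord0| <= 1.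
Proof.
move=> hx hy i; have /andP[x0 x1] := hx i; have /andP[y0 y1] := hy i.
rewrite !mxE ler_norml; apply/andP; split; lra.
Qed.

(** A closed interval of length 2 h contains at most three points of a grid of step h, and two
    numbers close to the same grid point are close to each other. *)
Lemma grid_multiplicity {R : realType} (h : R) (T : nat) (a b : R) : 0 < h ->
  \sum_(l < T) (`|a - l%:R * h| <= h)%R%:R * (`|b - l%:R * h| <= h)%R%:R <=
  3 * (`|a - b| <= 2 * h)%R%:R :> R.
Proof.
move=> h0.
have [ab|ab] := boolP (`|a - b| <= 2 * h); last first.
  rewrite mulr0 big1 // => l _.
  have [la|_] := boolP (`|a - l%:R * h| <= h); last by rewrite mul0r.
  have [lb|_] := boolP (`|b - l%:R * h| <= h); last by rewrite mulr0.
  move: ab; rewrite -(subrKA (l%:R * h)) (le_trans (ler_normD _ _)) //.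
  by rewrite (distrC _ b); lra.
rewrite mulr1.
apply: (@le_trans _ _ (\sum_(l < T) (`|a - l%:R * h| <= h)%R%:R)).
  by apply: ler_sum => l _; rewrite ler_piMr // lern1 leq_b1.
rewrite -natr_sum ler_nat.
have [[l0 hl0]|no] := pselect (exists l : nat, `|a - l%:R * h| <= h); last first.
  rewrite big1 // => l _; case: (boolP (`|a - l%:R * h| <= h)) => // hl.
  by exfalso; apply: no; exists l.
have ex : exists l : nat, `|a - l%:R * h| <= h by exists l0.
case: (ex_minnP ex) => m hm mmin.
have one k : (\sum_(l < T) (l == k :> nat) <= 1)%N.
  have [kT|kT] := ltnP k T; last first.
    by rewrite big1 // => l _; rewrite ltn_eqF // (leq_trans (ltn_ord l)).
  rewrite (bigD1 (Ordinal kT)) //= eqxx big1 // => l lk.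
  by apply/eqP; rewrite eqb0; apply: contra lk => /eqP e; apply/eqP/val_inj.
apply: (@leq_trans (\sum_(l < T) ((l == m :> nat) + (l == m.+1 :> nat) + (l == m.+2 :> nat)))%N); last first.
  by rewrite !big_split /= (leq_add (leq_add (one _) (one _)) (one _)).
apply: leq_sum => l _; case: (boolP (`|a - l%:R * h| <= h)) => // hl.
have ml := mmin _ hl.
have : (l <= m.+2)%N.
  rewrite leqNgt; apply/negP => ml3.
  have h1 : (m.+3%:R : R) * h <= l%:R * h by rewrite ler_pM2r // ler_nat.
  move: hm hl; rewrite !ler_norml => /andP[u1 u2] /andP[u3 u4].
  have E : m.+3%:R * h = m%:R * h + 3 * h :> R by rewrite -addn3 natrD mulrDl.
  by rewrite E in h1; lra.
by move: ml; rewrite leq_eqVlt => /orP[/eqP <-|]; rewrite ?eqxx // leq_eqVlt => /orP[/eqP <-|]; rewrite ?eqxx ?addn1 ?addn0 // => l1 l2;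
  rewrite (_ : (l == m.+2 :> nat)) ?addn1 // eqn_leq l2.
Qed.

Section PolyhedralCase.
Context {R : realType} {d : nat}.
Notation mxT := (borel_mx R d).
Local Notation SO := (@SO R d).
Variable mu : probability mxT R.
Hypothesis haar_mu : is_haar_SO mu.
Hypothesis d2 : (2 <= d)%N.

Lemma slab_mean_le (c v : 'cV[R]_d) (h : R) : c != 0 -> 0 < h ->
  (rot_mean mu (fun rho => (`|dot (rho *m v) c| <= 2 * h)%R%:R%R) <=
   ((1 + 20 * d%:R ^+ 2 / enorm c) * (if enorm v <= h then 1 else h / enorm v))%:E)%E.
Proof.
move=> c0 h0; have ec : 0 < enorm c by rewrite enorm_gt0.
have C1 : 0 <= 20 * d%:R ^+ 2 / enorm c.
  by rewrite divr_ge0 ?mulr_ge0 ?exprn_ge0 // ltW.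
case: ifPn => [_|]; last rewrite -ltNge => vh.
  apply: (@le_trans _ _ 1%:E); last by rewrite lee_fin mulr1 lerDl.
  rewrite -(rot_mean_cst haar_mu 1); apply: rot_mean_le => //; first exact: measurable_slab.
  by move=> rho _; rewrite lern1 leq_b1.
have v0 : v != 0 by rewrite -enorm_gt0 (lt_trans h0).
apply: le_trans (slab_mean haar_mu d2 c0 v0 (_ : 0 < 2 * h)) _; first by rewrite mulr_gt0.
have ev : 0 < enorm v by rewrite enorm_gt0.
rewrite lee_fin [leRHS]mulrDl mul1r.
have -> : 10 * d%:R ^+ 2 * (2 * h) / (enorm c * enorm v) = 20 * d%:R ^+ 2 / enorm c * (h / enorm v).
  by field; rewrite !lt0r_neq0.
by rewrite lerDr divr_ge0 // ltW.
Qed.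

Lemma slab_second_moment (N T : nat) (w : 'I_N -> R) (A : 'I_N -> R) (h : R) : 0 < h ->
  (forall i, 0 <= w i) ->
  \sum_(l < T) (\sum_(j | `|A j - l%:R * h| <= h) w j) ^+ 2 <=
  3 * \sum_j \sum_j' w j * w j' * (`|A j - A j'| <= 2 * h)%R%:R.
Proof.
move=> h0 w0.
have E (l : 'I_T) : (\sum_(j | `|A j - l%:R * h| <= h) w j) ^+ 2 =
   \sum_j \sum_j' w j * w j' * ((`|A j - l%:R * h| <= h)%R%:R * (`|A j' - l%:R * h| <= h)%R%:R).
  rewrite expr2 big_mkcond mulr_suml; apply: eq_bigr => j _.
  rewrite mulr_sumr; apply: eq_bigr => j' _.
  by case: ifP => _; case: ifP => _; rewrite ?(mulr1, mulr0, mul0r).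
under eq_bigr do rewrite E.
rewrite exchange_big mulr_sumr /=; apply: ler_sum => j _.
rewrite exchange_big mulr_sumr /=; apply: ler_sum => j' _.
rewrite -mulr_sumr mulrCA ler_wpM2l ?mulr_ge0 //.
exact: grid_multiplicity.
Qed.

(** For each linear form the square is expanded in the second point of the pair only. The first
    point cancels in the difference of two values, which leaves the event that the form is at most 2
    h at the rotated vector x a - x b. Its probability O(h / |x a - x b|) leads to the Riesz sum of
    order 1, bounded in dimension above 1. *)
Theorem ae_polyhedral_distance (E K : set 'cV[R]_d) :
  compact E -> E `<=` unit_cube -> convex_body K -> polyhedron K -> origin_symmetric K ->
  (1 < hausdorff_dim E)%E ->
  {ae mu, forall rho : mxT, SO rho -> (0 < lebesgue_measure (distance_set K (rotate rho E)))%E}.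
Proof.
move=> cE Ecube bK pK sK /real_between[s s1 sdim].
have d0 : (0 < d)%N by exact: ltnW.
have [I [c [c0 cP]]] := polyhedral_norm d0 bK pK sK.
have s0 : 0 < s by exact: lt_trans s1.
have [C C0 frost] := frostman cE s0 sdim.
have [C' C'0 riesz] := @frostman_riesz R d C s s1 C0.
have [r r0 rK] := convex_body_ball bK sK.
pose Cc i := 1 + 20 * d%:R ^+ 2 / enorm (c i).
apply: (@ae_positive_distance _ _ mu K E (3 * #|I|%:R * (C' * \sum_i Cc i))) => // n.
have [N [x [w [xE w0 w1 wF]]]] := frost n.
have Fw : frostman_weights C s n x w by split.
set h : R := 2^-1 ^+ n.
have h0 : 0 < h by rewrite exprn_gt0 // invr_gt0.
pose J := (I * ('I_N * 'I_N))%type.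
pose ind (p : J) (rho : 'M[R]_d) : R := (`|dot (rho *m (x p.2.1 - x p.2.2)) (c p.1)| <= 2 * h)%R%:R.
pose coef (p : J) := 3 * #|I|%:R / h * (w p.2.1 * w p.2.2).
have coef0 p : 0 <= coef p by rewrite mulr_ge0 ?mulr_ge0 ?invr_ge0 // ltW.
have mind p : measurable_fun setT (ind p : mxT -> R) by exact: measurable_slab.
exists (fun rho => \sum_p coef p * ind p rho); split.
- by apply: measurable_sum => p; exact: measurable_funM.
- by move=> rho; apply: sumr_ge0 => p _; exact: mulr_ge0.
- pose bnd (p : J) := Cc p.1 * (if enorm (x p.2.1 - x p.2.2) <= h then 1 else h / enorm (x p.2.1 - x p.2.2)).
  have Hb p : (rot_mean mu (ind p) <= (bnd p)%:E)%E by exact: slab_mean_le.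
  apply: le_trans (rot_mean_comb_le coef0 mind _ Hb) _ => //.
  rewrite lee_fin /bnd.
  rewrite -(pair_bigA _ (fun i (q : 'I_N * 'I_N) => coef (i, q) * (Cc i *
    (if enorm (x q.1 - x q.2) <= h then 1 else h / enorm (x q.1 - x q.2))))) /=.
  rewrite mulr_sumr mulr_sumr; apply: ler_sum => i _.
  rewrite -(pair_bigA _ (fun j j' => coef (i, (j, j')) * (Cc i *
    (if enorm (x j - x j') <= h then 1 else h / enorm (x j - x j'))))) /=.
  have Cc0 : 0 <= Cc i.
    by rewrite addr_ge0 // divr_ge0 ?mulr_ge0 ?exprn_ge0 // enorm_ge0.
  apply: (@le_trans _ _ (\sum_j 3 * #|I|%:R / h * Cc i * (w j * (C' * h)))).
    apply: ler_sum => j _.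
    apply: (@le_trans _ _ (3 * #|I|%:R / h * Cc i * (w j *
      \sum_j' w j' * (if enorm (x j - x j') <= h then 1 else h / enorm (x j - x j'))))).
      rewrite !mulr_sumr le_eqVlt; apply/orP; left; apply/eqP; apply: eq_bigr => j' _.
      rewrite /coef /Cc /=; ring.
    rewrite ler_wpM2l //; first by rewrite !mulr_ge0 // invr_ge0 ltW.
    by rewrite ler_wpM2l // (riesz n N x w Fw).
  rewrite -mulr_sumr -mulr_suml w1 mul1r le_eqVlt; apply/orP; left; apply/eqP.
  by field; rewrite lt0r_neq0.
move=> rho srho.
(* With J = 1 the distances, at most d / r, must stay below (T - 1) h; hence the two extra grid
   points. *)
exists N, x, (fun e => w e.1 * w e.2), h, 1%N, (Num.truncn (d%:R / r / h)).+2; split.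
- split => //; first by move=> e; exact: mulr_ge0.
  rewrite -(pair_bigA _ (fun i j => w i * w j)) /=.
  under eq_bigr do rewrite -mulr_sumr w1 mulr1.
  by rewrite w1 invf_le1 ?ler1n.
- by rewrite mul1r.
- move=> e; rewrite body_norm_ge0 //=.
  apply: (@le_lt_trans _ _ (enorm (rho *m (x e.1 - x e.2)) / r)); first exact: body_norm_le_enorm.
  rewrite SO_enorm // -ltr_pdivrMr //.
  apply: (@le_lt_trans _ _ (d%:R / r / h)).
    rewrite ler_pM2r ?invr_gt0 // ler_pM2r ?invr_gt0 // -[leRHS]mulr1.
    by apply: enorm_le_coord => // i; apply: unit_cube_dist; exact: Ecube.
  by rewrite -natrB // subn1 /= truncnS_gt.
rewrite mul1r.
pose A i j a := dot (rho *m (x j - x a)) (c i).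
pose u i j l := \sum_(a | `|A i j a - l%:R * h| <= h) w a.
pose nu (l : nat) := \sum_(e | `|body_norm K (rho *m (x e.1 - x e.2)) - l%:R * h| <= h) w e.1 * w e.2.
have nu0 l : 0 <= nu l by apply: sumr_ge0 => e _; exact: mulr_ge0.
have u0 i j l : 0 <= u i j l by exact: sumr_ge0.
have nu_le l : nu l <= \sum_i \sum_j w j * u i j l.
  have -> : \sum_i \sum_j w j * u i j l =
      \sum_(e : 'I_N * 'I_N) \sum_i (w e.1 * w e.2) * (`|A i e.1 e.2 - l%:R * h| <= h)%R%:R.
    rewrite exchange_big /= -(pair_bigA _ (fun j a => \sum_i (w j * w a) * (`|A i j a - l%:R * h| <= h)%R%:R)) /=.
    apply: eq_bigr => j _; rewrite exchange_big /=; apply: eq_bigr => i _.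
    rewrite /u mulr_sumr big_mkcond /=; apply: eq_bigr => a _.
    by case: ifP => _; rewrite ?mulr1 ?mulr0.
  rewrite /nu big_mkcond; apply: ler_sum => e _.
  have pos (i : I) : 0 <= (w e.1 * w e.2) * (`|A i e.1 e.2 - l%:R * h| <= h)%R%:R by rewrite !mulr_ge0.
  case: ifP => he; last exact: sumr_ge0.
  have [i iP] := cP (rho *m (x e.1 - x e.2)); rewrite iP (dotC (c i)) in he.
  by rewrite (bigD1 i) //= {1}/A he mulr1 lerDl; apply: sumr_ge0 => k _; exact: pos.
(* Cauchy-Schwarz over the forms costs their number; over the first point it costs nothing, the
   weights having sum 1. *)
have nu_sq l : nu l ^+ 2 <= #|I|%:R * \sum_i \sum_j w j * u i j l ^+ 2.
  apply: (@le_trans _ _ ((\sum_i 1 * \sum_j w j * u i j l) ^+ 2)).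
    rewrite ler_sqr ?nnegrE ?nu0 //; last first.
      by apply: sumr_ge0 => i _; rewrite mul1r sumr_ge0 // => j _; rewrite mulr_ge0.
    by under eq_bigr do rewrite mul1r.
  apply: le_trans (sum_cauchy_schwarz _ _ _) _.
  under eq_bigr do rewrite expr1n.
  rewrite sumr_const ler_wpM2l //; apply: ler_sum => i _.
  exact: weighted_cauchy_schwarz.
apply: (@le_trans _ _ (h * \sum_(l < (Num.truncn (d%:R / r / h)).+2) #|I|%:R * \sum_i \sum_j w j * u i j l ^+ 2)).
  by rewrite ler_wpM2l ?(ltW h0) //; apply: ler_sum => l _; exact: nu_sq.
rewrite -mulr_sumr exchange_big /=.
apply: (@le_trans _ _ (h * (#|I|%:R * \sum_i 3 * \sum_a \sum_b w a * w b * ind (i, (a, b)) rho))).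
  rewrite ler_wpM2l ?(ltW h0) // ler_wpM2l //; apply: ler_sum => i _.
  rewrite exchange_big /= -[leRHS]mul1r -[X in _ <= X * _]w1 mulr_suml; apply: ler_sum => j _.
  rewrite -mulr_sumr ler_wpM2l //.
  have SM : \sum_(l < (Num.truncn (d%:R / r / h)).+2) u i j l ^+ 2 <=
      3 * \sum_a \sum_b w a * w b * (`|A i j a - A i j b| <= 2 * h)%R%:R.
    exact: slab_second_moment.
  apply: le_trans SM _.
  rewrite ler_wpM2l //; apply: ler_sum => a _; apply: ler_sum => b _.
  rewrite ler_wpM2l ?mulr_ge0 //.
  have E1 : x j - x a - (x j - x b) = - (x a - x b).
    by apply/matrixP => k l; rewrite !mxE; ring.
  by rewrite /ind /A -dotBl -mulmxBr E1 mulmxN dotNl normrN.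
rewrite mulr_suml -(pair_bigA _ (fun i (q : 'I_N * 'I_N) => coef (i, q) * ind (i, q) rho * h ^+ 2)) /=.
rewrite mulrA mulr_sumr; apply: ler_sum => i _.
rewrite -(pair_bigA _ (fun a b => coef (i, (a, b)) * ind (i, (a, b)) rho * h ^+ 2)) /=.
rewrite !mulr_sumr; apply: ler_sum => a _; rewrite !mulr_sumr; apply: ler_sum => b _.
rewrite le_eqVlt; apply/orP; left; apply/eqP; rewrite /coef /=.
by field; rewrite lt0r_neq0.
Qed.

End PolyhedralCase.

(** * Radial sets *)

Section RadialCase.
Context {R : realType} {d : nat}.

Lemma hausdorff_dim_sub0 (E : set 'cV[R]_d) (s : R) : 0 < s -> E `<=` [set 0] ->
  (hausdorff_dim E <= s%:E)%E.
Proof.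
move=> s0 E0; apply: ereal_inf_lbound; exists s => //; split; first exact: ltW.
apply: hausdorff_measure_eq0 => delta e delta0 e0.
apply: le_trans (@hausdorff_content_le _ _ s delta E 1 (fun=> [set 0]) (fun=> 0) _ _ _ _ _) _.
- exact: ltW.
- exact: ltW.
- by move=> x /E0 ->; exists 0%N.
- by move=> i _; rewrite lexx ltW.
- by move=> i x y _ -> ->; rewrite subrr enorm0.
- by rewrite big_ord1 powR0 ?lt0r_neq0 // lee_fin ltW.
Qed.

(** The dimension excludes that [E] is contained in {0}, so [E] contains a sphere of radius r > 0.
    Two points of it that are mirror images in the coordinate [i] differ by any prescribed multiple
    of the basis vector up to length 2 r, and their distances fill an interval. *)
Lemma radial_distance_pos (E K : set 'cV[R]_d) (E0 : set R) : (2 <= d)%N ->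
  E0 `<=` `[0, 1] -> E = [set r *: w | r in E0 & w in unit_sphere] -> compact E ->
  (((d%:R + 1) / 2)%:E < hausdorff_dim E)%E ->
  convex_body K -> origin_symmetric K ->
  (0 < lebesgue_measure (distance_set K E))%E.
Proof.
move=> d2 E01 EE cE dimE bK sK.
have dR : (2 : R) <= d%:R by rewrite ler_nat.
have [r [E0r r0]] : exists r, E0 r /\ 0 < r.
  apply: contrapT => no; move: dimE; rewrite ltNge => /negP; apply.
  apply: hausdorff_dim_sub0; first by rewrite divr_gt0 // addr_gt0 // ltr0n ltnW.
  rewrite EE => _ [r E0r [w _ <-]] /=.
  have := E01 _ E0r; rewrite /= in_itv /= => /andP[r0 _].
  suff -> : r = 0 by rewrite scale0r.
  apply/eqP; rewrite eq_le r0 andbT leNgt; apply/negP => rp; apply: no; by exists r.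
pose i := Ordinal (ltnW d2); pose j := Ordinal d2.
have ij : i != j by [].
have dij : dot (basis_vec i) (basis_vec j) = 0 :> R by rewrite dot_basis_vec mxE (negbTE ij).
have dii k : dot (basis_vec k) (basis_vec k) = 1 :> R by rewrite dot_basis_vec mxE !eqxx.
pose a := body_norm K (basis_vec i).
have [r' r'0 Kr'] := convex_body_bounded bK.
have a0 : 0 < a.
  have := enorm_le_body_norm bK sK (basis_vec i) r'0 Kr'.
  by rewrite enorm_basis_vec -/a => h; rewrite -(pmulr_rgt0 _ r'0); apply: lt_le_trans h.
have sphere (v : 'cV[R]_d) : enorm v = r -> E v.
  move=> vr; rewrite EE; exists r => //; exists (r^-1 *: v).
    by rewrite /unit_sphere /= enormZ vr gtr0_norm ?invr_gt0 // mulVf // lt0r_neq0.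
  by rewrite scalerA divff ?scale1r // lt0r_neq0.
have sub : `[0, r * a]%classic `<=` distance_set K E.
  move=> t /=; rewrite in_itv /= => /andP[t0 tr].
  (* The points +s e_i + q e_j and -s e_i + q e_j differ by 2 s e_i, of norm 2 s a = t; [q] puts
     them on the sphere. *)
  pose s := t / a / 2.
  have s0 : 0 <= s by rewrite !divr_ge0 // ltW.
  have sr : s <= r.
    rewrite /s ler_pdivrMr // ler_pdivrMr // (le_trans tr) // mulrAC ler_peMr ?ler1n //.
    by rewrite mulr_ge0 // ltW.
  pose q := Num.sqrt (r ^+ 2 - s ^+ 2).
  have q2 : q ^+ 2 = r ^+ 2 - s ^+ 2.
    by rewrite sqr_sqrtr // subr_ge0 ler_sqr ?nnegrE // ltW.
  have en (e : R) : e ^+ 2 = s ^+ 2 -> enorm (e *: basis_vec i + q *: basis_vec j) = r.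
    move=> e2; rewrite /enorm !dotDl !dotDr !dotZl !dotZr !dii dij dotC dij.
    rewrite !mulr0 !mulr1 addr0 add0r -!expr2 e2 q2 addrC subrK sqrtr_sqr gtr0_norm //.
  exists (s *: basis_vec i + q *: basis_vec j); first by apply: sphere; exact: en.
  exists (- s *: basis_vec i + q *: basis_vec j); first by apply: sphere; apply: en; rewrite sqrrN.
  have -> : s *: basis_vec i + q *: basis_vec j - (- s *: basis_vec i + q *: basis_vec j) = (t / a) *: basis_vec i :> 'cV[R]_d.
    by apply/matrixP => k l; rewrite !mxE /s; field; rewrite lt0r_neq0.
  by rewrite body_normZ // -/a ger0_norm ?divr_ge0 ?(ltW a0) // divfK // lt0r_neq0.
apply: (@lt_le_trans _ _ (lebesgue_measure `[0, r * a]%classic)).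
  by rewrite lebesgue_measure_itv /= lte_fin mulr_gt0 // oppr0 addr0 lte_fin mulr_gt0.
apply: le_measure => //; rewrite inE; first exact: measurable_itv.
apply: compact_measurable.
have [r'' r''0 rK] := convex_body_ball bK sK.
apply: (@compact_difference_image _ _ (body_norm K) r''^-1) => // x y.
by rewrite mulrC body_norm_dist.
Qed.

End RadialCase.

(** * Sharpness: a Cantor set on an axis *)

(** With r = k^(-1/alpha) the product 2 k r equals 2 k^(-b), b = 1/alpha - 1 > 0, which is below 1
    as soon as k > 2^(1/b). *)
Lemma cantor_ratio {R : realType} (alpha : R) : 0 < alpha < 1 ->
  exists (k : nat) (r : R), [/\ (0 < k)%N, 0 < r, r `^ alpha = k%:R^-1 & 2 * k%:R * r < 1].
Proof.
move=> /andP[a0 a1].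
pose b := alpha^-1 - 1.
have b0 : 0 < b by rewrite subr_gt0 invf_gt1.
pose k := (Num.truncn ((2 : R) `^ b^-1)).+1.
have k0 : (0 : R) < k%:R by rewrite ltr0n.
have kb : 2 < k%:R `^ b.
  have -> : (2 : R) = (2 `^ b^-1) `^ b by rewrite -powRrM mulVf ?powRr1 // lt0r_neq0.
  by apply: gt0_ltr_powR; rewrite ?nnegrE ?powR_ge0 // truncnS_gt.
exists k, (k%:R `^ (- alpha^-1)); split => //; first by rewrite powR_gt0.
  by rewrite -powRrM mulNr mulVf ?lt0r_neq0 // powR_inv1 // ltW.
have -> : - alpha^-1 = - b + - 1 by rewrite /b; lra.
rewrite powRD ?lt0r_neq0 ?implybT // powRN powR_inv1 ?(ltW k0) //.
rewrite -mulrA (mulrCA k%:R) divff ?lt0r_neq0 // mulr1.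
by rewrite ltr_pdivrMr ?powR_gt0 // mul1r.
Qed.

Lemma invr_one_sub_half {R : realType} : (1 - 2^-1)^-1 = 2 :> R.
Proof. by field. Qed.

Lemma digit_difference_lt (k u v : nat) : (u < k -> u + (k - v) < 2 * k)%N.
Proof. lia. Qed.

Section CantorSet.
Context {R : realType}.
Variables (k : nat) (r : R).
Hypothesis k0 : (0 < k)%N.
Hypothesis r0 : 0 < r.
Hypothesis kr : 2 * k%:R * r < 1.

Let kR : (0 : R) < k%:R. Proof. by rewrite ltr0n. Qed.

Let kR1 : (1 : R) <= k%:R. Proof. by rewrite ler1n. Qed.

Let kr1 : k%:R * r <= 2^-1. Proof. by have := kr; rewrite -mulrA; lra. Qed.

Let r12 : r <= 2^-1. Proof. by apply: le_trans kr1; rewrite ler_peMl // ltW. Qed.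

Let rn0 n : 0 < r ^+ n. Proof. by rewrite exprn_gt0. Qed.

Definition digits (w : nat -> nat) := forall i, (w i < k)%N.

(** Left endpoint of the level-n interval with address [w]: an interval of length r^i has [k]
    children of length r^(i+1), whose left endpoints are spaced by r^i / k. *)
Definition cantor_pt (w : nat -> nat) n : R := \sum_(i < n) (w i)%:R * r ^+ i / k%:R.

Lemma cantor_tail w m j : digits w ->
  0 <= cantor_pt w (m + j) - cantor_pt w m <= r ^+ m - r ^+ (m + j).
Proof.
move=> dw; elim: j => [|j /andP[IH1 IH2]]; first by rewrite addn0 !subrr lexx.
rewrite addnS /cantor_pt big_ord_recr /= -/(cantor_pt w (m + j)).
have t0 : 0 <= (w (m + j)%N)%:R * r ^+ (m + j) / k%:R.
  by rewrite divr_ge0 ?mulr_ge0 // ltW.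
have t1 : (w (m + j)%N)%:R * r ^+ (m + j) / k%:R <= r ^+ (m + j) - r ^+ (m + j).+1.
  rewrite ler_pdivrMr // exprS -[X in X - _]mul1r -mulrBl mulrAC ler_pM2r //.
  have : (w (m + j)%N)%:R + 1 <= k%:R :> R by rewrite natr1 ler_nat.
  by move: kr1; rewrite mulrBl mul1r (mulrC r); lra.
by move: IH1 IH2 t0 t1; rewrite -/(cantor_pt w m); lra.
Qed.

Definition cantor_level n : set R :=
  [set x | exists2 w, digits w & cantor_pt w n <= x <= cantor_pt w n + r ^+ n].

Definition cantor_dust : set R := \bigcap_n cantor_level n.

Lemma cantor_pt_ext w w' n : (forall i, (i < n)%N -> w i = w' i) -> cantor_pt w n = cantor_pt w' n.
Proof. by move=> h; apply: eq_bigr => i _; rewrite h. Qed.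

Lemma cantor_pt_dust w n : digits w -> cantor_dust (cantor_pt w n).
Proof.
move=> dw m _; have [mn|nm] := leqP m n.
  exists w => //; have := cantor_tail m (n - m) dw; rewrite subnKC // => /andP[h1 h2].
  by have := rn0 n; move: h1 h2; lra.
pose w' i := if (i < n)%N then w i else 0%N.
have dw' : digits w' by move=> i; rewrite /w'; case: ifP.
exists w' => //.
have -> : cantor_pt w n = cantor_pt w' m.
  rewrite (cantor_pt_ext (_ : forall i, (i < n)%N -> w i = w' i)); last by move=> i; rewrite /w' => ->.
  rewrite /cantor_pt -(subnKC (ltnW nm)) big_split_ord /= [X in _ = _ + X]big1 ?addr0 // => i _.
  by rewrite /w' ltnNge leq_addr /= !mul0r.
by rewrite lexx lerDl ltW.
Qed.

Definition word_digits n (f : {ffun 'I_n -> 'I_k}) (i : nat) : nat :=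
  if insub i is Some j then f j else 0%N.

Lemma word_digitsE n (f : {ffun 'I_n -> 'I_k}) (i : 'I_n) : word_digits f i = f i.
Proof. by rewrite /word_digits valK. Qed.

Lemma digits_word n (f : {ffun 'I_n -> 'I_k}) : digits (word_digits f).
Proof. by move=> i; rewrite /word_digits; case: insubP. Qed.

Lemma cantor_levelE n x : cantor_level n x ->
  exists f : {ffun 'I_n -> 'I_k}, cantor_pt (word_digits f) n <= x <= cantor_pt (word_digits f) n + r ^+ n.
Proof.
move=> [w dw hx]; exists [ffun i : 'I_n => Ordinal (dw i)].
rewrite (cantor_pt_ext (_ : forall i, (i < n)%N -> _ = w i)) // => i ilt.
by rewrite (word_digitsE _ (Ordinal ilt)) ffunE.
Qed.

Lemma closed_cantor_level n : closed (cantor_level n).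
Proof.
have -> : cantor_level n = \bigcup_(f in [set: {ffun 'I_n -> 'I_k}])
    `[cantor_pt (word_digits f) n, cantor_pt (word_digits f) n + r ^+ n]%classic.
  apply/seteqP; split => [x /cantor_levelE[f hf]|x [f _ hf]].
    by exists f => //=; rewrite in_itv.
  by exists (word_digits f); [exact: digits_word|move: hf; rewrite /= in_itv].
apply: closed_bigcup => //; first exact: finite_finset.
by move=> f _; exact: interval_closed.
Qed.

Lemma compact_cantor_dust : compact cantor_dust.
Proof.
apply: (subclosed_compact _ (@segment_compact _ 0 1)).
  by apply: closed_bigI => n _; exact: closed_cantor_level.
move=> x /(_ 0%N I) [w _]; rewrite /cantor_pt big_ord0 add0r expr0 /=.
by rewrite in_itv.
Qed.

(** At the first digit where the addresses differ the points lie in distinct children of one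
    interval, and adjacent children are separated by a gap of r^i / k - r^(i+1). *)
Lemma cantor_separation w w' n i : digits w -> digits w' -> (i < n)%N ->
  (forall j, (j < i)%N -> w j = w' j) -> w i != w' i ->
  (k%:R^-1 - r) * r ^+ i <= `|cantor_pt w n - cantor_pt w' n|.
Proof.
wlog wi : w w' / (w i < w' i)%N => [H dw dw' ilt ag ne|dw dw' ilt ag _].
  case: (ltngtP (w i) (w' i)) => lt; [exact: H| |by rewrite lt eqxx in ne].
  by rewrite distrC; apply: H => //; [move=> j ji; rewrite ag|rewrite eq_sym].
have t := cantor_tail i.+1 (n - i.+1) dw; have t' := cantor_tail i.+1 (n - i.+1) dw'.
rewrite !subnKC // in t t'.
have E v : cantor_pt v i.+1 = cantor_pt v i + (v i)%:R * r ^+ i / k%:R by rewrite /cantor_pt big_ord_recr.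
rewrite !E (cantor_pt_ext ag) in t; rewrite !E in t'.
have d1 : r ^+ i / k%:R <= (w' i)%:R * r ^+ i / k%:R - (w i)%:R * r ^+ i / k%:R.
  rewrite -!mulrA -mulrBl ler_peMl ?mulr_ge0 ?invr_ge0 ?(ltW (rn0 i)) //.
  by rewrite -natrB ?ler1n ?subn_gt0 // ltnW.
have h := rn0 n; rewrite distrC.
apply: le_trans (ler_norm _).
move: t t' => /andP[t1 t2] /andP[t3 t4]; rewrite exprS in t2.
rewrite mulrBl mulrC; lra.
Qed.

Lemma card_word_prefix n m (f : {ffun 'I_n -> 'I_k}) : (m <= n)%N ->
  (#|[pred g : {ffun 'I_n -> 'I_k} | [forall i : 'I_n, (i < m)%N ==> (f i == g i)]]| <= k ^ (n - m))%N.
Proof.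
move=> mn.
pose F (i : 'I_n) := if (i < m)%N then pred1 (f i) else predT.
apply: (@leq_trans #|family F|).
  apply/subset_leq_card/fintype.subsetP => g; rewrite inE => /forallP gf.
  apply/familyP => i; rewrite /F; case: ifP => im //; rewrite inE eq_sym.
  by have := gf i; rewrite im.
rewrite card_family.
have -> : [seq #|F x| | x : 'I_n] = [seq (if (nat_of_ord x < m)%N then 1%N else k) | x : 'I_n].
  by apply: eq_map => i; rewrite /F; case: ifP => _; rewrite ?card1 ?card_ord.
rewrite foldrE big_map big_enum /= -(big_mkord xpredT (fun i => if (i < m)%N then 1%N else k)).
rewrite (@big_cat_nat _ _ _ m) //= [X in (X * _)%N]big_nat big1 ?mul1n; last by move=> i /andP[_ ->].
rewrite big_nat (eq_bigr (fun=> k)) -?big_nat ?prod_nat_const_nat // => i /andP[mi _].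
by rewrite ltnNge mi.
Qed.

Variable alpha : R.
Hypothesis alpha0 : 0 < alpha.
Hypothesis ralpha : r `^ alpha = k%:R^-1.

Let gam : R := k%:R^-1 - r.

Let gam0 : 0 < gam.
Proof.
rewrite subr_gt0 -[ltRHS]mul1r ltr_pdivlMr // mulrC; apply: le_lt_trans kr1 _.
by rewrite invf_lt1 ?ltr1n.
Qed.

Lemma rn_powR n : (r ^+ n) `^ alpha = k%:R^-1 ^+ n.
Proof. by rewrite -powR_mulrn ?ltW // powRAC ralpha powR_mulrn // invr_ge0 ltW. Qed.

(* The words of length [n] in an interval of length [2 rho] share their first [m]
   digits, where [gam * r ^ m] is comparable to [2 rho]. *)
Lemma count_words_near (rho : R) : 0 < rho -> exists n0, forall n (a : R), (n0 <= n)%N ->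
  #|[pred f : {ffun 'I_n -> 'I_k} | `|cantor_pt (word_digits f) n - a| < rho]|%:R <=
   k%:R ^+ n * ((2 / gam) `^ alpha * rho `^ alpha).
Proof.
move=> rho0.
have ex : exists m, gam * r ^+ m < 2 * rho.
  have [m hm] := @exists_half_pow_le R (rho / gam) (divr_gt0 rho0 gam0).
  exists m; apply: (@le_lt_trans _ _ rho); last by rewrite ltr_pMl // ltr1n.
  rewrite mulrC -ler_pdivlMr //; apply: le_trans hm.
  by apply: lerXn2r; rewrite ?nnegrE ?invr_ge0 // ltW.
case: (ex_minnP ex) => m hm mmin; exists m => n a mn.
set P := [pred f : {ffun 'I_n -> 'I_k} | _].
apply: (@le_trans _ _ (k ^ (n - m))%:R).
  rewrite ler_nat; have [/eqP P0|/card_gt0P[f Pf]] := posnP #|P|; first by rewrite (eqP P0).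
  apply: leq_trans (card_word_prefix f mn).
  apply/subset_leq_card/fintype.subsetP => g Pg; rewrite inE; apply/forallP => i.
  apply/implyP => im; apply: contrapT => ne.
  pose Q (j : nat) := word_digits f j != word_digits g j.
  have exQ : exists j, Q j by exists i; rewrite /Q !word_digitsE; apply/negP.
  case: (ex_minnP exQ) => j Qj jmin.
  have ji : (j <= i)%N by apply: jmin; rewrite /Q !word_digitsE; apply/negP.
  have jm : (j < m)%N by exact: leq_ltn_trans im.
  have := @cantor_separation (word_digits f) (word_digits g) n j (digits_word f) (digits_word g)
    (leq_trans jm mn) _ Qj.
  have ag l : (l < j)%N -> word_digits f l = word_digits g l.
    by move=> lj; apply/eqP; apply: contraTT lj => /jmin; rewrite -leqNgt.
  move=> /(_ ag); apply/negP; rewrite -ltNge.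
  apply: (@lt_le_trans _ _ (2 * rho)); last first.
    by rewrite leNgt; apply/negP => /mmin; rewrite leqNgt jm.
  rewrite -(subrKA a); apply: le_lt_trans (ler_normD _ _) _.
  move: Pf Pg; rewrite !inE => h1 h2; rewrite (distrC a); lra.
rewrite natrX -powRM ?divr_ge0 ?(ltW gam0) ?(ltW rho0) //.
apply: (@le_trans _ _ (k%:R ^+ n * (r ^+ m) `^ alpha)).
  rewrite rn_powR -{2}(subnK mn) exprD -mulrA -exprMn divff ?expr1n ?mulr1 //.
  by rewrite lt0r_neq0.
rewrite ler_wpM2l ?exprn_ge0 ?(ltW kR) //; apply: ge0_ler_powR; rewrite ?nnegrE ?(ltW alpha0) ?(ltW (rn0 m)) //.
  by rewrite mulr_ge0 ?divr_ge0 ?(ltW gam0) ?(ltW rho0).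
by rewrite mulrAC ler_pdivlMr // mulrC ltW.
Qed.

Variables (d : nat) (i0 : 'I_d).

Definition cantor_segment : set 'cV[R]_d := [set t *: basis_vec i0 | t in cantor_dust].

Lemma enorm_axis (t s : R) : enorm (t *: basis_vec i0 - s *: basis_vec i0) = `|t - s|.
Proof. by rewrite -scalerBl enormZ enorm_basis_vec mulr1. Qed.

Lemma compact_cantor_segment : compact cantor_segment.
Proof.
apply: continuous_compact; last exact: compact_cantor_dust.
apply: continuous_subspaceT => t; apply: (@cvgZ _ _ _ (nbhs t) _ id (fun=> basis_vec i0)); [exact: cvg_id|exact: cvg_cst].
Qed.

Lemma cantor_segment_cube : cantor_segment `<=` unit_cube.
Proof.
move=> _ [t ct <-] j; rewrite !mxE.
have [w _] := ct 0%N I; rewrite /cantor_pt big_ord0 add0r expr0 => t01.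
by case: (j == i0); rewrite ?mulr1 ?mulr0 ?lexx ?ler01.
Qed.

(** The k^n intervals of level n contribute (k r^s)^n, and k r^s < 1 because k r^alpha = 1. *)
Lemma cantor_segment_null (s : R) : alpha < s -> hausdorff_measure s cantor_segment = 0%E.
Proof.
move=> als; apply: hausdorff_measure_eq0 => delta e delta0 e0.
have s0 : 0 < s by exact: lt_trans als.
pose q := k%:R * r `^ s.
have q0 : 0 <= q by rewrite mulr_ge0 ?powR_ge0 // ltW.
have q1 : q < 1.
  rewrite /q (_ : s = alpha + (s - alpha)); last by lra.
  rewrite powRD ?lt0r_neq0 ?implybT // ralpha mulrA divff ?lt0r_neq0 // mul1r.
  apply: (@lt_le_trans _ _ (1 `^ (s - alpha))); last by rewrite powR1.
  apply: gt0_ltr_powR; rewrite ?nnegrE ?subr_gt0 ?(ltW r0) //.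
  by apply: le_lt_trans r12 _; rewrite invf_lt1 ?ltr1n.
have [n [rnd qn]] : exists n, r ^+ n <= delta /\ q ^+ n <= e.
  have r1 : `|r| < 1.
    by rewrite gtr0_norm //; apply: le_lt_trans r12 _; rewrite invf_lt1 ?ltr1n.
  have q1' : `|q| < 1 by rewrite ger0_norm.
  near \oo => n; exists n; split; near: n.
    by apply: (cvgr_le _ (cvg_expr r1)).
  by apply: (cvgr_le _ (cvg_expr q1')).
have H := @hausdorff_content_le_fin R d s delta cantor_segment {ffun 'I_n -> 'I_k}
  (fun f => [set t *: basis_vec i0 | t in `[cantor_pt (word_digits f) n, cantor_pt (word_digits f) n + r ^+ n]])
  (fun=> r ^+ n).
apply: le_trans (H _ _ _ _ _) _.
- exact: ltW.
- exact: ltW.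
- move=> _ [t ct <-]; have [f hf] := cantor_levelE (ct n I).
  by exists f; exists t => //; rewrite /= in_itv.
- by move=> f; rewrite rnd ltW.
- move=> f _ _ [t + <-] [u + <-]; rewrite /= !in_itv /= enorm_axis => /andP[t1 t2] /andP[u1 u2].
  clear H; rewrite ler_norml; apply/andP; split.
    by rewrite -[t - u]opprB lerN2 lerBlDr (le_trans u2) // addrC lerD2l.
  by rewrite lerBlDr (le_trans t2) // addrC lerD2l.
rewrite sumr_const card_ffun !card_ord lee_fin; apply: le_trans qn.
rewrite /q exprMn -[leLHS]mulr_natl natrX ler_wpM2l ?exprn_ge0 ?(ltW kR) //.
by rewrite -powR_mulrn ?(ltW r0) // powRAC powR_mulrn ?powR_ge0.
Unshelve. all: by end_near. Qed.

(** Twice the diameter D serves as radius, and D^alpha <= D^s because D <= 1 and s < alpha. If D = 0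
    a positive radius is still required for an open cover; the error [e] pays for it. *)
Lemma ball_of_diam (U : set 'cV[R]_d) (s e : R) : 0 <= s < alpha -> 0 < e ->
  (diam U <= 1%:E)%E -> (diam_pow s U < +oo)%E -> U !=set0 ->
  exists (a : R) (rho : R), [/\ 0 < rho,
    forall x, U x -> `|x i0 ord0 - a| < rho & rho `^ alpha <= 2 `^ alpha * fine (diam_pow s U) + e].
Proof.
move=> /andP[s0 sa] e0 U1 Ufin [y Uy].
have diam0 : (0 <= diam U)%E.
  by apply: ereal_sup_ubound; exists y => //; exists y => //; rewrite subrr enorm0.
have diamE : diam U = (fine (diam U))%:E.
  by rewrite fineK // ge0_fin_numE // (le_lt_trans U1) // ltry.
set D := fine (diam U) in diamE.
have D0 : 0 <= D by rewrite -lee_fin -diamE.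
have D1 : D <= 1 by rewrite -lee_fin -diamE.
have near_y x : U x -> `|x i0 ord0 - y i0 ord0| <= D.
  move=> Ux; have := coord_le_enorm (x - y) i0; rewrite !mxE => /le_trans; apply.
  by rewrite -lee_fin -diamE; apply: ereal_sup_ubound; exists x => //; exists y.
have dpE : fine (diam_pow s U) = D `^ s.
  rewrite /diam_pow; case: eqVneq => [U0|_]; first by rewrite U0 in Uy.
  by rewrite diamE poweR_EFin.
exists (y i0 ord0); have [D00|Dn0] := eqVneq D 0.
  exists (e `^ alpha^-1); split; first by rewrite powR_gt0.
    by move=> x /near_y; rewrite D00 => /le_lt_trans; apply; rewrite powR_gt0.
  rewrite -powRrM mulVf ?lt0r_neq0 // powRr1 ?(ltW e0) // lerDr.
  by rewrite dpE mulr_ge0 ?powR_ge0.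
have Dp : 0 < D by rewrite lt0r Dn0.
exists (2 * D); split; first by rewrite mulr_gt0.
  by move=> x /near_y /le_lt_trans; apply; rewrite ltr_pMl // ltr1n.
rewrite powRM ?(ltW Dp) // dpE; apply: (@le_trans _ _ (2 `^ alpha * D `^ s)); last by rewrite lerDl ltW.
by rewrite ler_wpM2l ?powR_ge0 //; apply: ger_powR; rewrite ?Dp //= ltW.
Qed.

(** The mass distribution principle by counting words. A cheap cover is enlarged to open intervals
    and reduced to finitely many by compactness; at a level [n] deep enough for all of them, each
    contains at most a share A rho^alpha of the k^n left endpoints, while together they contain
    all. *)
Lemma cantor_segment_lower (s : R) : 0 <= s -> hausdorff_measure s cantor_segment = 0%E -> alpha <= s.
Proof.
move=> s0 H0; rewrite leNgt; apply/negP => sa.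
pose A := (2 / gam) `^ alpha.
have A0 : 0 < A by rewrite powR_gt0 // divr_gt0.
(* Chosen so that the final estimate reads 1 <= 1/2; the summand 2 bounds the sum of the errors
   2^-i. *)
pose e := (A * (2 `^ alpha + 2))^-1 / 2.
have e0 : 0 < e by rewrite divr_gt0 // invr_gt0 mulr_gt0 // addr_gt0 ?powR_gt0.
have cont0 : (hausdorff_content s 1 cantor_segment < e%:E)%E.
  apply: (@le_lt_trans _ _ 0%E); last by rewrite lte_fin.
  by rewrite -H0; apply: ereal_sup_ubound; exists 1 => //=.
have [_ [U [EU U1] <-] Ue] := ereal_inf_lt cont0.
have f0 i : (0 <= diam_pow s (U i))%E by exact: diam_pow_ge0.
have partial m : (\sum_(i < m) diam_pow s (U i) <= e%:E)%E.
  apply: le_trans (ltW Ue); rewrite -(big_mkord xpredT (fun i => diam_pow s (U i))).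
  by apply: nneseries_lim_ge.
have Ufin i : (diam_pow s (U i) < +oo)%E.
  apply: (@le_lt_trans _ _ e%:E); last exact: ltry.
  apply: le_trans (partial i.+1); rewrite big_ord_recr /= leeDr //.
  by apply: sume_ge0 => j _.
pose eta (i : nat) := e * 2^-1 ^+ i.
have balls i : exists ar : R * R, [/\ 0 < ar.2, forall x, U i x -> `|x i0 ord0 - ar.1| < ar.2 &
     ar.2 `^ alpha <= 2 `^ alpha * fine (diam_pow s (U i)) + eta i].
  have eta0 : 0 < eta i by rewrite mulr_gt0 // exprn_gt0 // invr_gt0.
  have [U0|/set0P Un] := eqVneq (U i) set0; last first.
    have sa' : 0 <= s < alpha by rewrite s0.
    have [a [rho [h1 h2 h3]]] := ball_of_diam sa' eta0 (U1 i) (Ufin i) Un.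
    by exists (a, rho).
  exists (0, (eta i) `^ alpha^-1); split => /=; first by rewrite powR_gt0.
    by move=> x; rewrite U0.
  rewrite -powRrM mulVf ?lt0r_neq0 // powRr1 ?(ltW eta0) // lerDr.
  by rewrite mulr_ge0 ?powR_ge0 // fine_ge0.
have [ar Har] := choice balls.
have : compact cantor_dust by exact: compact_cantor_dust.
rewrite compact_cover => /(_ nat setT (fun i => ball (ar i).1 (ar i).2)).
case=> [i _||D _ cov]; first by apply: ball_open; case: (Har i).
  move=> t ct; have [i _ Ui] : (\bigcup_i U i) (t *: basis_vec i0) by apply: EU; exists t.
  exists i => //; have [_ /(_ _ Ui) h _] := Har i.
  by rewrite /ball /= distrC; move: h; rewrite !mxE !eqxx mulr1.
have rho0 i : 0 < (ar i).2 by case: (Har i).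
have [n0 Hn0] := choice (fun i => count_words_near (rho0 i)).
pose n := (\max_(i <- finmap.enum_fset D) n0 i)%N.
pose P i := [pred f : {ffun 'I_n -> 'I_k} | `|cantor_pt (word_digits f) n - (ar i).1| < (ar i).2].
have kn0 : (0 : R) < k%:R ^+ n by rewrite exprn_gt0.
have c1 : k%:R ^+ n <= \sum_(i <- finmap.enum_fset D) #|P i|%:R :> R.
  rewrite -natrX -natr_sum ler_nat -{1}[k]card_ord -{1}[n]card_ord -card_ffun -sum1_card.
  under [leqRHS]eq_bigr do rewrite -sum1_card big_mkcond.
  rewrite exchange_big /=; apply: leq_sum => f _.
  have [i Di] := cov _ (cantor_pt_dust n (digits_word f)).
  rewrite /ball /= distrC => fi.
  rewrite (big_rem i) //= ifT; first by rewrite leq_addr.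
  by rewrite inE.
have c2 : 1 <= A * \sum_(i <- finmap.enum_fset D) (ar i).2 `^ alpha.
  rewrite -(ler_pM2l kn0) mulr1; apply: le_trans c1 _.
  rewrite mulrA mulr_sumr big_seq [leRHS]big_seq; apply: ler_sum => i iD.
  by rewrite -mulrA; apply: Hn0; rewrite /n; apply: leq_bigmax_seq.
pose m := (\max_(i <- finmap.enum_fset D) i).+1.
pose g i : R := 2 `^ alpha * fine (diam_pow s (U i)) + eta i.
have g0 i : 0 <= g i.
  apply: addr_ge0; first by rewrite mulr_ge0 ?powR_ge0 ?fine_ge0.
  by rewrite /eta mulr_ge0 ?(ltW e0) // exprn_ge0 // invr_ge0.
have c3 : \sum_(i <- finmap.enum_fset D) (ar i).2 `^ alpha <= \sum_(i < m) g i.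
  apply: (@le_trans _ _ (\sum_(i <- finmap.enum_fset D) g i)).
    by apply: ler_sum => i _; case: (Har i).
  have -> : \sum_(i <- finmap.enum_fset D) g i = \sum_(i <- iota 0 m | i \in finmap.enum_fset D) g i.
    rewrite -[RHS]big_filter; apply: perm_big; apply: uniq_perm.
    - exact: finmap.fset_uniq.
    - by rewrite filter_uniq // iota_uniq.
    - move=> i; rewrite mem_filter mem_iota add0n /=; case: (boolP (i \in finmap.enum_fset D)) => //= iD.
      by rewrite ltnS leq_bigmax_seq.
  have -> : \sum_(i < m) g i = \sum_(i <- iota 0 m) g i by rewrite -(big_mkord xpredT g) /index_iota subn0.
  by rewrite [leRHS](bigID (fun i => i \in finmap.enum_fset D)) /= lerDl sumr_ge0.
have c4 : \sum_(i < m) g i <= (2 `^ alpha + 2) * e.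
  rewrite big_split /= mulrDl lerD //.
    rewrite -mulr_sumr ler_wpM2l ?powR_ge0 //.
    rewrite -lee_fin -sumEFin; apply: le_trans (partial m); apply: lee_sum => i _.
    by rewrite fineK // ge0_fin_numE.
  rewrite -mulr_sumr mulrC ler_wpM2r ?(ltW e0) //.
  rewrite -[leRHS]invr_one_sub_half.
  by apply: geometric_sum_le; apply/andP; split; lra.
have : 1 <= A * ((2 `^ alpha + 2) * e).
  by apply: le_trans c2 _; rewrite ler_wpM2l ?(ltW A0) // (le_trans c3).
have Ap : A * (2 `^ alpha + 2) != 0 by rewrite lt0r_neq0 // mulr_gt0 // addr_gt0 ?powR_gt0.
by rewrite /e !mulrA divff //; lra.
Qed.

(** On an axis every body norm is a multiple [a] of the absolute value, so one set serves all [K].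
    The (2 k)^n covering intervals of length 2 a r^n have total length 2 a (2 k r)^n, which tends to
    0. *)
Lemma null_distance_cantor_segment (K : set 'cV[R]_d) : convex_body K -> origin_symmetric K ->
  lebesgue_measure (distance_set K cantor_segment) = 0%E.
Proof.
move=> bK sK.
pose a := body_norm K (basis_vec i0 : 'cV[R]_d).
have a0 : 0 <= a by exact: body_norm_ge0.
have mD : measurable (distance_set K cantor_segment).
  apply: compact_measurable.
  have [r'' r''0 rK] := convex_body_ball bK sK.
  apply: (@compact_difference_image _ _ (body_norm K) r''^-1); last exact: compact_cantor_segment.
  by move=> x y; rewrite mulrC body_norm_dist.
apply/eqP; rewrite eq_le measure_ge0 andbT; apply/lee_addgt0Pr => e e0; rewrite add0e.
pose q := 2 * k%:R * r.
have q0 : 0 <= q by rewrite !mulr_ge0 // ltW.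
have [n qn] : exists n, 2 * a * q ^+ n <= e.
  have q1 : `|q| < 1 by rewrite ger0_norm.
  have c0 : 0 < 2 * a + 1 by rewrite ltr_pwDr // mulr_ge0.
  near \oo => n; exists n.
  have : q ^+ n <= e / (2 * a + 1).
    by near: n; apply: (cvgr_le _ (cvg_expr q1)); rewrite divr_gt0.
  rewrite ler_pdivlMr // => h; apply: le_trans h; rewrite mulrC.
  by rewrite ler_wpM2l ?exprn_ge0 // lerDl.
(* The word [u] encodes the digit differences shifted by [k], which makes them natural numbers below
   2 k. *)
pose z (u : {ffun 'I_n -> 'I_(2 * k)}) : R := \sum_(i < n) ((u i)%:R - k%:R) * r ^+ i / k%:R.
pose J (u : {ffun 'I_n -> 'I_(2 * k)}) : set R := `[a * (`|z u| - r ^+ n), a * (`|z u| + r ^+ n)]%classic.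
have sub : distance_set K cantor_segment `<=` \bigcup_(u in [set: {ffun 'I_n -> 'I_(2 * k)}]) J u.
  move=> _ [_ [t ct <-] [_ [s cs <-] <-]].
  have [w dw /andP[w1 w2]] := ct n I; have [v dv /andP[v1 v2]] := cs n I.
  have dlt i : (w i + (k - v i) < 2 * k)%N by exact: digit_difference_lt.
  exists [ffun i : 'I_n => Ordinal (dlt i)] => //.
  have zE : z [ffun i : 'I_n => Ordinal (dlt i)] = cantor_pt w n - cantor_pt v n.
    rewrite /z /cantor_pt -sumrB; apply: eq_bigr => i _; rewrite ffunE /=.
    by rewrite natrD natrB 1?ltnW ?dv //; ring.
  rewrite /J /= in_itv /= -scalerBl body_normZ // -/a zE [`|t - s| * a]mulrC.
  have h : `|(t - s) - (cantor_pt w n - cantor_pt v n)| <= r ^+ n.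
    by rewrite ler_norml; apply/andP; split; lra.
  have h1 := le_trans (lerB_dist _ _) h; rewrite distrC in h; have h2 := le_trans (lerB_dist _ _) h.
  by rewrite !ler_wpM2l //; lra.
apply: (@le_trans _ _ (\sum_(u \in [set: {ffun 'I_n -> 'I_(2 * k)}]) lebesgue_measure (J u))%E).
  apply: content_sub_fsum => //; first exact: finite_finset.
  by move=> u _; exact: measurable_itv.
rewrite fsbig_finite; last exact: finite_finset.
have -> : (\sum_(u <- finmap.enum_fset (fset_set [set: {ffun 'I_n -> 'I_(2 * k)}])) lebesgue_measure (J u) =
    \sum_u lebesgue_measure (J u))%E.
  rewrite -[RHS]big_enum; apply/perm_big/uniq_perm; [exact: finmap.fset_uniq|exact: enum_uniq|].
  move=> u; have fT : finite_set [set: {ffun 'I_n -> 'I_(2 * k)}] by exact: finite_finset.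
  by rewrite mem_enum; have := in_fset_set fT u; rewrite in_setT.
rewrite (eq_bigr (fun=> (2 * a * r ^+ n)%:E)); last first.
  move=> u _; rewrite lebesgue_measure_itv /= lte_fin.
  case: ltP => [_|le]; first by rewrite -EFinB; congr EFin; ring.
  congr EFin; apply/esym/le_anti; rewrite !mulr_ge0 ?(ltW (rn0 n)) // andbT.
  by move: le; rewrite -subr_le0; apply: le_trans; rewrite le_eqVlt; apply/orP; left; apply/eqP; ring.
rewrite sumEFin sumr_const card_ffun !card_ord lee_fin; apply: le_trans qn.
by rewrite /q !exprMn -[leLHS]mulr_natr natrX natrM exprMn le_eqVlt; apply/orP; left; apply/eqP; ring.
Unshelve. all: by end_near. Qed.

Lemma hausdorff_dim_cantor_segment : hausdorff_dim cantor_segment = alpha%:E.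
Proof.
apply/eqP; rewrite eq_le; apply/andP; split.
  apply/lee_addgt0Pr => e e0; apply: ereal_inf_lbound; exists (alpha + e) => //; split.
    by rewrite addr_ge0 // ltW.
  by apply: cantor_segment_null; rewrite ltrDl.
apply: le_ereal_inf_tmp => _ [s [s0 Hs] <-]; rewrite lee_fin.
exact: cantor_segment_lower.
Qed.

End CantorSet.

Lemma exists_null_distance_set {R : realType} (d : nat) (alpha : R) : (2 <= d)%N -> 0 <= alpha < 1 ->
  exists E : set 'cV[R]_d,
    [/\ compact E, E `<=` unit_cube, hausdorff_dim E = alpha%:E &
        forall K : set 'cV[R]_d, convex_body K -> origin_symmetric K ->
          lebesgue_measure (distance_set K E) = 0%E].
Proof.
move=> d2 /andP[al0 al1]; have [->|aln] := eqVneq alpha 0; last first.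
  have alp : 0 < alpha by rewrite lt0r aln.
  have al01 : 0 < alpha < 1 by rewrite alp.
  have [k [r [k0 r0 ralpha kr]]] := cantor_ratio al01.
  exists (cantor_segment k r (Ordinal (ltnW d2))); split.
  - exact: compact_cantor_segment.
  - exact: cantor_segment_cube.
  - exact: hausdorff_dim_cantor_segment.
  - by move=> K bK sK; apply: null_distance_cantor_segment.
exists [set 0]; split.
- exact: compact_set1.
- by move=> _ -> i; rewrite mxE lexx ler01.
- apply/eqP; rewrite eq_le; apply/andP; split.
    by apply/lee_addgt0Pr => e e0; rewrite add0e; exact: hausdorff_dim_sub0.
  by apply: le_ereal_inf_tmp => _ [s [s0 _] <-]; rewrite lee_fin.
- move=> K bK sK; apply/eqP; rewrite eq_le measure_ge0 andbT -(lebesgue_measure_set1 (0 : R)).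
  apply: le_outer_measure => _ [_ -> [_ -> <-]].
  by rewrite /= subrr body_norm0.
Qed.

(** * Trigonometric sums *)

Section Trigonometry.
Context {R : realType}.
Implicit Types x y z : R.

Lemma cos_lipschitz x y : `|cos x - cos y| <= `|x - y|.
Proof.
wlog xy : x y / y < x => [H|].
  have [->|ne] := eqVneq x y; first by rewrite !subrr.
  by case: (ltgtP x y) ne => // lt _; [rewrite distrC (distrC x)|]; exact: H.
have [c _ ->] : exists2 c, c \in `]y, x[ & cos x - cos y = - sin c * (x - y).
  apply: (@MVT R cos (fun t => - sin t)) => //.
  by apply: continuous_subspaceT => t; exact: continuous_cos.
by rewrite normrM normrN ler_piMl // sin_max.
Qed.

Lemma sin_sub_cos x : exists2 c, `|c| <= `|x| & sin x = x * cos c.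
Proof.
wlog x0 : x / 0 < x => [H|].
  case: (ltgtP x 0) => [x0|x0|->]; last by exists 0; rewrite ?sin0 ?mul0r.
    have [|c h e] := H (- x); first by rewrite oppr_gt0.
    by exists c; [rewrite -(normrN x)|apply: oppr_inj; rewrite -sinN e mulNr].
  exact: H.
have [c] : exists2 c, c \in `]0, x[ & sin x - sin 0 = cos c * (x - 0).
  apply: (@MVT R sin cos) => //.
  by apply: continuous_subspaceT => t; exact: continuous_sin.
rewrite in_itv /= => /andP[c0 cx]; rewrite sin0 !subr0 => ->.
by exists c; rewrite 1?mulrC // !gtr0_norm // ltW.
Qed.

Lemma sin_norm_le x : `|sin x| <= `|x|.
Proof.
have [c _ ->] := sin_sub_cos x.
by rewrite normrM ler_piMr // cos_max.
Qed.

Lemma one_sub_cosE x : 1 - cos x = 2 * sin (x / 2) ^+ 2.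
Proof.
have -> : x = (x / 2) *+ 2 by rewrite -mulr_natr divfK.
rewrite cos_mulr2n mulrnAl -[X in sin X](_ : x / 2 = _) ?sin2cos2; last by rewrite -mulr_natr; field.
rewrite -mulr_natr; ring.
Qed.

Lemma cos_ge x : 1 - x ^+ 2 / 2 <= cos x.
Proof.
have := one_sub_cosE x; have : sin (x / 2) ^+ 2 <= (x / 2) ^+ 2.
  by rewrite -(real_normK (num_real (sin _))) -(real_normK (num_real (x / 2))) ler_sqr ?nnegrE // sin_norm_le.
rewrite expr_div_n; lra.
Qed.

Lemma one_sub_cos_ge x : `|x| <= 1 -> x ^+ 2 / 8 <= 1 - cos x.
Proof.
move=> x1; rewrite one_sub_cosE; have [c cx ->] := sin_sub_cos (x / 2).
have c1 : c ^+ 2 <= 1.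
  rewrite -(real_normK (num_real c)) -(expr1n _ 2) ler_sqr ?nnegrE //.
  by apply: le_trans cx _; rewrite normrM normfV [X in _ / X]ger0_norm //; lra.
have : 2^-1 <= cos c by apply: le_trans (cos_ge c); lra.
move=> h; rewrite exprMn; have h2 : 4^-1 <= cos c ^+ 2.
  have -> : 4^-1 = (2^-1 : R) ^+ 2 by rewrite exprVn -natrX.
  by rewrite ler_sqr ?nnegrE ?invr_ge0 // (le_trans _ h).
rewrite expr_div_n; have := ler_wpM2l (sqr_ge0 x) h2; lra.
Qed.

(** Squared modulus of the sum of e^(imz) over m < T, that is, T times a Fejer kernel. *)
Definition trig_kernel (T : nat) z : R :=
  (\sum_(m < T) cos (m%:R * z)) ^+ 2 + (\sum_(m < T) sin (m%:R * z)) ^+ 2.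

Lemma trig_kernel_ge0 T z : 0 <= trig_kernel T z.
Proof. by rewrite addr_ge0 ?sqr_ge0. Qed.

Lemma sqr_trig_sums (I : finType) (c a : I -> R) :
  (\sum_i c i * cos (a i)) ^+ 2 + (\sum_i c i * sin (a i)) ^+ 2 =
  \sum_i \sum_j c i * c j * cos (a i - a j).
Proof.
rewrite !expr2 !big_distrl -big_split /=; apply: eq_bigr => i _.
rewrite !big_distrr -big_split /=; apply: eq_bigr => j _.
by rewrite cosB; ring.
Qed.

Lemma trig_kernelE T z :
  trig_kernel T z = \sum_(i < T) \sum_(j < T) cos ((i%:R - j%:R) * z).
Proof.
rewrite /trig_kernel.
have := @sqr_trig_sums 'I_T (fun=> 1) (fun i => i%:R * z).
under eq_bigr do rewrite mul1r; under [X in _ + X ^+ 2]eq_bigr do rewrite mul1r.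
move=> ->; apply: eq_bigr => i _; apply: eq_bigr => j _.
by rewrite !mul1r mulrBl.
Qed.

Lemma trig_kernel_le T z : trig_kernel T z <= T%:R ^+ 2.
Proof.
rewrite trig_kernelE; apply: (@le_trans _ _ (\sum_(i < T) \sum_(j < T) 1)).
  by apply: ler_sum => i _; apply: ler_sum => j _; exact: cos_le1.
by rewrite sumr_const card_ord sumr_const card_ord -[leLHS]mulr_natr expr2.
Qed.

(** Squared moduli of the geometric sum identity: |1 - e^(iz)|^2 times the kernel is |1 -
    e^(iTz)|^2. *)
Lemma trig_kernel_telescope T z :
  (2 - 2 * cos z) * trig_kernel T z = 2 - 2 * cos (T%:R * z).
Proof.
rewrite /trig_kernel.
set a := \sum_(m < T) cos _; set b := \sum_(m < T) sin _.
have ea : a - cos z * a + sin z * b = 1 - cos (T%:R * z).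
  rewrite {}/a {}/b; elim: T => [|T IH]; first by rewrite !big_ord0 !mulr0 mul0r cos0 !subrr addr0.
  rewrite !big_ord_recr /= -[T.+1]addn1 natrD mulrDl mul1r cosD; move: IH; lra.
have eb : b - sin z * a - cos z * b = - sin (T%:R * z).
  clear ea; rewrite {}/a {}/b; elim: T => [|T IH]; first by rewrite !big_ord0 !mulr0 mul0r sin0 !subr0 oppr0.
  rewrite !big_ord_recr /= -[T.+1]addn1 natrD mulrDl mul1r sinD; move: IH; lra.
have e1 := cos2Dsin2 z; have e2 := cos2Dsin2 (T%:R * z).
have -> : 2 - 2 * cos (T%:R * z) = (1 - cos (T%:R * z)) ^+ 2 + (- sin (T%:R * z)) ^+ 2.
  by rewrite sqrrN -[X in X - _]/(1 + 1 : R) -{2}e2; ring.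
rewrite -ea -eb.
have -> : 2 - 2 * cos z = (1 - cos z) ^+ 2 + sin z ^+ 2.
  by rewrite -[X in X - _]/(1 + 1 : R) -{2}e1; ring.
ring.
Qed.

(** The trivial bound T^2 accounts for 1 of the 17. The other 16 come from the telescoped identity,
    whose right side is at most 4 and whose factor 2 - 2 cos z is at least z^2 / 4 on [-1, 1]. *)
Lemma trig_kernel_decay T z : `|z| <= 1 ->
  trig_kernel T z * (1 + (T%:R * z) ^+ 2) <= 17 * T%:R ^+ 2.
Proof.
move=> z1; have h := trig_kernel_telescope T z; have hz := one_sub_cos_ge z1.
have hT := cos_geN1 (T%:R * z); have D0 := trig_kernel_ge0 T z.
have h1 : trig_kernel T z * z ^+ 2 <= 16.
  have := ler_wpM2r D0 hz; nra.
have := ler_wpM2r (sqr_ge0 (T%:R : R)) h1; have := trig_kernel_le T z.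
rewrite exprMn; lra.
Qed.

Lemma trig_kernel_lower T z : T%:R * `|z| <= 1 -> T%:R ^+ 2 / 4 <= trig_kernel T z.
Proof.
move=> Tz; rewrite /trig_kernel; apply: (@le_trans _ _ ((\sum_(m < T) cos (m%:R * z)) ^+ 2)); last first.
  by rewrite lerDl sqr_ge0.
have h : T%:R / 2 <= \sum_(m < T) cos (m%:R * z).
  apply: (@le_trans _ _ (\sum_(m < T) 2^-1)).
    by rewrite sumr_const card_ord -[leRHS]mulr_natl.
  apply: ler_sum => m _; apply: le_trans (cos_ge _).
  have : (m%:R * z) ^+ 2 <= 1.
    rewrite -(real_normK (num_real (_ * z))) -[leRHS](expr1n _ 2) ler_sqr ?nnegrE //.
    rewrite normrM normr_nat; apply: le_trans Tz; rewrite ler_wpM2r // ler_nat ltnW //.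
  lra.
have -> : T%:R ^+ 2 / 4 = (T%:R / 2) ^+ 2 :> R by field.
by rewrite ler_sqr ?nnegrE ?divr_ge0 // (le_trans _ h) ?divr_ge0.
Qed.

End Trigonometry.

(** * Products of kernels as sums of cosines *)

Section ComplexExponential.
Context {R : realType}.
Import complex ComplexField.

Definition expi (x : R) : R[i] := (cos x +i* sin x)%C.

Lemma expiD x y : expi (x + y) = expi x * expi y.
Proof. by rewrite /expi cosD sinD; simpc; rewrite [sin x * _ + _]addrC. Qed.

Lemma expi0 : expi 0 = 1.
Proof. by rewrite /expi cos0 sin0. Qed.

Lemma expi_sum (I : finType) (x : I -> R) : expi (\sum_i x i) = \prod_i expi (x i).
Proof. by apply: (big_morph expi); [exact: expiD|exact: expi0]. Qed.

Lemma trig_kernel_expi (T : nat) (z : R) :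
  \sum_(p : 'I_T * 'I_T) expi ((p.1%:R - p.2%:R) * z) = (trig_kernel T z)%:C%C.
Proof.
rewrite -(pair_bigA _ (fun i j : 'I_T => expi ((i%:R - j%:R) * z))) /=.
under eq_bigr do under eq_bigr do rewrite mulrBl expiD.
under eq_bigr do rewrite -mulr_sumr.
rewrite -mulr_suml /trig_kernel.
have sumE (I : finType) (a : I -> R) : \sum_i expi (a i) = ((\sum_i cos (a i)) +i* (\sum_i sin (a i)))%C.
  by elim/big_rec3: _ => // i u v _ _ ->; simpc.
rewrite !sumE; under [X in (_ * (X +i* _)%C)]eq_bigr do rewrite cosN.
under [X in (_ * (_ +i* X)%C)]eq_bigr do rewrite sinN.
rewrite sumrN; simpc; rewrite -!expr2; congr (_ +i* _)%C.
by rewrite mulrC addNr.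
Qed.

(** Multiplicativity of complex exponentials: the product of the [d] double sums expands over
    functions [g], and taking real parts leaves cosines. *)
Lemma prod_trig_kernel (d T : nat) (z : 'I_d -> R) :
  \prod_l trig_kernel T (z l) =
  \sum_(g : {ffun 'I_d -> 'I_T * 'I_T}) cos (\sum_l ((g l).1%:R - (g l).2%:R) * z l).
Proof.
transitivity (complex.Re (\prod_l (trig_kernel T (z l))%:C%C)).
  suff -> : \prod_l (trig_kernel T (z l))%:C%C = (\prod_l trig_kernel T (z l))%:C%C by [].
  by rewrite rmorph_prod.
under eq_bigr do rewrite -trig_kernel_expi.
rewrite bigA_distr_bigA /=; under eq_bigr do rewrite -expi_sum.
by elim/big_rec2: _ => // g u v _ <-; case: v.
Qed.

End ComplexExponential.

(** * Lattice sums of trigonometric energies and counts of close pairs *)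

Section PairEnergy.
Context {R : realType} {d : nat}.

Lemma sum_inv_sqr_le (B : nat) : \sum_(k < B) (1 + k%:R ^+ 2)^-1 <= 3 :> R.
Proof.
suff h : \sum_(k < B) (1 + k%:R ^+ 2)^-1 <= 3 - 3 / B.+1%:R :> R.
  by apply: le_trans h _; rewrite gerBl divr_ge0.
elim: B => [|B IH]; first by rewrite big_ord0 divr1 subrr.
rewrite big_ord_recr /=; apply: le_trans (lerD IH (lexx _)) _.
have B0 : (0 : R) <= B%:R by [].
have e1 : B.+1%:R = B%:R + 1 :> R by rewrite natr1.
have e2 : B.+2%:R = B%:R + 2 :> R by rewrite -natrD addn2.
have h1 : 0 <= (2 * B%:R - 1) * (B%:R - 1) :> R.
  have [->|Bp] := posnP B; first by rewrite mulr0 !sub0r mulN1r opprK.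
  by have b1 : (1 : R) <= B%:R; [rewrite ler1n|apply: mulr_ge0; lra].
rewrite -lerBrDl e1 e2.
have -> : 3 - 3 / (B%:R + 2) - (3 - 3 / (B%:R + 1)) = 3 / ((B%:R + 1) * (B%:R + 2)) :> R.
  by field; apply/andP; split; apply/eqP; lra.
have p0 : 0 < (B%:R + 1) * (B%:R + 2) :> R by apply: mulr_gt0; lra.
have p1 : 0 < 1 + B%:R ^+ 2 :> R by rewrite ltr_pwDl // sqr_ge0.
rewrite ler_pdivlMr // ler_pdivrMl //; move: h1; lra.
Qed.

Lemma truncn_cell_dist (a b : R) : (0 <= a) = (0 <= b) ->
  Num.truncn `|a| = Num.truncn `|b| -> `|a - b| <= 1.
Proof.
move=> sij tij; have hi := truncnS_gt `|a|; have hj := truncnS_gt `|b|.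
have li : (Num.truncn `|a|)%:R <= `|a| by rewrite truncn_le.
have lj : (Num.truncn `|b|)%:R <= `|b| by rewrite truncn_le.
rewrite tij -natr1 in hi li; rewrite -natr1 in hj.
move: sij hi li hj lj; case: (leP 0 a) => si; case: (leP 0 b) => sj // _.
  by rewrite (ger0_norm si) (ger0_norm sj) ler_norml => *; apply/andP; split; lra.
by rewrite (ltr0_norm si) (ltr0_norm sj) ler_norml => *; apply/andP; split; lra.
Qed.

(** Points are sorted into cells by the sign and integer part of each coordinate. A cell has mass at
    most [Q], and the sum of the kernel over cells is a product of [d] one-dimensional sums, each at
    most 3 for either sign. *)
Lemma weighted_cell_count (I : finType) (c : I -> R) (x : I -> 'I_d -> R) (Q : R) :
  (forall i, 0 <= c i) ->
  (forall P : pred I, (forall i j, P i -> P j -> forall l, `|x i l - x j l| <= 1) ->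
     \sum_(i | P i) c i <= Q) ->
  \sum_i c i * \prod_l (1 + x i l ^+ 2)^-1 <= 6 ^+ d * Q.
Proof.
move=> c0 cQ.
have Q0 : 0 <= Q by have := cQ pred0; rewrite big_pred0 //; apply.
pose B := (\sum_i \sum_l Num.truncn `|x i l|)%N.
have xB i l : (Num.truncn `|x i l| < B.+1)%N.
  rewrite ltnS /B (bigD1 i) //= (bigD1 l) //= -addnA; exact: leq_addr.
pose cell i l : bool * 'I_B.+1 := (0 <= x i l, Ordinal (xB i l)).
pose kap (a : bool * 'I_B.+1) : R := (1 + a.2%:R ^+ 2)^-1.
have kap0 a : 0 <= kap a by rewrite invr_ge0 addr_ge0 ?sqr_ge0.
have sq (a : R) : 0 < 1 + a ^+ 2 by rewrite ltr_pwDl // sqr_ge0.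
have ker i l : (1 + x i l ^+ 2)^-1 <= kap (cell i l).
  rewrite lef_pV2 ?posrE ?sq // lerD2l -(real_normK (num_real (x i l))).
  by rewrite ler_sqr ?nnegrE // truncn_le.
apply: (@le_trans _ _ (\sum_i c i * \prod_l kap (cell i l))).
  apply: ler_sum => i _; rewrite ler_wpM2l //; apply: ler_prod => l _.
  by rewrite ker invr_ge0 ltW.
rewrite (partition_big (fun i => [ffun l => cell i l]) xpredT) //=.
apply: (@le_trans _ _ (\sum_(f : {ffun 'I_d -> bool * 'I_B.+1}) (\prod_l kap (f l)) * Q)).
  apply: ler_sum => f _.
  have -> : \sum_(i | [ffun l => cell i l] == f) c i * \prod_l kap (cell i l) =
      (\prod_l kap (f l)) * \sum_(i | [ffun l => cell i l] == f) c i.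
    rewrite mulr_sumr; apply: eq_bigr => i /eqP <-; rewrite mulrC; congr (_ * _).
    by apply: eq_bigr => l _; rewrite ffunE.
  rewrite ler_wpM2l ?prodr_ge0 //; apply: cQ => i j /eqP fi /eqP fj l.
  have : cell i l = cell j l by rewrite -[LHS](ffunE (cell i)) fi -fj ffunE.
  by case=> sij tij; exact: truncn_cell_dist.
rewrite -mulr_suml ler_wpM2r //.
rewrite -(bigA_distr_bigA (fun (l : 'I_d) a => kap a)) /=.
apply: (@le_trans _ _ (\prod_(l < d) 6)); last by rewrite prodr_const card_ord.
apply: ler_prod => l _; rewrite sumr_ge0 //=.
rewrite -(pair_bigA _ (fun (b : bool) (k : 'I_B.+1) => kap (b, k))) /= big_bool /=.
have := sum_inv_sqr_le B.+1; rewrite /kap /=; lra.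
Qed.

(** An integer vector presented as a difference of two vectors of the cube: a sum over [g] counts it
    with the multiplicity that it has in a product of Fejer kernels. *)
Definition frequency (T : nat) (g : {ffun 'I_d -> 'I_T * 'I_T}) : 'cV[R]_d :=
  \col_l ((g l).1%:R - (g l).2%:R).

(** Squared modulus at [z] of the Fourier transform of the measure with mass [c i] at [Y i]. *)
Definition trig_energy (I : finType) (c : I -> R) (Y : I -> 'cV[R]_d) (z : 'cV[R]_d) : R :=
  (\sum_i c i * cos (dot z (Y i))) ^+ 2 + (\sum_i c i * sin (dot z (Y i))) ^+ 2.

Lemma trig_energy_ge0 (I : finType) (c : I -> R) Y z : 0 <= trig_energy c Y z.
Proof. by rewrite addr_ge0 ?sqr_ge0. Qed.

Lemma trig_energyE (I : finType) (c : I -> R) Y z :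
  trig_energy c Y z = \sum_i \sum_j c i * c j * cos (dot z (Y i - Y j)).
Proof.
rewrite /trig_energy sqr_trig_sums; apply: eq_bigr => i _; apply: eq_bigr => j _.
by rewrite dotBr.
Qed.

Lemma sum_cos_frequency (T : nat) (z : 'cV[R]_d) :
  \sum_(g : {ffun 'I_d -> 'I_T * 'I_T}) cos (dot (frequency g) z) =
  \prod_l trig_kernel T (z l ord0).
Proof.
rewrite prod_trig_kernel; apply: eq_bigr => g _; congr cos.
by apply: eq_bigr => l _; rewrite mxE.
Qed.

(** Summed over frequencies, the energy becomes a sum over pairs of products of kernels, which by
    their decay count the pairs at distance about 1 / (T lam). The kernels are periodic, so the
    rescaled differences must stay in [-1, 1]. The constant is 102 = 17 * 6. *)
Lemma pair_energy_le (I : finType) (c : I -> R) (Y : I -> 'cV[R]_d) (lam Q : R) (T : nat) :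
  (forall i, 0 <= c i) ->
  (forall i j l, `|lam * (Y i - Y j) l ord0| <= 1) ->
  (forall P : pred I,
     (forall i j, P i -> P j -> forall l, T%:R * `|lam * (Y i - Y j) l ord0| <= 1) ->
     \sum_(i | P i) c i <= Q) ->
  \sum_(g : {ffun 'I_d -> 'I_T * 'I_T}) trig_energy c Y (lam *: frequency g) <=
  102 ^+ d * T%:R ^+ (2 * d) * Q * \sum_i c i.
Proof.
move=> c0 small cQ.
have -> : \sum_(g : {ffun 'I_d -> 'I_T * 'I_T}) trig_energy c Y (lam *: frequency g) =
    \sum_i c i * \sum_j c j * \prod_l trig_kernel T (lam * (Y j - Y i) l ord0).
  under eq_bigr do rewrite trig_energyE.
  rewrite exchange_big /=.
  under eq_bigr do rewrite exchange_big /=.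
  rewrite exchange_big /=; apply: eq_bigr => i _; rewrite mulr_sumr; apply: eq_bigr => j _.
  rewrite -mulr_sumr mulrA (mulrC (c i)); congr (_ * _).
  transitivity (\sum_(g : {ffun 'I_d -> 'I_T * 'I_T}) cos (dot (frequency g) (lam *: (Y j - Y i)))).
    by apply: eq_bigr => g _; rewrite dotZl dotZr.
  by rewrite sum_cos_frequency; apply: eq_bigr => l _; rewrite mxE.
rewrite [leRHS]mulr_sumr; apply: ler_sum => i _; rewrite [leRHS]mulrC ler_wpM2l //.
apply: (@le_trans _ _ (\sum_j c j * ((17 * T%:R ^+ 2) ^+ d *
    \prod_l (1 + (T%:R * (lam * (Y j - Y i) l ord0)) ^+ 2)^-1))).
  apply: ler_sum => j _; rewrite ler_wpM2l //.
  rewrite -[in (17 * _) ^+ d](card_ord d) -prodr_const -big_split /=; apply: ler_prod => l _.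
  rewrite trig_kernel_ge0 /= ler_pdivlMr; last by rewrite ltr_pwDl // sqr_ge0.
  exact: trig_kernel_decay.
have -> : 102 ^+ d * T%:R ^+ (2 * d) * Q = (17 * T%:R ^+ 2) ^+ d * (6 ^+ d * Q) :> R.
  by rewrite exprM exprMn (_ : 102 = 17 * 6 :> R) ?exprMn; [ring|rewrite -natrM].
under eq_bigr do rewrite mulrCA.
rewrite -mulr_sumr ler_wpM2l ?exprn_ge0 ?mulr_ge0 ?sqr_ge0 //.
apply: weighted_cell_count => // P HP; apply: cQ => j k Pj Pk l.
have := HP j k Pj Pk l.
have -> : T%:R * (lam * (Y j - Y i) l ord0) - T%:R * (lam * (Y k - Y i) l ord0) =
   T%:R * (lam * (Y j - Y k) l ord0) by rewrite !mxE; ring.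
by rewrite normrM normr_nat.
Qed.

Lemma sum_injective_le (I J : finType) (P : pred I) (h : I -> J) (f : J -> R) :
  (forall j, 0 <= f j) -> {in P &, injective h} ->
  \sum_(i | P i) f (h i) <= \sum_j f j.
Proof.
move=> f0 hi.
have hi' : {in [set i | P i]%SET &, injective h} by move=> i j; rewrite !inE; exact: hi.
have -> : \sum_(i | P i) f (h i) = \sum_(i in [set i | P i]%SET) f (h i).
  by apply: eq_bigl => i; rewrite inE.
rewrite -(big_imset f hi') /=.
by rewrite [leRHS](bigID (mem (h @: [set i | P i]%SET))) /= lerDl sumr_ge0.
Qed.

(** A vector with entries below [L] in absolute value is a difference in at most M^d ways in the
    cube of side [M], and in at least L^d ways in that of side 2 L. The injection keeps the second
    term of [g] and translates the positive and negative parts of the difference by [s]. *)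
Lemma sum_frequency_near_le (M L : nat) (f : 'cV[R]_d -> R) : (forall z, 0 <= f z) ->
  L%:R ^+ d * \sum_(g : {ffun 'I_d -> 'I_M * 'I_M} |
     [forall l, ((g l).1 - (g l).2 < L)%N && ((g l).2 - (g l).1 < L)%N]) f (frequency g) <=
  M%:R ^+ d * \sum_(g : {ffun 'I_d -> 'I_(2 * L) * 'I_(2 * L)}) f (frequency g).
Proof.
move=> f0; have Lle : (L <= 2 * L)%N by rewrite leq_pmull.
pose P (p : {ffun 'I_d -> 'I_L} * {ffun 'I_d -> 'I_M * 'I_M}) :=
  [forall l, ((p.2 l).1 - (p.2 l).2 < L)%N && ((p.2 l).2 - (p.2 l).1 < L)%N].
pose up (s : 'I_L) (m : nat) : 'I_(2 * L) := insubd (widen_ord Lle s) (s + m)%N.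
have upE s m : (m < L)%N -> up s m = (s + m)%N :> nat.
  move=> mL; have lt2 : (s + m < 2 * L)%N by rewrite mul2n -addnn -addSn leq_add // ltnW.
  by rewrite val_insubd lt2.
pose h (p : {ffun 'I_d -> 'I_L} * {ffun 'I_d -> 'I_M * 'I_M}) :=
  ([ffun l => (p.2 l).2], [ffun l => (up (p.1 l) ((p.2 l).1 - (p.2 l).2)%N, up (p.1 l) ((p.2 l).2 - (p.2 l).1)%N)]).
have constE (n : nat) (A : R) : n%:R ^+ d * A = \sum_(s : {ffun 'I_d -> 'I_n}) A.
  by rewrite [RHS]sumr_const card_ffun !card_ord -[RHS]mulr_natl natrX.
rewrite !constE.
rewrite (pair_big (xpredT : pred {ffun 'I_d -> 'I_L}) _ (fun s g => f (frequency g))) /=.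
rewrite (pair_bigA _ (fun (s : {ffun 'I_d -> 'I_M}) (g : {ffun 'I_d -> 'I_(2 * L) * 'I_(2 * L)}) => f (frequency g))) /=.
rewrite (eq_bigr (fun p => f (frequency (h p).2))); last first.
  move=> [s g] /= /forallP Pg; congr f; apply/matrixP => l k; rewrite !mxE !ffunE /=.
  have /andP[h1 h2] := Pg l; rewrite !upE // !natrD.
  case: (leqP (g l).1 (g l).2) => [le|/ltnW le].
    by rewrite (eqP le) natrB //; ring.
  by rewrite [X in _ - (_ + X%:R)](eqP le) natrB //; ring.
apply: (@sum_injective_le _ _ P h (fun q => f (frequency q.2))) => //.
move=> [s g] [s' g']; rewrite !unfold_in /= => /forallP Pg /forallP Pg' [] /ffunP e1 /ffunP e2.
have E l : g l = g' l /\ s l = s' l.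
  have := e1 l; have := e2 l; rewrite !ffunE /= => -[/(congr1 val) a1 /(congr1 val) a2] b.
  have /andP[h1 h2] := Pg l; have /andP[h1' h2'] := Pg' l.
  move: a1 a2; rewrite /= !upE // => a1 a2.
  have b' : (g l).2 = (g' l).2 :> nat by rewrite b.
  move: (g l) (g' l) (s l) (s' l) a1 a2 b b' {h1 h2 h1' h2' Pg Pg' e1 e2} => [p q] [p' q'] t t' /= a1 a2 b b'.
  have [e3 e4] : p = p' :> nat /\ t = t' :> nat by move: a1 a2 b'; clear; lia.
  by split; [rewrite b; congr pair; exact: val_inj|exact: val_inj].
by congr pair; apply/ffunP => l; case: (E l).
Qed.

(** A lattice point k of the cube is the difference of s + k and s for each of T^d choices of s. *)
Lemma sum_lattice_le (T : nat) (f : 'cV[R]_d -> R) : (forall z, 0 <= f z) ->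
  T%:R ^+ d * \sum_(k : {ffun 'I_d -> 'I_T}) f (\col_l (k l)%:R) <=
  \sum_(g : {ffun 'I_d -> 'I_(2 * T) * 'I_(2 * T)}) f (frequency g).
Proof.
move=> f0; have Tle : (T <= 2 * T)%N by rewrite leq_pmull.
have lt2 (a b : 'I_T) : (a + b < 2 * T)%N by rewrite mul2n -addnn -addSn leq_add // ltnW.
pose h (p : {ffun 'I_d -> 'I_T} * {ffun 'I_d -> 'I_T}) :=
  [ffun l => (Ordinal (lt2 (p.1 l) (p.2 l)), widen_ord Tle (p.1 l))].
have -> : T%:R ^+ d * \sum_(k : {ffun 'I_d -> 'I_T}) f (\col_l (k l)%:R) =
    \sum_(p : {ffun 'I_d -> 'I_T} * {ffun 'I_d -> 'I_T}) f (frequency (h p)).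
  rewrite -(pair_bigA _ (fun s k => f (frequency (h (s, k))))) /=.
  transitivity (\sum_(s : {ffun 'I_d -> 'I_T}) \sum_(k : {ffun 'I_d -> 'I_T}) f (\col_l (k l)%:R)).
    by rewrite [RHS]sumr_const card_ffun !card_ord -[RHS]mulr_natl natrX.
  apply: eq_bigr => s _; apply: eq_bigr => k _; congr f; apply/matrixP => l j; rewrite !mxE ffunE /= natrD; ring.
apply: (@sum_injective_le _ _ xpredT h (fun q => f (frequency q))) => //.
move=> [s k] [s' k'] _ _ /ffunP e.
have E l : s l = s' l /\ k l = k' l.
  have := e l; rewrite !ffunE /= => -[a1 a2].
  have a3 : s l = s' l by apply: val_inj.
  by split => //; apply: val_inj => /=; move: a1; rewrite a3 => /addnI.
by congr pair; apply/ffunP => l; case: (E l).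
Qed.

End PairEnergy.

(** * A net on the boundary of a convex body *)

Section BoundaryNet.
Context {R : realType} {d : nat}.
Variable K : set 'cV[R]_d.
Hypothesis bK : convex_body K.
Hypothesis sK : origin_symmetric K.

Variable M : nat.
Hypothesis M0 : (0 < M)%N.

Let MR : (0 : R) < M%:R. Proof. by rewrite ltr0n. Qed.

Definition cube_pt (m : {ffun 'I_d -> 'I_(2 * M).+1}) : 'cV[R]_d :=
  \col_l ((m l)%:R / M%:R - 1).

Definition net_weight (m : {ffun 'I_d -> 'I_(2 * M).+1}) : R :=
  [exists j, (m j == 0 :> nat) || (m j == (2 * M)%N :> nat)]%:R.

(** Radial projection to the boundary of [K] of a grid on the cube [-1, 1]^d. All grid points serve
    as indices, and [net_weight] selects those on the surface of the cube. *)
Definition net_pt (m : {ffun 'I_d -> 'I_(2 * M).+1}) : 'cV[R]_d :=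
  (body_norm K (cube_pt m))^-1 *: cube_pt m.

Lemma net_weight_ge0 m : 0 <= net_weight m.
Proof. by rewrite /net_weight ler0n. Qed.

Lemma cube_pt_le m l : `|cube_pt m l ord0| <= 1.
Proof.
have h : (m l)%:R <= 2 * M%:R :> R by rewrite -natrM ler_nat -ltnS.
rewrite mxE ler_norml lerBrDr addNr divr_ge0 ?lerBlDr ?ler_pdivrMr //=.
Qed.

Lemma cube_pt_boundary m : net_weight m != 0 -> exists a, `|cube_pt m a ord0| = 1.
Proof.
rewrite /net_weight pnatr_eq0 eqb0 negbK => /existsP[a ha]; exists a; rewrite mxE.
case/orP: ha => /eqP ->; first by rewrite mul0r sub0r normrN normr1.
by rewrite natrM mulfK ?lt0r_neq0 // (_ : 2 - 1 = 1) ?normr1 //; lra.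
Qed.

Lemma net_pt_enorm (R0 : R) m : 0 < R0 -> (forall x, K x -> enorm x <= R0) -> enorm (net_pt m) <= R0.
Proof.
move=> R00 KR; apply: le_trans (enorm_le_body_norm bK sK _ R00 KR) _.
rewrite -[leRHS]mulr1 ler_wpM2l ?(ltW R00) // body_normZ //.
have p0 := body_norm_ge0 bK sK (cube_pt m); rewrite normfV (ger0_norm p0).
by have [->|pn] := eqVneq (body_norm K (cube_pt m)) 0; rewrite ?mulr0 // mulVf.
Qed.

(** Scaled to sup norm 1, [x] is rounded down to the grid; a coordinate equal to 1 or -1 is already
    on it, so the result stays on the surface of the cube. The radial projection then distorts the
    error 1 / M by a bounded factor only. *)
Lemma net_pt_dense (r0 R0 : R) : 0 < r0 -> (forall x, enorm x <= r0 -> K x) ->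
  0 < R0 -> (forall x, K x -> enorm x <= R0) ->
  forall x, body_norm K x = 1 ->
  exists2 m, net_weight m = 1 & enorm (x - net_pt m) <= d%:R * (R0 + R0 ^+ 2 / r0) / M%:R.
Proof.
move=> r00 rK R00 KR x x1.
have x0 : x != 0.
  by apply/negP => /eqP xE; have := body_norm0 bK sK; rewrite -xE x1 => /eqP; rewrite oner_eq0.
have [a0 xa0] : exists a, x a ord0 != 0.
  apply/existsP; apply: contraR x0 => /existsPn h; apply/eqP/matrixP => i j.
  by rewrite ord1 mxE; apply/eqP; have := h i; rewrite negbK.
pose a := [arg max_(i > a0) `|x i ord0|]%O.
have amax l : `|x l ord0| <= `|x a ord0| by rewrite /a; case: arg_maxP => // i _; apply.
have N0 : 0 < `|x a ord0| by apply: lt_le_trans (amax a0); rewrite normr_gt0.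
set N := `|x a ord0| in amax N0.
pose y := N^-1 *: x.
have y1 l : `|y l ord0| <= 1.
  by rewrite mxE normrM normfV (gtr0_norm N0) mulrC ler_pdivrMr // mul1r.
have yM l : 0 <= (y l ord0 + 1) * M%:R <= (2 * M)%:R.
  have := y1 l; rewrite ler_norml => /andP[h1 h2].
  by rewrite mulr_ge0 ?(ltW MR) // ?natrM ?ler_pM2r //; lra.
have mlt l : (Num.truncn ((y l ord0 + 1) * M%:R) < (2 * M).+1)%N.
  have /andP[h1 h2] := yM l.
  by rewrite ltnS -(ler_nat R) (le_trans _ h2) // truncn_le.
pose m := [ffun l => Ordinal (mlt l)].
have qy l : `|(y - cube_pt m) l ord0| <= M%:R^-1.
  have /andP[h1 _] := yM l.
  have : 0 <= (y l ord0 + 1) * M%:R - (m l)%:R <= 1.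
    rewrite ffunE /= subr_ge0 truncn_le // h1 /= lerBlDr.
    by rewrite [leRHS]addrC natr1 ltW // truncnS_gt.
  have -> : (y - cube_pt m) l ord0 = ((y l ord0 + 1) * M%:R - (m l)%:R) / M%:R.
    rewrite [LHS]mxE [X in _ + X]mxE [X in - X]mxE; set t := y l ord0; set k := (m l)%:R.
    by clearbody t k; field; rewrite lt0r_neq0.
  move=> /andP[g1 g2]; rewrite ger0_norm ?divr_ge0 ?(ltW MR) //.
  by rewrite ler_pdivrMr // mulVf ?lt0r_neq0.
have cm : net_weight m = 1.
  rewrite /net_weight; suff -> : [exists j, (m j == 0 :> nat) || (m j == (2 * M)%N :> nat)] by [].
  apply/existsP; exists a.
  have : `|y a ord0| = 1 by rewrite mxE normrM normfV (gtr0_norm N0) mulVf ?lt0r_neq0.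
  rewrite ffunE /=; move/eqP; rewrite eqr_norml ler01 andbT => /orP[/eqP->|/eqP->].
    by rewrite (_ : (1 + 1) * M%:R = (2 * M)%:R :> R) ?natrM // -natrM natrK eqxx orbT.
  by rewrite addNr mul0r truncn0 eqxx.
exists m => //; have c1 : net_weight m != 0 by rewrite cm oner_neq0.
have [b qb] := cube_pt_boundary c1.
pose q := cube_pt m; pose p := body_norm K q; pose ps := body_norm K y.
have inv_le z : 1 <= enorm z -> (body_norm K z)^-1 <= R0 /\ 0 < body_norm K z.
  move=> z1; have h := le_trans z1 (enorm_le_body_norm bK sK z R00 KR).
  have z0 : 0 < body_norm K z.
    by rewrite lt0r body_norm_ge0 // andbT; apply: contraTneq h => ->; rewrite mulr0 ler10.
  by split => //; rewrite -[leLHS]div1r ler_pdivrMr.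
have [p1 p0] : p^-1 <= R0 /\ 0 < p.
  by apply: inv_le; rewrite -qb; exact: coord_le_enorm.
have [ps1 ps0] : ps^-1 <= R0 /\ 0 < ps.
  apply: inv_le; apply: le_trans (coord_le_enorm _ a).
  by rewrite mxE normrM normfV (gtr0_norm N0) mulVf ?lt0r_neq0.
have psE : ps = N^-1 by rewrite /ps body_normZ // x1 mulr1 gtr0_norm // invr_gt0.
have xE : x = ps^-1 *: y by rewrite psE invrK scalerA divff ?scale1r // lt0r_neq0.
have dy : enorm (y - q) <= d%:R / M%:R by apply: enorm_le_coord => //; rewrite invr_ge0 ltW.
have dp : `|p - ps| <= enorm (y - q) / r0 by rewrite enormB; exact: body_norm_dist.
(* The first term compares the points of the cube, the second the scaling factors, which are
   Lipschitz in the point. *)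
have -> : x - net_pt m = ps^-1 *: (y - q) + ((p - ps) * ps^-1) *: net_pt m.
  rewrite {1}xE /net_pt -/q -/p; apply/matrixP => i j; rewrite !mxE.
  by field; rewrite !lt0r_neq0.
apply: le_trans (ler_enormD _ _) _; rewrite (enormZ ps^-1) (enormZ ((p - ps) * ps^-1)) normrM normfV (gtr0_norm ps0).
have e0 := enorm_ge0 (y - q).
apply: (@le_trans _ _ (R0 * enorm (y - q) + (enorm (y - q) / r0 * R0) * R0)).
  apply: lerD; first by rewrite ler_wpM2r.
  have ps0' : 0 <= ps^-1 by rewrite invr_ge0 ltW.
  apply: ler_pM; [by rewrite mulr_ge0|exact: enorm_ge0|by apply: ler_pM|exact: net_pt_enorm].
have -> : R0 * enorm (y - q) + enorm (y - q) / r0 * R0 * R0 = (R0 + R0 ^+ 2 / r0) * enorm (y - q).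
  by field; rewrite lt0r_neq0.
rewrite -mulrA mulrCA ler_wpM2l //.
by rewrite addr_ge0 ?divr_ge0 ?sqr_ge0 ?(ltW R00) ?(ltW r00).
Qed.

(** The inverse of the radial projection is Lipschitz as well. A surface point q of the cube has sup
    norm 1, so its body norm p is the reciprocal of the sup norm of its net point; hence close net
    points satisfy |p - p'| <= p p' r. *)
Lemma net_pt_separated (r0 r : R) m m' : 0 < r0 -> (forall x, enorm x <= r0 -> K x) ->
  net_weight m != 0 -> net_weight m' != 0 ->
  enorm (net_pt m - net_pt m') <= r ->
  forall l, `|(m l)%:R - (m' l)%:R| <= 2 * d%:R / r0 * r * M%:R :> R.
Proof.
move=> r00 rK cm cm' hr l.
have r_ge0 : 0 <= r by exact: le_trans (enorm_ge0 _) hr.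
pose q := cube_pt m; pose q' := cube_pt m'; pose p := body_norm K q; pose p' := body_norm K q'.
have p_le k : body_norm K (cube_pt k) <= d%:R / r0.
  apply: le_trans (body_norm_le_enorm (cube_pt k) r00 rK) _.
  rewrite ler_pM2r ?invr_gt0 // -[leRHS]mulr1; apply: enorm_le_coord => // i; exact: cube_pt_le.
have pE k : net_weight k != 0 -> cube_pt k = body_norm K (cube_pt k) *: net_pt k /\ 0 < body_norm K (cube_pt k).
  move=> ck; have [b qb] := cube_pt_boundary ck.
  have [R1 R10 KR] := convex_body_bounded bK.
  have h := enorm_le_body_norm bK sK (cube_pt k) R10 KR.
  have p0 : 0 < body_norm K (cube_pt k).
    rewrite lt0r body_norm_ge0 // andbT; apply: contraTneq h => ->; rewrite mulr0 -ltNge.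
    by apply: lt_le_trans (coord_le_enorm _ b); rewrite qb.
  by split => //; rewrite scalerA divff ?scale1r // lt0r_neq0.
have key k k' : net_weight k != 0 -> net_weight k' != 0 -> enorm (net_pt k - net_pt k') <= r ->
    body_norm K (cube_pt k') - body_norm K (cube_pt k) <=
    body_norm K (cube_pt k) * body_norm K (cube_pt k') * r.
  move=> ck ck' hk; have [qE pk0] := pE _ ck; have [qE' pk0'] := pE _ ck'.
  have [a qa] := cube_pt_boundary ck.
  set s := body_norm K (cube_pt k) in qE pk0 *; set s' := body_norm K (cube_pt k') in qE' pk0' *.
  have h1 : s * `|net_pt k a ord0| = 1.
    by rewrite -[RHS]qa [in RHS]qE [in RHS]mxE normrM (gtr0_norm pk0).
  have h2 : s' * `|net_pt k' a ord0| <= 1.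
    by apply: le_trans (cube_pt_le k' a); rewrite [in leRHS]qE' [in leRHS]mxE normrM (gtr0_norm pk0').
  have h3 : `|net_pt k a ord0| <= `|net_pt k' a ord0| + r.
    rewrite -lerBlDl; apply: le_trans (lerB_dist _ _) _; apply: le_trans hk.
    by have := coord_le_enorm (net_pt k - net_pt k') a; rewrite !mxE.
  have h4 : s' * (s * `|net_pt k a ord0|) <= s * (1 + s' * r).
    rewrite mulrCA ler_wpM2l ?(ltW pk0) //.
    apply: le_trans (ler_wpM2l (ltW pk0') h3) _; rewrite mulrDr; exact: lerD.
  by rewrite h1 mulr1 in h4; rewrite lerBlDl -mulrA -[X in X + _]mulr1 -mulrDr.
have [qE p0] := pE _ cm; have [qE' p0'] := pE _ cm'.
rewrite -/q -/p in qE p0; rewrite -/q' -/p' in qE' p0'.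
have k1 := key _ _ cm cm' hr; have k2 := key _ _ cm' cm; rewrite enormB in k2.
have {k2} k2 := k2 hr; rewrite -/p -/p' in k1 k2.
have dp : `|p - p'| <= p * p' * r by rewrite ler_norml; apply/andP; split; [move: k1|move: k2; rewrite (mulrC p')]; lra.
have -> : (m l)%:R - (m' l)%:R = (q - q') l ord0 * M%:R.
  by rewrite !mxE; field; rewrite lt0r_neq0.
rewrite normrM (gtr0_norm MR) ler_pM2r //.
have -> : q - q' = p *: (net_pt m - net_pt m') + (p - p') *: net_pt m'.
  by rewrite {1}qE {1}qE' scalerBr scalerBl addrA subrK.
rewrite [X in `|X|]mxE; apply: le_trans (ler_normD _ _) _.
have t1 : `|(p *: (net_pt m - net_pt m')) l ord0| <= p * r.
  rewrite [X in `|X|]mxE normrM (gtr0_norm p0) ler_wpM2l ?(ltW p0) //.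
  by apply: le_trans (coord_le_enorm _ l) _.
have t2 : `|((p - p') *: net_pt m') l ord0| <= p * r.
  rewrite [X in `|X|]mxE normrM; apply: le_trans (ler_wpM2r (normr_ge0 _) dp) _.
  have -> : p * p' * r * `|net_pt m' l ord0| = p * r * (p' * `|net_pt m' l ord0|) by ring.
  rewrite ler_piMr ?mulr_ge0 ?(ltW p0) //.
  by apply: le_trans (cube_pt_le m' l); rewrite -/q' [in leRHS]qE' [in leRHS]mxE normrM (gtr0_norm p0').
apply: le_trans (lerD t1 t2) _.
have := ler_wpM2r r_ge0 (p_le m); rewrite -/q -/p; lra.
Qed.


Lemma near_index_count (n a l : nat) :
  \sum_(b < n) (`|b%:R - a%:R| <= l%:R :> R)%R%:R <= (2 * l).+1%:R :> R.
Proof.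
have -> : \sum_(b < n) (`|b%:R - a%:R| <= l%:R :> R)%R%:R =
    \sum_(b < n | (`|b%:R - a%:R| <= l%:R :> R)) 1 :> R.
  by rewrite [RHS]big_mkcond; apply: eq_bigr => b _; case: ifP.
have H (b : 'I_n) : `|b%:R - a%:R| <= l%:R :> R -> (a <= b + l)%N /\ (b <= a + l)%N.
  rewrite ler_norml => /andP[h1 h2]; split; rewrite -(ler_nat R) natrD; lra.
pose h (b : 'I_n) : 'I_(2 * l).+1 := inord (b + l - a).
apply: (@le_trans _ _ (\sum_(b < (2 * l).+1) 1)); last by rewrite sumr_const card_ord.
apply: (@sum_injective_le _ _ _ _ h (fun=> 1)) => // b b'; rewrite !unfold_in => /H[h1 h2] /H[h3 h4].
move=> /(congr1 val); rewrite /= !inordK; [|by clear -h3 h4; lia|by clear -h1 h2; lia].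
by move=> e; apply: val_inj => /=; clear -h1 h2 h3 h4 e; lia.
Qed.

Lemma nat_dist_truncn (a b : nat) (x : R) : `|a%:R - b%:R| <= x ->
  `|a%:R - b%:R| <= (Num.truncn x)%:R :> R.
Proof.
have -> : `|a%:R - b%:R| = ((a - b) + (b - a))%:R :> R.
  case: (leqP a b) => [le|/ltnW le].
    by rewrite distrC -natrB // normr_nat (eqP le).
  by rewrite -natrB // normr_nat (eqP le) addn0.
by move=> /le_lt_trans /(_ (truncnS_gt x)); rewrite ltr_nat ltnS ler_nat.
Qed.

(** Indices of close net points agree up to [l] in each coordinate, and one coordinate is fixed at
    an end of its range: 2 d faces with at most (2 l + 1)^(d-1) indices each. The exponent d - 1 is
    the dimension of the boundary. *)
Lemma net_count (r0 r : R) (P : pred {ffun 'I_d -> 'I_(2 * M).+1}) :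
  0 < r0 -> (forall x, enorm x <= r0 -> K x) -> M%:R^-1 <= r ->
  (forall m m', P m -> P m' -> enorm (net_pt m - net_pt m') <= r) ->
  \sum_(m | P m) net_weight m <= 2 * d%:R * ((4 * d%:R / r0 + 1) * (r * M%:R)) ^+ d.-1.
Proof.
move=> r00 rK Mr HP.
have rM : 1 <= r * M%:R by rewrite -ler_pdivrMr // div1r.
have r_gt0 : 0 < r by apply: lt_le_trans Mr; rewrite invr_gt0.
have A0 : 0 <= 2 * d%:R / r0 * r * M%:R by rewrite !mulr_ge0 ?invr_ge0 // ltW.
have B0 : 0 <= (4 * d%:R / r0 + 1) * (r * M%:R).
  by rewrite mulr_ge0 ?addr_ge0 ?mulr_ge0 ?invr_ge0 // ltW.
have [[m0 [Pm0 cm0]]|no] := pselect (exists m, P m /\ net_weight m != 0); last first.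
  rewrite big1 ?mulr_ge0 ?exprn_ge0 // => m Pm; apply: contrapT => /eqP cm.
  by apply: no; exists m.
pose l := Num.truncn (2 * d%:R / r0 * r * M%:R).
have near m : P m -> net_weight m != 0 -> forall i, `|(m i)%:R - (m0 i)%:R| <= l%:R :> R.
  move=> Pm cm i; have h := net_pt_separated r00 rK cm cm0 (HP _ _ Pm Pm0) i.
  exact: nat_dist_truncn.
pose w (j : 'I_d) (v : nat) (i : 'I_d) (b : 'I_(2 * M).+1) : R :=
  if i == j then (b == v :> nat)%:R else (`|b%:R - (m0 i)%:R| <= l%:R :> R)%R%:R.
have w0 j v i b : 0 <= w j v i b by rewrite /w; case: ifP.
have S j v : \sum_(m : {ffun 'I_d -> 'I_(2 * M).+1}) \prod_i w j v i (m i) <= (2 * l).+1%:R ^+ d.-1.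
  rewrite -(bigA_distr_bigA (fun i b => w j v i b)) /=.
  rewrite (bigD1 j) //=; apply: (@le_trans _ _ (1 * \prod_(i < d | i != j) (2 * l).+1%:R)); last first.
    by rewrite mul1r prodr_const cardC1 card_ord.
  have sw0 i : 0 <= \sum_(b < (2 * M).+1) w j v i b by apply: sumr_ge0.
  apply: ler_pM; [exact: sw0|by apply: prodr_ge0|..].
    rewrite /w eqxx.
    have [vM|vM] := ltnP v (2 * M).+1; last first.
      by rewrite big1 // => b _; rewrite ltn_eqF // (leq_trans (ltn_ord b)).
    rewrite (bigD1 (Ordinal vM)) //= eqxx big1 ?addr0 // => b bv.
    by apply/eqP; rewrite pnatr_eq0 eqb0; apply: contra bv => /eqP e; apply/eqP/val_inj.
  apply: ler_prod => i ij; rewrite sw0 /= /w (negbTE ij).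
  exact: near_index_count.
have pt m : P m -> net_weight m <= \sum_j (\prod_i w j 0%N i (m i) + \prod_i w j (2 * M)%N i (m i)).
  move=> Pm; have pr0 j v : 0 <= \prod_i w j v i (m i) by rewrite prodr_ge0.
  have [->|cm] := eqVneq (net_weight m) 0; first by rewrite sumr_ge0 // => j _; exact: addr_ge0.
  have nm := near _ Pm cm.
  move: cm; rewrite /net_weight pnatr_eq0 eqb0 negbK => ex; rewrite ex.
  have /existsP[j hj] := ex.
  have one v : m j = v :> nat -> \prod_i w j v i (m i) = 1.
    move=> mv; rewrite big1 // => i _; rewrite /w; case: eqVneq => [->|_]; first by rewrite mv eqxx.
    by rewrite nm.
  rewrite (bigD1 j) //= -[leLHS]addr0; apply: lerD; last first.
    by rewrite sumr_ge0 // => i _; exact: addr_ge0.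
  by case/orP: hj => /eqP /one ->; rewrite ?lerDl ?lerDr.
apply: (@le_trans _ _ (\sum_(m : {ffun 'I_d -> 'I_(2 * M).+1}) \sum_j (\prod_i w j 0%N i (m i) + \prod_i w j (2 * M)%N i (m i)))).
  rewrite [leLHS]big_mkcond; apply: ler_sum => m _; case: ifP => [/pt //|_].
  by apply: sumr_ge0 => j _; apply: addr_ge0; apply: prodr_ge0.
rewrite exchange_big /=.
apply: (@le_trans _ _ (\sum_(j < d) 2 * ((2 * l).+1%:R ^+ d.-1))).
  apply: ler_sum => j _; rewrite big_split /=; have := S j 0%N; have := S j (2 * M)%N; lra.
rewrite sumr_const card_ord -[leLHS]mulr_natl mulrA (mulrC d%:R) ler_wpM2l //.
apply: lerXn2r; rewrite ?nnegrE //.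
have : l%:R <= 2 * d%:R / r0 * r * M%:R by rewrite truncn_le.
have -> : (2 * l).+1%:R = 2 * l%:R + 1 :> R by rewrite -addn1 natrD natrM.
clear S pt near HP; move: rM; lra.
Qed.

End BoundaryNet.

(** * Decay of rotation averages *)

Section EnergyMeans.
Context {R : realType} {d : nat}.
Notation mxT := (borel_mx R d).
Local Notation SO := (@SO R d).

Lemma measurable_trig_energy (disp : measure_display) (T : measurableType disp) (I : finType)
    (c : I -> R) (Y : I -> 'cV[R]_d) (phi : T -> 'cV[R]_d) :
  (forall i, measurable_fun setT (fun t => phi t i ord0)) ->
  measurable_fun setT (fun t => trig_energy c Y (phi t)).
Proof.
move=> mphi.
have mdot i : measurable_fun setT (fun t => dot (phi t) (Y i)).
  by apply: measurable_sum => j; exact: measurable_funM.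
apply: measurable_funD; apply: measurable_funX; apply: measurable_sum => i;
  apply: measurable_funM => //.
  apply: (measurableT_comp (continuous_measurable_fun (@continuous_cos R))); exact: mdot.
apply: (measurableT_comp (continuous_measurable_fun (@continuous_sin R))); exact: mdot.
Qed.

Lemma measurable_sum_cond (I : Type) (s : seq I) (P : pred I) (f : I -> mxT -> R) :
  (forall i, measurable_fun setT (f i)) ->
  measurable_fun setT (fun x => \sum_(i <- s | P i) f i x).
Proof. by move=> mf; under eq_fun do rewrite -big_filter; exact: measurable_sum. Qed.

Lemma measurable_mulmx_coord (z : 'cV[R]_d) i :
  measurable_fun setT (fun rho : mxT => ((rho : 'M[R]_d) *m z) i ord0).
Proof.
under eq_fun do rewrite mxE.
by apply: measurable_sum => j; apply: measurable_funM => //; exact: measurable_entry.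
Qed.

Lemma measurable_trmx_coord (z : 'cV[R]_d) i :
  measurable_fun setT (fun rho : mxT => ((rho : 'M[R]_d)^T *m z) i ord0).
Proof.
under eq_fun do rewrite mxE.
apply: measurable_sum => j; apply: measurable_funM => //.
under eq_fun do rewrite mxE; exact: measurable_entry.
Qed.

Lemma measurable_trmx_mulmx_coord (z : 'cV[R]_d) i :
  measurable_fun setT (fun p : mxT * mxT => ((p.1 : 'M[R]_d)^T *m ((p.2 : 'M[R]_d) *m z)) i ord0).
Proof.
under eq_fun do rewrite mxE.
apply: measurable_sum => j; apply: measurable_funM.
  under eq_fun do rewrite mxE.
  apply: (measurableT_comp (measurable_entry j i)); exact: measurable_fst.
apply: (measurableT_comp (measurable_mulmx_coord z j)); exact: measurable_snd.
Qed.

Lemma trig_energy_rot (I : finType) (c : I -> R) (Y : I -> 'cV[R]_d) (rho : 'M[R]_d) z :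
  trig_energy c Y (rho *m z) = trig_energy c (fun i => rho^T *m Y i) z.
Proof.
by congr (_ ^+ 2 + _ ^+ 2); apply: eq_bigr => i _; rewrite dot_mulmx.
Qed.

Lemma trig_energy_lipschitz (I : finType) (c : I -> R) (Y : I -> 'cV[R]_d) (D : R) z z' :
  (forall i, 0 <= c i) -> (forall i j, enorm (Y i - Y j) <= D) ->
  trig_energy c Y z <= trig_energy c Y z' + (\sum_i c i) ^+ 2 * D * enorm (z - z').
Proof.
move=> c0 YD; rewrite !trig_energyE.
have -> : (\sum_i c i) ^+ 2 * D * enorm (z - z') = \sum_i \sum_j c i * c j * (D * enorm (z - z')).
  rewrite expr2 -mulrA mulr_suml mulr_suml; apply: eq_bigr => i _.
  by rewrite -mulrA mulr_suml mulr_sumr; apply: eq_bigr => j _; rewrite mulrA.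
rewrite -big_split /=; apply: ler_sum => i _; rewrite -big_split /=; apply: ler_sum => j _.
rewrite -mulrDr ler_wpM2l ?mulr_ge0 // -lerBlDl.
apply: le_trans (ler_norm _) _; apply: le_trans (cos_lipschitz _ _) _.
rewrite -dotBl; apply: le_trans (cauchy_schwarz_dot _ _) _.
by rewrite mulrC ler_wpM2r ?enorm_ge0.
Qed.

Variable j0 : 'I_d.

(** The point of the sphere of radius [l] above [k], in the direction [j0]. The entry [k j0] gives
    way to the height and remains in the index as a multiplicity [N]. *)
Definition sphere_lift (l N : nat) (k : {ffun 'I_d -> 'I_N}) : 'cV[R]_d :=
  \col_j (if j == j0 then Num.sqrt (l%:R ^+ 2 - \sum_(i | i != j0) (k i)%:R ^+ 2) else (k j)%:R).

Lemma sum_sqr_le (l N : nat) (k : {ffun 'I_d -> 'I_N}) : (d * N <= l)%N ->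
  \sum_(i | i != j0) (k i)%:R ^+ 2 <= l%:R ^+ 2 :> R.
Proof.
move=> dN; apply: (@le_trans _ _ (\sum_(i < d) N%:R ^+ 2)).
  rewrite big_mkcond; apply: ler_sum => i _; case: ifP => _; rewrite ?sqr_ge0 //.
  by rewrite ler_sqr ?nnegrE // ler_nat ltnW.
rewrite sumr_const card_ord -natrX -mulrnA -natrX ler_nat.
apply: leq_trans (_ : (d * N) ^ 2 <= _)%N; last by rewrite leq_sqr.
rewrite expnMn mulnC leq_mul // -mulnn leq_pmulr //; exact: leq_ltn_trans (ltn_ord j0).
Qed.

Lemma enorm_sphere_lift (l N : nat) (k : {ffun 'I_d -> 'I_N}) : (d * N <= l)%N ->
  enorm (sphere_lift l k) = l%:R.
Proof.
move=> dN; have h := sum_sqr_le k dN.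
rewrite /enorm /dot (bigD1 j0) //= [sphere_lift l k j0 ord0]mxE eqxx -expr2 sqr_sqrtr ?subr_ge0 //.
rewrite [X in _ + X](eq_bigr (fun i => (k i)%:R ^+ 2)) => [|i ij].
  by rewrite subrK sqrtr_sqr normr_nat.
by rewrite [sphere_lift l k i ord0]mxE (negbTE ij) -expr2.
Qed.

(** If s^2 = l^2 - S then s <= l, so (s + 1)^2 <= (l + 1)^2 - S: heights over a fixed base point
    grow by at least 1 with the radius. *)
Lemma sphere_lift_gap (l l' N : nat) (k : {ffun 'I_d -> 'I_N}) : (d * N <= l)%N ->
  (l < l')%N -> sphere_lift l k j0 ord0 + 1 <= sphere_lift l' k j0 ord0.
Proof.
move=> dN ll; have h := sum_sqr_le k dN; rewrite !mxE eqxx.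
set S := \sum_(i | _) _ in h *.
have S0 : 0 <= S by apply: sumr_ge0 => i _; rewrite sqr_ge0.
set s := Num.sqrt _.
have s0 : 0 <= s by exact: sqrtr_ge0.
have s2 : s ^+ 2 = l%:R ^+ 2 - S by rewrite sqr_sqrtr // subr_ge0.
have sl : s <= l%:R.
  by rewrite -ler_sqr ?nnegrE // s2 gerBl.
have ll' : l%:R + 1 <= l'%:R :> R by rewrite natr1 ler_nat.
have l0 : 0 <= l%:R :> R by [].
have -> : s + 1 = Num.sqrt ((s + 1) ^+ 2) by rewrite sqrtr_sqr ger0_norm // addr_ge0.
rewrite ler_sqrt; last by have := sqr_ge0 (l%:R : R); nra.
have : (l%:R + 1) ^+ 2 <= l'%:R ^+ 2 :> R by rewrite ler_sqr ?nnegrE ?addr_ge0.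
by rewrite !sqrrD !mulr1 expr1n s2; lra.
Qed.

(** Rounding the height down moves a point by at most 1, which the Lipschitz bound pays for. By the
    gap between heights, distinct radii over the same base point round to distinct lattice points of
    the cube; the factor [N] counts the values of [k j0]. *)
Lemma sum_sphere_lift_le (F : 'cV[R]_d -> R) (N T : nat) (lam D : R) :
  (forall z, 0 <= F z) -> 0 <= lam -> 0 <= D ->
  (forall z z', F z <= F z' + D * enorm (z - z')) ->
  \sum_(l < T | (d * N <= l)%N) \sum_(k : {ffun 'I_d -> 'I_N}) F (lam *: sphere_lift l k) <=
  N%:R * \sum_(k : {ffun 'I_d -> 'I_T}) F (lam *: \col_j (k j)%:R) + T%:R * N%:R ^+ d * (D * lam).
Proof.
move=> F0 lam0 D0 FD.
pose kt (l : 'I_T) (k : {ffun 'I_d -> 'I_N}) : {ffun 'I_d -> 'I_T} :=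
  [ffun j => insubd l (if j == j0 then Num.truncn (sphere_lift l k j0 ord0) else k j)].
have d0 : (0 < d)%N by exact: leq_ltn_trans (ltn_ord j0).
have NT (l : 'I_T) : (d * N <= l)%N -> (N <= T)%N.
  move=> dN; apply: leq_trans (ltnW (ltn_ord l)); apply: leq_trans dN; by rewrite leq_pmull.
have s_ge0 l (k : {ffun 'I_d -> 'I_N}) : 0 <= sphere_lift l k j0 ord0 by rewrite mxE eqxx sqrtr_ge0.
have trT (l : 'I_T) (k : {ffun 'I_d -> 'I_N}) : (d * N <= l)%N -> (Num.truncn (sphere_lift l k j0 ord0) < T)%N.
  move=> dN; apply: leq_ltn_trans (ltn_ord l); rewrite -(ler_nat R).
  apply: (@le_trans _ _ (sphere_lift l k j0 ord0)); first by rewrite truncn_le.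
  rewrite -(enorm_sphere_lift k dN).
  by apply: le_trans (coord_le_enorm _ j0); exact: ler_norm.
have ktE (l : 'I_T) k j : (d * N <= l)%N ->
    kt l k j = (if j == j0 then Num.truncn (sphere_lift l k j0 ord0) else k j) :> nat.
  move=> dN; rewrite ffunE val_insubd; case: eqVneq => _; first by rewrite trT.
  by rewrite (leq_trans (ltn_ord _) (NT _ dN)).
have near (l : 'I_T) k : (d * N <= l)%N ->
    F (lam *: sphere_lift l k) <= F (lam *: \col_j (kt l k j)%:R) + D * lam.
  move=> dN; apply: le_trans (FD _ (lam *: \col_j (kt l k j)%:R)) _; rewrite lerD2l ler_wpM2l //.
  rewrite -scalerBr enormZ (ger0_norm lam0) ler_piMr //.
  set s := sphere_lift l k j0 ord0.
  have -> : sphere_lift l k - \col_j (kt l k j)%:R = (s - (Num.truncn s)%:R) *: basis_vec j0.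
    apply/matrixP => j i; rewrite ord1 [LHS]mxE [X in _ + X]mxE [X in - X]mxE ktE // !mxE eqxx andbT.
    by rewrite /s !mxE eqxx; case: (j == j0); rewrite ?mulr1 ?mulr0 ?subrr.
  rewrite enormZ enorm_basis_vec mulr1 ger0_norm ?subr_ge0 ?truncn_le ?s_ge0 //.
  by rewrite lerBlDl natr1 ltW // truncnS_gt.
apply: (@le_trans _ _ (\sum_(l < T | (d * N <= l)%N) \sum_(k : {ffun 'I_d -> 'I_N})
    (F (lam *: \col_j (kt l k j)%:R) + D * lam))).
  by apply: ler_sum => l dN; apply: ler_sum => k _; exact: near.
under eq_bigr do rewrite big_split /=.
rewrite big_split /=; apply: lerD; last first.
  apply: (@le_trans _ _ (\sum_(l < T) \sum_(k : {ffun 'I_d -> 'I_N}) D * lam)).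
    rewrite [leLHS]big_mkcond; apply: ler_sum => l _; case: ifP => // _.
    by apply: sumr_ge0 => k _; rewrite mulr_ge0.
  by rewrite !sumr_const card_ffun !card_ord -mulrnA -[leLHS]mulr_natl mulnC natrM natrX.
pose P (p : 'I_T * {ffun 'I_d -> 'I_N}) := (d * N <= p.1)%N.
pose h (p : 'I_T * {ffun 'I_d -> 'I_N}) := (p.2 j0, kt p.1 p.2).
have -> : \sum_(l < T | (d * N <= l)%N) \sum_(k : {ffun 'I_d -> 'I_N}) F (lam *: \col_j (kt l k j)%:R) =
    \sum_(p | P p) F (lam *: \col_j ((h p).2 j)%:R).
  rewrite pair_big /=; apply: eq_bigl => p; by rewrite andbT.
have -> : N%:R * \sum_(k : {ffun 'I_d -> 'I_T}) F (lam *: \col_j (k j)%:R) =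
    \sum_(q : 'I_N * {ffun 'I_d -> 'I_T}) F (lam *: \col_j (q.2 j)%:R).
  rewrite -(pair_bigA _ (fun (a : 'I_N) (k : {ffun 'I_d -> 'I_T}) => F (lam *: \col_j (k j)%:R))) /=.
  by rewrite sumr_const card_ord mulr_natl.
apply: (@sum_injective_le _ _ _ P h (fun q => F (lam *: \col_j (q.2 j)%:R))) => //.
move=> [l k] [l' k']; rewrite !unfold_in /P /h /= => dN dN' [e0 /ffunP e].
have ek : k = k'.
  apply/ffunP => j; have [->//|jj] := eqVneq j j0; apply: val_inj => /=.
  by have := congr1 val (e j); rewrite /= !ktE // (negbTE jj).
rewrite {}ek in e *; congr pair; apply: val_inj => /=.
have := congr1 val (e j0); rewrite /= !ktE // eqxx => et.
have gap (a b : 'I_T) : (d * N <= a)%N -> (a < b)%N ->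
    Num.truncn (sphere_lift a k' j0 ord0) = Num.truncn (sphere_lift b k' j0 ord0) -> False.
  move=> dNa ab eab; have g := sphere_lift_gap k' dNa ab.
  have h1 : (Num.truncn (sphere_lift a k' j0 ord0))%:R <= sphere_lift a k' j0 ord0 by rewrite truncn_le.
  have h2 := truncnS_gt (sphere_lift b k' j0 ord0).
  by rewrite -eab -natr1 in h2; clear -g h1 h2; lra.
by case: (ltngtP l l') => // lt; exfalso; [exact: gap dN lt et|exact: gap dN' lt (esym et)].
Qed.


Variable mu : probability mxT R.
Hypothesis haar_mu : is_haar_SO mu.
Hypothesis d2 : (2 <= d)%N.

Lemma rot_mean_energy_radial (I : finType) (c : I -> R) (u : I -> 'cV[R]_d) x y :
  enorm x = enorm y ->
  rot_mean mu (fun rho => trig_energy c u (rho *m x)) =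
  rot_mean mu (fun rho => trig_energy c u (rho *m y)).
Proof.
apply: (rot_mean_radial haar_mu d2) => z.
- exact: trig_energy_ge0.
- by apply: measurable_trig_energy => i; exact: measurable_mulmx_coord.
- by apply: measurable_trig_energy => i; exact: measurable_trmx_coord.
- by apply: measurable_trig_energy => i; exact: measurable_trmx_mulmx_coord.
Qed.

Lemma measurable_rot_energy (I : finType) (c : I -> R) (u : I -> 'cV[R]_d) z :
  measurable_fun setT (fun rho : mxT => trig_energy c u ((rho : 'M[R]_d) *m z)).
Proof. by apply: measurable_trig_energy => i; exact: measurable_mulmx_coord. Qed.

(** By radial symmetry the frequency with radius [l] may be replaced by any of its N^d lifts, scaled
    by h |xi|. For each single rotation the sum over all lifts is at most a lattice sum, bounded by
    [pair_energy_le]; division by N^d concludes. The radii below d N are left out so that every lift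
    exists. *)
Lemma rot_mean_energy_sum_le (I : finType) (c : I -> R) (u : I -> 'cV[R]_d)
    (Cu r Q h : R) (N T : nat) (xi : 'cV[R]_d) :
  (forall i, 0 <= c i) -> (forall i, enorm (u i) <= Cu) -> 0 < h ->
  h * enorm xi * (2 * Cu) <= 1 -> d%:R <= r * ((2 * T)%:R * (h * enorm xi)) ->
  0 < h * enorm xi ->
  (forall P : pred I, (forall i j, P i -> P j -> enorm (u i - u j) <= r) -> \sum_(i | P i) c i <= Q) ->
  (0 < N)%N -> (0 < T)%N ->
  (rot_mean mu (fun rho => (\sum_(l < T | (d * N <= l)%N) trig_energy c u (rho *m (l%:R * h *: xi)))%R) <=
   ((N%:R * (408 ^+ d * T%:R ^+ d * Q * \sum_i c i) +
     T%:R * N%:R ^+ d * ((\sum_i c i) ^+ 2 * (2 * Cu) * (h * enorm xi))) / N%:R ^+ d)%:E)%E.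
Proof.
move=> c0 uC h0 small hr lam0 cQ N0 T0.
set lam := h * enorm xi in small hr lam0 *; set D := (\sum_i c i) ^+ 2 * (2 * Cu).
set Bd := _ + _; have Nd : (0 : R) < N%:R ^+ d by rewrite exprn_gt0 // ltr0n.
have uD i j : enorm (u i - u j) <= 2 * Cu.
  by apply: le_trans (ler_enormB _ _) _; have := uC i; have := uC j; lra.
have Cu0 (i : I) : 0 <= Cu by exact: le_trans (enorm_ge0 _) (uC i).
have D0 : 0 <= D.
  rewrite /D; have [i _|noI] := pickP I; last by rewrite big_pred0 // expr0n mul0r.
  by rewrite mulr_ge0 ?sqr_ge0 // mulr_ge0 // (Cu0 i).
pose S (rho : 'M[R]_d) := \sum_(l < T | (d * N <= l)%N) \sum_(k : {ffun 'I_d -> 'I_N})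
  trig_energy c u (rho *m (lam *: sphere_lift l k)).
have SB rho : SO rho -> S rho <= Bd.
  move=> srho; pose F := trig_energy c (fun i => rho^T *m u i).
  have ub i j : enorm (rho^T *m u i - rho^T *m u j) = enorm (u i - u j).
    by rewrite -mulmxBr SO_enorm //; exact: SO_tr.
  have F0 z : 0 <= F z by exact: trig_energy_ge0.
  have -> : S rho = \sum_(l < T | (d * N <= l)%N) \sum_(k : {ffun 'I_d -> 'I_N}) F (lam *: sphere_lift l k).
    by apply: eq_bigr => l _; apply: eq_bigr => k _; rewrite trig_energy_rot.
  apply: le_trans (@sum_sphere_lift_le F N T lam D F0 (ltW lam0) D0 _) _.
    by move=> z z'; apply: trig_energy_lipschitz => // i j; rewrite ub.
  rewrite lerD2r ler_wpM2l //.
  have Td : (0 : R) < T%:R ^+ d by rewrite exprn_gt0 // ltr0n.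
  rewrite -(ler_pM2l Td).
  apply: le_trans (@sum_lattice_le _ _ T (fun z => F (lam *: z)) _) _; first by move=> z.
  have small' i j l : `|lam * (rho^T *m u i - rho^T *m u j) l ord0| <= 1.
    rewrite normrM (gtr0_norm lam0); apply: le_trans small; rewrite ler_wpM2l ?(ltW lam0) //.
    by apply: le_trans (coord_le_enorm _ l) _; rewrite ub.
  apply: le_trans (@pair_energy_le _ _ _ c _ lam Q (2 * T) c0 small' _) _.
    move=> P HP; apply: cQ => i j Pi Pj; rewrite -ub.
    have lT : 0 < (2 * T)%:R * lam by rewrite mulr_gt0 // ltr0n muln_gt0.
    apply: (@le_trans _ _ (d%:R * ((2 * T)%:R * lam)^-1)); last by rewrite ler_pdivrMr.
    apply: enorm_le_coord => [|l]; first by rewrite invr_ge0 ltW.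
    rewrite -[leRHS]mul1r ler_pdivlMr // mulrC -mulrA.
    have := HP i j Pi Pj l; by rewrite normrM (gtr0_norm lam0).
  have e1 : 408 ^+ d = 102 ^+ d * (2 ^+ 2) ^+ d :> R by rewrite -exprMn; congr (_ ^+ d); ring.
  have e2 : T%:R ^+ (2 * d) = T%:R ^+ d * T%:R ^+ d :> R by rewrite mul2n -addnn exprD.
  rewrite natrM exprMn e2 e1 exprM.
  by rewrite le_eqVlt; apply/orP; left; apply/eqP; ring.
have m1 l : measurable_fun setT (fun rho : mxT => trig_energy c u ((rho : 'M[R]_d) *m (l%:R * h *: xi))).
  exact: measurable_rot_energy.
have m2 l (k : {ffun 'I_d -> 'I_N}) : measurable_fun setT
   (fun rho : mxT => trig_energy c u ((rho : 'M[R]_d) *m (lam *: sphere_lift l k))).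
  exact: measurable_rot_energy.
have rS : (rot_mean mu S <= Bd%:E)%E.
  rewrite -(rot_mean_cst haar_mu Bd); apply: rot_mean_le => //.
    by apply: measurable_sum_cond => l; apply: measurable_sum => k.
  by move=> rho; apply: sumr_ge0 => l _; apply: sumr_ge0 => k _; exact: trig_energy_ge0.
have ES : rot_mean mu S = ((N%:R ^+ d)%:E *
   rot_mean mu (fun rho => (\sum_(l < T | (d * N <= l)%N) trig_energy c u (rho *m (l%:R * h *: xi)))%R))%E.
  rewrite [in RHS]rot_mean_sum //; last by move=> l rho; exact: trig_energy_ge0.
  rewrite ge0_sume_distrr; last by move=> l _; apply: rot_mean_ge0 => rho; exact: trig_energy_ge0.
  rewrite rot_mean_sum.
  - apply: eq_bigr => l dN; rewrite rot_mean_sum //; last by move=> k rho; exact: trig_energy_ge0.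
    rewrite (eq_bigr (fun=> rot_mean mu (fun rho => trig_energy c u (rho *m (l%:R * h *: xi))))).
      rewrite -(rot_mean_sum mu _ _ (fun=> m1 l)) => [|_ rho]; last exact: trig_energy_ge0.
      rewrite -rot_meanZ ?exprn_ge0 // => [|rho]; last exact: trig_energy_ge0.
      congr rot_mean; apply/funext => rho.
      by rewrite sumr_const card_ffun !card_ord -[LHS]mulr_natl natrX.
    move=> k _; apply: rot_mean_energy_radial.
    rewrite !enormZ enorm_sphere_lift // (normrM l%:R h) normr_nat (gtr0_norm lam0) (gtr0_norm h0) /lam; ring.
  - by move=> l; apply: measurable_sum => k.
  - by move=> l rho; apply: sumr_ge0 => k _; exact: trig_energy_ge0.
rewrite ES in rS.
by rewrite EFinM lee_pdivlMr // muleC.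
Qed.

End EnergyMeans.

(** * Energies and dyadic weights *)

Section DyadicEnergy.
Context {R : realType} {d : nat}.

Definition dyadic_near (j M : nat) (g : {ffun 'I_d -> 'I_M * 'I_M}) : bool :=
  [forall l, ((g l).1 - (g l).2 < 2 ^ j)%N && ((g l).2 - (g l).1 < 2 ^ j)%N].

Definition dyadic_ratio : R := 2 `^ (- (d.-1%:R / 2)).

(* Comparable to [enorm (frequency g) `^ (- (d - 1) / 2)] for frequencies of size
   between [1] and [2 ^ n]. *)
Definition dyadic_weight (n M : nat) (g : {ffun 'I_d -> 'I_M * 'I_M}) : R :=
  \sum_(j < n.+1) dyadic_ratio ^+ j * (dyadic_near j g)%:R.

Lemma dyadic_ratio_gt0 : 0 < dyadic_ratio.
Proof. exact: powR_gt0. Qed.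

Lemma dyadic_ratio_sqr : dyadic_ratio ^+ 2 = 2^-1 ^+ d.-1.
Proof.
rewrite -powR_mulrn ?(ltW dyadic_ratio_gt0) // /dyadic_ratio -powRrM mulNr divfK //.
by rewrite powRN powR_mulrn // exprVn.
Qed.

Lemma frostman_pair_energy (C s : R) (n N j : nat) (x : 'I_N -> 'cV[R]_d) w :
  frostman_weights C s n x w -> (forall i, unit_cube (x i)) -> (j <= n)%N -> (0 < d)%N ->
  \sum_(g : {ffun 'I_d -> 'I_(2 * 2 ^ j) * 'I_(2 * 2 ^ j)}) trig_energy w x (frequency g) <=
  102 ^+ d * (2 * 2 ^ j)%:R ^+ (2 * d) * (C * (d%:R * 2^-1 ^+ j) `^ s).
Proof.
move=> [w0 w1 HP] xc jn d0.
have := @pair_energy_le R d _ w x 1 (C * (d%:R * 2^-1 ^+ j) `^ s) (2 * 2 ^ j) w0 _ _.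
rewrite w1 mulr1; under eq_bigr do rewrite scale1r.
apply.
  by move=> i k l; rewrite mul1r; exact: unit_cube_dist.
have j0 : 0 < (2^-1 : R) ^+ j by rewrite exprn_gt0 // invr_gt0.
move=> P hP; apply: HP.
  apply: (@le_trans _ _ (1 * 2^-1 ^+ j)); last by rewrite ler_wpM2r ?(ltW j0) // ler1n.
  by rewrite mul1r ler_wiXn2l // ?invr_ge0 ?invf_le1 ?ler1n.
move=> i k Pi Pk; apply: enorm_le_coord => [|l]; first exact: ltW.
have := hP i k Pi Pk l; rewrite mul1r => h.
rewrite exprVn -[leRHS]mul1r ler_pdivlMr ?exprn_gt0 // mulrC; apply: le_trans h.
by rewrite ler_wpM2r // -natrX ler_nat leq_pmull.
Qed.

(** At scale 2^-j the number of frequencies contributes 2^(jd), the Frostman bound 2^(-js) and the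
    weight 2^(-j(d-1)/2): a geometric series that converges exactly when s > (d+1)/2. *)
Lemma dyadic_energy_le (C s : R) : (0 < d)%N -> 0 < C -> (d%:R + 1) / 2 < s ->
  exists2 C' : R, 0 < C' & forall n N (x : 'I_N -> 'cV[R]_d) w,
    frostman_weights C s n x w -> (forall i, unit_cube (x i)) ->
    \sum_(g : {ffun 'I_d -> 'I_(2 ^ n) * 'I_(2 ^ n)}) trig_energy w x (frequency g) * dyadic_weight n g <=
    C' * (2 ^ n)%:R ^+ d.
Proof.
move=> d0 C0 ds.
pose q : R := dyadic_ratio * 2 ^+ d * 2^-1 `^ s.
have q01 : 0 <= q < 1.
  apply/andP; split; first by rewrite !mulr_ge0 ?powR_ge0 ?exprn_ge0.
  rewrite /q -powR_mulrn // /dyadic_ratio -powRD; last by rewrite pnatr_eq0 implybT.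
  have -> : (2^-1 : R) `^ s = 2 `^ (- s) by rewrite -powR_inv1 // -powRrM mulN1r.
  rewrite -powRD; last by rewrite pnatr_eq0 implybT.
  pose t := s - (d%:R + 1) / 2; have t0 : 0 < t by rewrite subr_gt0.
  have -> : - (d.-1%:R / 2) + d%:R - s = - t.
    have e : d%:R = d.-1%:R + 1 :> R by rewrite natr1 prednK.
    by rewrite /t e; lra.
  rewrite powRN invf_lt1 ?powR_gt0 // -[ltLHS](congr1 (fun f => f t) (@powR1 R)).
  by apply: gt0_ltr_powR; rewrite ?nnegrE ?ltr1n.
have [B BE] : exists B : R, B = 408 ^+ d by exists (408 ^+ d).
have B0 : 0 < B by rewrite BE; apply: exprn_gt0; rewrite ltr0n.
pose C1 : R := B * C * d%:R `^ s.
have C10 : 0 < C1 by rewrite !mulr_gt0 // powR_gt0 // ltr0n.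
have q1 : 0 < (1 - q)^-1 by rewrite invr_gt0 subr_gt0; case/andP: q01.
exists (C1 * (1 - q)^-1); first exact: mulr_gt0.
move=> n N x w Fw xc; set M := (2 ^ n)%N.
have A0 z : 0 <= trig_energy w x z by exact: trig_energy_ge0.
have -> : \sum_(g : {ffun 'I_d -> 'I_M * 'I_M}) trig_energy w x (frequency g) * dyadic_weight n g =
   \sum_(j < n.+1) dyadic_ratio ^+ j *
     \sum_(g : {ffun 'I_d -> 'I_M * 'I_M} | dyadic_near j g) trig_energy w x (frequency g).
  under eq_bigr do rewrite mulr_sumr.
  rewrite exchange_big /=; apply: eq_bigr => j _; rewrite mulr_sumr [RHS]big_mkcond /=.
  apply: eq_bigr => g _; case: ifP => _; rewrite ?mulr1 ?mulr0 //; exact: mulrC.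
apply: (@le_trans _ _ (\sum_(j < n.+1) M%:R ^+ d * C1 * q ^+ j)); last first.
  rewrite -mulr_sumr [leRHS]mulrAC (mulrC C1); apply: ler_wpM2l.
    by rewrite mulr_ge0 ?(ltW C10) // exprn_ge0.
  exact: geometric_sum_le.
apply: ler_sum => j _.
have jn : (j <= n)%N by rewrite -ltnS.
have L0 : (0 : R) < (2 ^ j)%:R ^+ d by rewrite exprn_gt0 // ltr0n expn_gt0.
have h1 := @sum_frequency_near_le R d M (2 ^ j) (trig_energy w x) A0.
have h2 := frostman_pair_energy Fw xc jn d0.
have h3 := le_trans h1 (ler_wpM2l (exprn_ge0 d (ler0n R M)) h2).
rewrite -(ler_pM2l L0) mulrCA.
apply: le_trans (ler_wpM2l (exprn_ge0 j (ltW dyadic_ratio_gt0)) h3) _.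
have e3 : (d%:R * 2^-1 ^+ j) `^ s = d%:R `^ s * (2^-1 `^ s) ^+ j :> R.
  by rewrite powRM ?exprn_ge0 ?invr_ge0 // -[2^-1 ^+ j]powR_mulrn ?invr_ge0 // powRAC powR_mulrn ?powR_ge0.
have e1 : B = 102 ^+ d * (2 ^+ 2) ^+ d :> R by rewrite BE -exprMn; congr (_ ^+ d); ring.
have e2 : (2 * 2 ^ j)%:R ^+ (2 * d) = (2 ^+ 2) ^+ d * ((2 ^ j)%:R ^+ d * (2 ^+ d) ^+ j) :> R.
  rewrite natrM exprMn exprM; congr (_ * _).
  by rewrite mul2n -addnn exprD natrX -!exprM [(d * j)%N]mulnC.
rewrite e3 e2 /C1 e1 /q !exprMn le_eqVlt; apply/orP; left; apply/eqP.
ring.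
Qed.

(** For the least [j] with [dyadic_near j g] the weight is at least [dyadic_ratio ^+ j], while, if j
    > 0, some entry of the frequency is at least 2^(j-1). *)
Lemma dyadic_weight_lower (n : nat) (g : {ffun 'I_d -> 'I_(2 ^ n) * 'I_(2 ^ n)}) :
  [/\ 0 < dyadic_weight n g,
      frequency g = 0 :> 'cV[R]_d -> 1 <= dyadic_weight n g &
      frequency g != 0 :> 'cV[R]_d -> 1 <= enorm (frequency g : 'cV[R]_d) /\
        1 <= 2 ^+ d.-1 * enorm (frequency g : 'cV[R]_d) ^+ d.-1 * dyadic_weight n g ^+ 2].
Proof.
have b0 := dyadic_ratio_gt0.
have t0 (j : 'I_n.+1) : 0 <= dyadic_ratio ^+ j * (dyadic_near j g)%:R.
  by rewrite mulr_ge0 // exprn_ge0 // ltW.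
have one j : (j <= n)%N -> dyadic_near j g -> dyadic_ratio ^+ j <= dyadic_weight n g.
  move=> jn nj; have jn' : (j < n.+1)%N by [].
  rewrite /dyadic_weight (bigD1 (Ordinal jn')) //= nj mulr1 lerDl.
  by apply: sumr_ge0 => i _; exact: t0.
have ex : exists j, dyadic_near j g.
  exists n; apply/forallP => l; have := ltn_ord (g l).1; have := ltn_ord (g l).2.
  by move=> h1 h2; rewrite !(leq_ltn_trans (leq_subr _ _)).
case: (ex_minnP ex) => j nj jmin.
have jn : (j <= n)%N.
  apply: jmin; apply/forallP => l; have := ltn_ord (g l).1; have := ltn_ord (g l).2.
  by move=> h1 h2; rewrite !(leq_ltn_trans (leq_subr _ _)).
have Wj := one j jn nj.
have W0 : 0 < dyadic_weight n g by apply: lt_le_trans Wj; rewrite exprn_gt0.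
split => // [g0|g0].
  have n0 : dyadic_near 0 g.
    apply/forallP => l; have := congr1 (fun z : 'cV[R]_d => z l ord0) g0; rewrite !mxE.
    by move/eqP; rewrite subr_eq0 eqr_nat => /eqP ->; rewrite subnn.
  by have := one 0%N isT n0; rewrite expr0.
case: j nj jmin jn Wj => [nj|j nj jmin jn Wj].
  exfalso; move/eqP: g0; apply; apply/matrixP => l i; rewrite !mxE.
  have /andP[] := forallP nj l; rewrite !ltnS !leqn0 !subn_eq0 => h1 h2.
  by apply/eqP; rewrite subr_eq0 eqr_nat eqn_leq h1 h2.
have : ~~ dyadic_near j g by apply/negP => /jmin; rewrite ltnn.
rewrite negb_forall => /existsP[l]; rewrite negb_and -!leqNgt => hl.
have ge : 2 ^+ j <= enorm (frequency g : 'cV[R]_d).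
  apply: le_trans (coord_le_enorm _ l); rewrite mxE -natrX.
  case/orP: hl => h.
    have le : ((g l).2 <= (g l).1)%N by rewrite leqNgt; apply/negP => /ltnW; rewrite -subn_eq0 => /eqP e; move: h; rewrite e leqn0 expn_eq0.
    by rewrite -natrB // normr_nat ler_nat.
  have le : ((g l).1 <= (g l).2)%N by rewrite leqNgt; apply/negP => /ltnW; rewrite -subn_eq0 => /eqP e; move: h; rewrite e leqn0 expn_eq0.
  by rewrite distrC -natrB // normr_nat ler_nat.
split; first by apply: le_trans ge; rewrite exprn_ege1 // ler1n.
have W2 : (2^-1 ^+ d.-1) ^+ j.+1 <= dyadic_weight n g ^+ 2.
  rewrite -dyadic_ratio_sqr exprAC ler_sqr ?nnegrE ?(ltW W0) //.
  by rewrite exprn_ge0 // ltW.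
have E : (2 ^+ d.-1 * (2 ^+ j) ^+ d.-1) * (2^-1 ^+ d.-1) ^+ j.+1 = 1 :> R.
  by rewrite -exprMn -exprS exprAC -exprMn -exprMn mulfV // !expr1n.
have p0 : 0 <= (2 : R) ^+ d.-1 by rewrite exprn_ge0.
rewrite -[leLHS]E; apply: ler_pM; last exact: W2.
- by rewrite mulr_ge0 // !exprn_ge0.
- by rewrite !exprn_ge0 // invr_ge0.
- by rewrite ler_wpM2l //; apply: lerXn2r; rewrite ?nnegrE ?exprn_ge0 ?enorm_ge0.
Qed.


Lemma sum_sin_differences (I : finType) (w : I -> R) (x : I -> 'cV[R]_d) z :
  \sum_i \sum_j w i * w j * sin (dot z (x i - x j)) = 0.
Proof.
set S := LHS; suff : S = - S by lra.
rewrite {1}/S exchange_big /= -sumrN; apply: eq_bigr => i _; rewrite -sumrN; apply: eq_bigr => j _.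
by rewrite -opprB dotNr sinN mulrN (mulrC (w j)).
Qed.

(** The product of kernels is expanded in frequencies. The sines of the differences x i - x j cancel
    by antisymmetry, which leaves the energy of the weights against a cosine sum over [Y]. *)
Lemma pair_kernel_sum (I J : finType) (w : I -> R) (x : I -> 'cV[R]_d) (c : J -> R)
    (Y : J -> 'cV[R]_d) (M : nat) :
  \sum_i \sum_j w i * w j * \sum_m c m * \prod_l trig_kernel M ((x i - x j - Y m) l ord0) =
  \sum_(g : {ffun 'I_d -> 'I_M * 'I_M})
    trig_energy w x (frequency g) * \sum_m c m * cos (dot (frequency g) (Y m)).
Proof.
transitivity (\sum_i \sum_j \sum_(g : {ffun 'I_d -> 'I_M * 'I_M})
    w i * w j * \sum_m c m * cos (dot (frequency g) (x i - x j) - dot (frequency g) (Y m))).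
  apply: eq_bigr => i _; apply: eq_bigr => j _; rewrite -mulr_sumr; congr (_ * _).
  rewrite exchange_big /=; apply: eq_bigr => m _; rewrite -mulr_sumr; congr (_ * _).
  by rewrite -sum_cos_frequency; apply: eq_bigr => g _; rewrite -dotBr.
under eq_bigr do rewrite exchange_big /=.
rewrite exchange_big /=; apply: eq_bigr => g _.
pose a i j := dot (frequency g) (x i - x j); pose b m := dot (frequency g) (Y m).
transitivity ((\sum_i \sum_j w i * w j * cos (a i j)) * (\sum_m c m * cos (b m)) +
    (\sum_i \sum_j w i * w j * sin (a i j)) * (\sum_m c m * sin (b m))).
  rewrite !mulr_suml -big_split /=; apply: eq_bigr => i _.
  rewrite !mulr_suml -big_split /=; apply: eq_bigr => j _.
  rewrite -!mulrA -!mulrDr; congr (_ * (_ * _)).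
  rewrite !mulr_sumr -big_split /=; apply: eq_bigr => m _.
  by rewrite cosB /a /b; ring.
by rewrite sum_sin_differences mul0r addr0 trig_energyE.
Qed.

(** The product of kernels is nonnegative, and at least (M^2 / 4)^d within 1 / M of the origin, so
    its multiple majorises the indicator of a hit. *)
Lemma pair_hits_le (I J : finType) (w : I -> R) (x : I -> 'cV[R]_d) (c : J -> R)
    (Y : J -> 'cV[R]_d) (M : nat) (P : pred (I * I)) (W : I * I -> R) :
  (0 < M)%N -> (forall i, 0 <= w i) -> (forall m, 0 <= c m) ->
  (forall e, W e <= w e.1 * w e.2) ->
  (forall e, P e -> 0 < W e -> exists2 m, c m = 1 & forall l, M%:R * `|(x e.1 - x e.2 - Y m) l ord0| <= 1) ->
  \sum_(e | P e) W e <= (4 / M%:R ^+ 2) ^+ d *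
    \sum_(g : {ffun 'I_d -> 'I_M * 'I_M})
      trig_energy w x (frequency g) * \sum_m c m * cos (dot (frequency g) (Y m)).
Proof.
move=> M0 w0 c0 Ww HP.
have MR : (0 : R) < M%:R ^+ 2 by rewrite exprn_gt0 // ltr0n.
have D0 (z : 'I_d -> R) : 0 <= \prod_l trig_kernel M (z l).
  by apply: prodr_ge0 => l _; exact: trig_kernel_ge0.
pose G (e : I * I) := \sum_m c m * \prod_l trig_kernel M ((x e.1 - x e.2 - Y m) l ord0).
have G0 e : 0 <= G e by apply: sumr_ge0 => m _; exact: mulr_ge0.
rewrite -pair_kernel_sum (pair_bigA _ (fun i j => w i * w j * G (i, j))) /= mulr_sumr.
rewrite [leLHS]big_mkcond; apply: ler_sum => -[i j] _ /=; set e := (i, j).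
have K0 : 0 <= (4 / M%:R ^+ 2) ^+ d * (w i * w j * G e).
  by rewrite mulr_ge0 ?exprn_ge0 ?divr_ge0 ?(ltW MR) // !mulr_ge0.
case: ifP => // Pe; have [W0|W0] := leP (W e) 0; first exact: le_trans K0.
have [m cm hm] := HP e Pe W0.
apply: le_trans (Ww e) _; rewrite mulrCA -[leLHS]mulr1 ler_wpM2l ?mulr_ge0 //.
have G1 : (M%:R ^+ 2 / 4) ^+ d <= G e.
  rewrite /G (bigD1 m) //= cm mul1r; apply: (@le_trans _ _ (\prod_l trig_kernel M ((x i - x j - Y m) l ord0))).
    rewrite -[X in _ ^+ X](card_ord d) -prodr_const; apply: ler_prod => l _.
    by rewrite divr_ge0 ?(ltW MR) //= trig_kernel_lower // hm.
  by rewrite lerDl; apply: sumr_ge0 => k _; exact: mulr_ge0.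
apply: le_trans (ler_wpM2l _ G1); last by rewrite exprn_ge0 // divr_ge0 // ltW.
rewrite -exprMn (_ : 4 / _ * _ = 1) ?expr1n //.
by field; rewrite pnatr_eq0 -lt0n.
Qed.

Lemma energy_cauchy_schwarz (I : finType) (A W S : I -> R) :
  (forall i, 0 <= A i) -> (forall i, 0 < W i) ->
  (\sum_i A i * S i) ^+ 2 <= (\sum_i A i * W i) * (\sum_i A i / W i * S i ^+ 2).
Proof.
move=> A0 W0.
have := sum_cauchy_schwarz xpredT (fun i => Num.sqrt (A i * W i)) (fun i => Num.sqrt (A i / W i) * S i).
have E i : Num.sqrt (A i * W i) * (Num.sqrt (A i / W i) * S i) = A i * S i.
  rewrite mulrA -sqrtrM ?mulr_ge0 ?(ltW (W0 i)) // mulrACA divff ?lt0r_neq0 // mulr1.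
  by rewrite -expr2 sqrtr_sqr ger0_norm.
under eq_bigr do rewrite E.
under [X in X * _]eq_bigr do rewrite sqr_sqrtr ?mulr_ge0 ?(ltW (W0 _)) //.
by under [X in _ * X]eq_bigr do rewrite exprMn sqr_sqrtr ?divr_ge0 ?(ltW (W0 _)) //.
Qed.

End DyadicEnergy.

(** * Convex bodies *)

Section ConvexBodyDistances.
Context {R : realType} {d : nat}.
Notation mxT := (borel_mx R d).
Local Notation SO := (@SO R d).

Lemma trig_energy_le (I : finType) (c : I -> R) (Y : I -> 'cV[R]_d) z :
  (forall i, 0 <= c i) -> trig_energy c Y z <= (\sum_i c i) ^+ 2.
Proof.
move=> c0; rewrite trig_energyE expr2 mulr_suml; apply: ler_sum => i _.
rewrite mulr_sumr; apply: ler_sum => j _.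
by rewrite -[leRHS]mulr1 ler_wpM2l ?mulr_ge0 // cos_le1.
Qed.

Variable K : set 'cV[R]_d.
Hypothesis bK : convex_body K.
Hypothesis sK : origin_symmetric K.
Variables r0 R0 : R.
Hypothesis r00 : 0 < r0.
Hypothesis rK : forall x, enorm x <= r0 -> K x.
Hypothesis R00 : 0 < R0.
Hypothesis KR : forall x, K x -> enorm x <= R0.
Hypothesis d2 : (2 <= d)%N.

Let d0 : (0 < d)%N. Proof. exact: ltnW. Qed.

Let dR : (0 : R) < d%:R. Proof. by rewrite ltr0n. Qed.

Let Cl : R := 2 * d%:R * (4 * d%:R / r0 + 1) ^+ d.-1.

Let Cn : R := Cl * (2 * R0 + 1) ^+ d.-1.

Let Ce : R := 408 ^+ d.

Let Ce0 : 0 <= Ce. Proof. by rewrite /Ce; apply: exprn_ge0; exact: ler0n. Qed.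

Let Cl0 : 0 <= Cl.
Proof.
by rewrite mulr_ge0 ?mulr_ge0 // exprn_ge0 // addr_ge0 // divr_ge0 ?mulr_ge0 // ltW.
Qed.

Let Cn0 : 0 <= Cn.
Proof. by rewrite mulr_ge0 // exprn_ge0 // addr_ge0 // mulr_ge0 // ltW. Qed.

Lemma net_local (M : nat) (r : R) (P : pred {ffun 'I_d -> 'I_(2 * M).+1}) : (0 < M)%N ->
  M%:R^-1 <= r -> (forall m m', P m -> P m' -> enorm (net_pt K m - net_pt K m') <= r) ->
  \sum_(m | P m) (net_weight m : R) <= Cl * (r * M%:R) ^+ d.-1.
Proof.
move=> M0 Mr HP; apply: le_trans (net_count bK sK M0 r00 rK Mr HP) _.
by rewrite exprMn mulrA.
Qed.

Lemma net_total (M : nat) : (0 < M)%N -> \sum_(m : {ffun 'I_d -> 'I_(2 * M).+1}) (net_weight m : R) <= Cn * M%:R ^+ d.-1 :> R.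
Proof.
move=> M0; have := @net_local M (2 * R0 + 1) xpredT M0.
rewrite exprMn mulrA; apply.
  apply: (@le_trans _ _ 1); first by rewrite invf_le1 ?ler1n // ltr0n.
  by rewrite lerDr mulr_ge0 // ltW.
move=> m m' _ _; apply: le_trans (ler_enormB _ _) _.
have := net_pt_enorm bK sK m R00 KR; have := net_pt_enorm bK sK m' R00 KR; lra.
Qed.

(** With v = z / tau on the boundary and u a net point near v, z - t u = (tau - t) v + t (v - u). *)
Lemma net_hit (M : nat) (z : 'cV[R]_d) (t delta : R) : (0 < M)%N ->
  0 < body_norm K z -> 0 <= t -> `|body_norm K z - t| <= delta ->
  exists2 m : {ffun 'I_d -> 'I_(2 * M).+1}, (net_weight m : R) = 1 &
    enorm (z - t *: net_pt K m) <= delta * R0 + t * (d%:R * (R0 + R0 ^+ 2 / r0) / M%:R).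
Proof.
move=> M0 z0 t0 zt; set tau := body_norm K z in z0 zt *.
pose v := tau^-1 *: z.
have v1 : body_norm K v = 1 by rewrite body_norm_posZ // ?invr_gt0 // mulVf ?lt0r_neq0.
have [m cm hm] := net_pt_dense bK sK M0 r00 rK R00 KR v1.
exists m => //.
have -> : z - t *: net_pt K m = (tau - t) *: v + t *: (v - net_pt K m).
  have zE : z = tau *: v by rewrite /v scalerA divff ?scale1r // lt0r_neq0.
  by rewrite {1}zE scalerBr scalerBl addrA subrK.
apply: le_trans (ler_enormD _ _) _; rewrite enormZ (enormZ t) (ger0_norm t0); apply: lerD.
  apply: ler_pM => //; first exact: enorm_ge0.
  by rewrite -[leRHS]mulr1 -v1; exact: enorm_le_body_norm.
exact: ler_wpM2l.
Qed.

Variable mu : probability mxT R.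
Hypothesis haar_mu : is_haar_SO mu.

Definition net_energy (M : nat) (z : 'cV[R]_d) : R :=
  trig_energy (fun m : {ffun 'I_d -> 'I_(2 * M).+1} => (net_weight m : R)) (@net_pt R d K M) z.

(** The first term comes from counting close net points in the lattice sum, the second from rounding
    the lifts to lattice points. *)
Definition net_mean_cst (tau : R) : R :=
  Ce * tau ^+ d.-1 * Cl * d%:R ^+ d.-1 * Cn + Cn ^+ 2 * (2 * R0).

Lemma net_mean_cst_ge0 tau : 0 <= tau -> 0 <= net_mean_cst tau.
Proof.
move=> t0; rewrite addr_ge0 //; last by rewrite mulr_ge0 ?sqr_ge0 // mulr_ge0 // ltW.
apply: mulr_ge0 => //; apply: mulr_ge0; last exact: exprn_ge0 (ltW dR).
apply: mulr_ge0 (Cl0); apply: (mulr_ge0 Ce0); exact: exprn_ge0.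
Qed.

(** A frequency of length e resolves the net at scale d / e, where a cluster has mass of order (M /
    e)^(d-1) out of a total of order M^(d-1); this is the decay e^(-(d-1)). The condition h e^d <= 1
    makes the rounding error as small. *)
Lemma rot_mean_net_energy_le (M N T : nat) (h tau : R) (xi : 'cV[R]_d) :
  (0 < M)%N -> (0 < N)%N -> (0 < T)%N -> 0 < h -> 1 <= enorm xi -> enorm xi <= d%:R * M%:R ->
  1 <= T%:R * h -> T%:R <= tau * N%:R -> h * enorm xi ^+ d <= 1 -> h * enorm xi * (2 * R0) <= 1 ->
  (rot_mean mu (fun rho => (\sum_(l < T | (d * N <= l)%N) net_energy M (rho *m (l%:R * h *: xi)))%R) <=
   (T%:R * (M%:R ^+ d.-1) ^+ 2 * net_mean_cst tau / enorm xi ^+ d.-1)%:E)%E.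
Proof.
move=> M0 N0 T0 h0 x1 xM Th TN hx small.
have NR : (0 : R) < N%:R by rewrite ltr0n.
have MR : (0 : R) < M%:R by rewrite ltr0n.
have x0 : 0 < enorm xi by exact: lt_le_trans x1.
set e := enorm xi in x0 x1 xM hx small *.
set S : R := \sum_(m : {ffun 'I_d -> 'I_(2 * M).+1}) (net_weight m : R).
have S0 : 0 <= S by apply: sumr_ge0 => m _; exact: net_weight_ge0.
have SC : S <= Cn * M%:R ^+ d.-1 by exact: net_total.
pose Q := Cl * (d%:R / e * M%:R) ^+ d.-1.
have := @rot_mean_energy_sum_le R d (Ordinal d0) mu haar_mu d2 _
  (fun m : {ffun 'I_d -> 'I_(2 * M).+1} => (net_weight m : R)) (@net_pt R d K M) R0 (d%:R / e) Q h N T xi.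
move=> /(_ (@net_weight_ge0 R d M) (fun m => net_pt_enorm bK sK m R00 KR) h0 small).
have hr : d%:R <= d%:R / e * ((2 * T)%:R * (h * e)).
  have -> : d%:R / e * ((2 * T)%:R * (h * e)) = d%:R * ((2 * T)%:R * h) by field; exact: lt0r_neq0.
  by rewrite -[leLHS]mulr1 ler_wpM2l ?(ltW dR) // natrM -mulrA; move: Th; lra.
have he : 0 < h * e by exact: mulr_gt0.
have HQ (P : pred {ffun 'I_d -> 'I_(2 * M).+1}) :
    (forall i j, P i -> P j -> enorm (net_pt K i - net_pt K j) <= d%:R / e) ->
    \sum_(i | P i) (net_weight i : R) <= Q.
  apply: net_local => //; rewrite ler_pdivlMr // mulrC ler_pdivrMr //.
move=> /(_ hr he HQ N0 T0) /le_trans; apply.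
rewrite -/S lee_fin.
rewrite /net_mean_cst -/Ce.
have [B [BE B0]] : exists B : R, Ce = B /\ 0 <= B by exists Ce; split.
rewrite BE {BE}.
have dE : d = d.-1.+1 by rewrite prednK.
have hxe : h * e <= (e ^+ d.-1)^-1.
  by rewrite -[leRHS]div1r ler_pdivlMr ?exprn_gt0 // -mulrA -exprS -dE.
have TNd : T%:R ^+ d.-1 / N%:R ^+ d.-1 <= tau ^+ d.-1.
  rewrite ler_pdivrMr ?exprn_gt0 // -exprMn; apply: lerXn2r => //; first by rewrite nnegrE.
  by rewrite nnegrE (le_trans _ TN).
have -> : (N%:R * (B * T%:R ^+ d * Q * S) + T%:R * N%:R ^+ d * (S ^+ 2 * (2 * R0) * (h * e))) / N%:R ^+ d =
    T%:R * (B * (T%:R ^+ d.-1 / N%:R ^+ d.-1) * Q * S + S ^+ 2 * (2 * R0) * (h * e)).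
  have -> : N%:R ^+ d = N%:R * N%:R ^+ d.-1 :> R by rewrite -exprS -dE.
  have -> : T%:R ^+ d = T%:R * T%:R ^+ d.-1 :> R by rewrite -exprS -dE.
  have Nd : N%:R ^+ d.-1 != 0 :> R by rewrite expf_neq0 // lt0r_neq0.
  move: (N%:R ^+ d.-1) (T%:R ^+ d.-1) Nd => n t nn.
  by field; rewrite nn lt0r_neq0.
have Q0 : 0 <= Q by rewrite mulr_ge0 // exprn_ge0 // mulr_ge0 ?divr_ge0 // ltW.
have ed0 : 0 <= (e ^+ d.-1)^-1 by rewrite invr_ge0 exprn_ge0 // ltW.
have Md0 : 0 <= (M%:R : R) ^+ d.-1 by rewrite exprn_ge0.
apply: (@le_trans _ _ (T%:R * (B * tau ^+ d.-1 * Q * (Cn * M%:R ^+ d.-1) +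
    (Cn * M%:R ^+ d.-1) ^+ 2 * (2 * R0) * (e ^+ d.-1)^-1))).
  rewrite ler_wpM2l //; apply: lerD.
    apply: ler_pM => //.
      by apply: mulr_ge0 => //; apply: mulr_ge0 => //; rewrite divr_ge0 ?exprn_ge0.
    by rewrite ler_wpM2r // ler_wpM2l.
  apply: ler_pM => //; [|exact: ltW|].
    by rewrite mulr_ge0 ?sqr_ge0 // mulr_ge0 // ltW.
  rewrite ler_wpM2r ?mulr_ge0 ?(ltW R00) // ler_sqr ?nnegrE //.
  exact: mulr_ge0.
rewrite /Q !exprMn exprVn le_eqVlt; apply/orP; left; apply/eqP.
by move: (e ^+ d.-1)^-1 (M%:R ^+ d.-1) (d%:R ^+ d.-1) (tau ^+ d.-1) => *; ring.
Qed.


(** For nonzero frequencies the power of the length is exchanged for the squared dyadic weight; at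
    frequency 0 the weight is at least 1 and the trivial bound by the squared total mass
    suffices. *)
Lemma rot_mean_net_dyadic_le (n M N T : nat) (h tau : R) (g : {ffun 'I_d -> 'I_(2 ^ n) * 'I_(2 ^ n)}) :
  (2 ^ n <= M)%N -> (0 < N)%N -> (0 < T)%N -> 0 < h -> 0 <= tau ->
  1 <= T%:R * h -> T%:R <= tau * N%:R -> h * (d%:R * M%:R) ^+ d <= 1 ->
  h * (d%:R * M%:R) * (2 * R0) <= 1 ->
  (rot_mean mu (fun rho => (\sum_(l < T | (d * N <= l)%N)
     net_energy M (rho *m (l%:R * h *: frequency g)))%R) <=
   (T%:R * (M%:R ^+ d.-1) ^+ 2 * (net_mean_cst tau * 2 ^+ d.-1 + Cn ^+ 2) * dyadic_weight n g ^+ 2)%:E)%E.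
Proof.
move=> nM N0 T0 h0 tau0 Th TN hM small.
have M0 : (0 < M)%N by apply: leq_trans nM; rewrite expn_gt0.
have [W0 Wz Wn] := @dyadic_weight_lower R d n g.
have cst0 := net_mean_cst_ge0 tau0.
have TM0 : 0 <= T%:R * (M%:R ^+ d.-1) ^+ 2 :> R by rewrite mulr_ge0 ?sqr_ge0.
have p0 : 0 <= (2 : R) ^+ d.-1 by rewrite exprn_ge0.
have [f0|f0] := eqVneq (frequency g) (0 : 'cV[R]_d).
  have W1 := Wz f0.
  apply: (@le_trans _ _ (T%:R * (Cn * M%:R ^+ d.-1) ^+ 2)%:E).
    rewrite -(rot_mean_cst haar_mu (_ * _)); apply: rot_mean_le => //.
    - by apply: measurable_sum_cond => l; exact: measurable_rot_energy.
    - by move=> rho; apply: sumr_ge0 => l _; exact: trig_energy_ge0.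
    - move=> rho _; apply: (@le_trans _ _ (\sum_(l < T) (Cn * M%:R ^+ d.-1) ^+ 2)); last first.
        by rewrite sumr_const card_ord -[leLHS]mulr_natl.
      rewrite big_mkcond; apply: ler_sum => l _; case: ifP => _; last exact: sqr_ge0.
      apply: le_trans (trig_energy_le _ _ _) _; first by move=> m; exact: net_weight_ge0.
      have nt := net_total M0.
      rewrite ler_sqr ?nnegrE //; last by rewrite mulr_ge0 ?exprn_ge0.
      by apply: sumr_ge0 => m _; exact: net_weight_ge0.
  rewrite lee_fin exprMn (mulrC (Cn ^+ 2)) mulrA -[X in _ <= X]mulrA ler_wpM2l //.
  rewrite -[leLHS]mulr1; apply: ler_pM; rewrite ?sqr_ge0 //.
    by rewrite lerDr mulr_ge0.
  by rewrite exprn_ege1.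
have [x1 xW] := Wn f0.
have xM : enorm (frequency g : 'cV[R]_d) <= d%:R * M%:R.
  apply: enorm_le_coord => // l; rewrite mxE.
  apply: le_trans (_ : (2 ^ n)%:R <= _); last by rewrite ler_nat.
  have a1 : 0 <= (g l).1%:R :> R by []; have a2 : 0 <= (g l).2%:R :> R by [].
  have b1 : (g l).1%:R <= (2 ^ n)%:R :> R by rewrite ler_nat ltnW.
  have b2 : (g l).2%:R <= (2 ^ n)%:R :> R by rewrite ler_nat ltnW.
  by rewrite ler_norml; apply/andP; split; lra.
have x0 : 0 < enorm (frequency g : 'cV[R]_d) by exact: lt_le_trans x1.
apply: le_trans (rot_mean_net_energy_le M0 N0 T0 h0 x1 xM Th TN _ _) _.
- apply: le_trans hM; rewrite ler_wpM2l ?(ltW h0) //; apply: lerXn2r => //.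
    by rewrite nnegrE ltW.
  by rewrite nnegrE mulr_ge0.
- apply: le_trans small; rewrite ler_wpM2r ?mulr_ge0 ?(ltW R00) //.
  by rewrite ler_wpM2l ?(ltW h0).
set e := enorm _ in x0 xW *; set W := dyadic_weight n g in xW W0 *.
have ed : 0 < e ^+ d.-1 by rewrite exprn_gt0.
rewrite lee_fin -[leLHS]mulrA -[leRHS]mulrA ler_wpM2l //.
apply: (@le_trans _ _ (net_mean_cst tau * (2 ^+ d.-1 * W ^+ 2))).
  rewrite ler_wpM2l // -[leLHS]div1r ler_pdivrMr //.
  by rewrite mulrAC.
by rewrite mulrA ler_wpM2r ?sqr_ge0 // lerDl sqr_ge0.
Qed.

Lemma exists_net_mean_bound (tau : R) : 0 <= tau -> exists2 c : R, 0 <= c &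
  forall (n M N T : nat) (h : R) (g : {ffun 'I_d -> 'I_(2 ^ n) * 'I_(2 ^ n)}),
  (2 ^ n <= M)%N -> (0 < N)%N -> (0 < T)%N -> 0 < h ->
  1 <= T%:R * h -> T%:R <= tau * N%:R -> h * (d%:R * M%:R) ^+ d <= 1 ->
  h * (d%:R * M%:R) * (2 * R0) <= 1 ->
  (rot_mean mu (fun rho => (\sum_(l < T | (d * N <= l)%N)
     net_energy M (rho *m (l%:R * h *: frequency g)))%R) <=
   (T%:R * (M%:R ^+ d.-1) ^+ 2 * c * dyadic_weight n g ^+ 2)%:E)%E.
Proof.
move=> tau0; exists (net_mean_cst tau * 2 ^+ d.-1 + Cn ^+ 2).
  by rewrite addr_ge0 ?sqr_ge0 // mulr_ge0 ?net_mean_cst_ge0 // exprn_ge0.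
by move=> *; exact: rot_mean_net_dyadic_le.
Qed.

End ConvexBodyDistances.

(** * Choice of scales and the case of a general convex body *)

Section FinalAssembly.
Context {R : realType} {d : nat}.
Notation mxT := (borel_mx R d).
Local Notation SO := (@SO R d).

(** Each ball of radius [r] about a point has mass at most 1/2, so at least half of the mass is
    farther away. *)
Lemma separated_pairs_mass (C s r : R) n N (x : 'I_N -> 'cV[R]_d) w :
  frostman_weights C s n x w -> 2^-1 ^+ n <= r -> C * (2 * r) `^ s <= 2^-1 ->
  2^-1 <= \sum_(e : 'I_N * 'I_N) w e.1 * w e.2 * (r < enorm (x e.1 - x e.2))%R%:R.
Proof.
move=> Fw nr Cr; have [w0 w1 _] := Fw.
rewrite -(pair_bigA _ (fun i j => w i * w j * (r < enorm (x i - x j))%R%:R)) /=.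
apply: (@le_trans _ _ (\sum_i w i * 2^-1)); first by rewrite -mulr_suml w1 mul1r.
apply: ler_sum => i _; under eq_bigr do rewrite -mulrA.
rewrite -mulr_sumr ler_wpM2l //.
have near := le_trans (frostman_ball Fw (x i) nr) Cr.
have : \sum_j w j * (r < enorm (x i - x j))%R%:R + \sum_(j | enorm (x i - x j) <= r) w j = 1.
  rewrite -[RHS]w1 [X in _ + X]big_mkcond -big_split /=; apply: eq_bigr => j _.
  by rewrite ltNge; case: (_ <= _); rewrite ?mulr0 ?mulr1 ?add0r ?addr0.
by move: near; lra.
Qed.

(** The step h divides delta and is as fine as [X] requires. The grid of [T] points reaches beyond b
    + delta, the omitted radii below d N h are at most a / 2, and [N] remains comparable to [T], as
    the mean over dilations needs. *)
Lemma grid_parameters (a b delta X : R) : (0 < d)%N -> 0 < a -> 1 <= b -> 0 < delta <= 1 ->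
  4 * d%:R / a + 1 <= X -> exists (h : R) (J T N : nat),
  [/\ [/\ 0 < h, (0 < J)%N, J%:R * h = delta & h * X <= 1],
      [/\ b < (T%:R - J%:R) * h, T%:R * h <= b + 2 & 1 <= T%:R * h] &
      [/\ (0 < N)%N, 2 * d%:R * N%:R * h <= a & T%:R <= 4 * d%:R * (b + 2) / a * N%:R]].
Proof.
move=> d0 a0 b1 /andP[del0 del1] aX.
have dR : (0 : R) < d%:R by rewrite ltr0n.
have X1 : 1 <= X by apply: le_trans aX; rewrite lerDr divr_ge0 ?mulr_ge0 // ltW.
have X0 : 0 < X by apply: lt_le_trans X1.
pose J := (Num.truncn (delta * X)).+1.
have J0 : (0 : R) < J%:R by rewrite ltr0n.
pose h := delta / J%:R.
have h0 : 0 < h by exact: divr_gt0.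
have hX : h * X <= 1.
  by rewrite /h mulrAC ler_pdivrMr // mul1r ltW // truncnS_gt.
have h1 : h <= 1 by apply: le_trans hX; rewrite ler_peMr // ltW.
have Jh : J%:R * h = delta by rewrite /h mulrC divfK // lt0r_neq0.
have ha : 4 * d%:R * h <= a.
  have h2 : h * (4 * d%:R / a) <= 1.
    by apply: le_trans hX; rewrite ler_wpM2l ?(ltW h0) //; move: aX; lra.
  move: h2; rewrite mulrA ler_pdivrMr // mul1r mulrC; lra.
pose p := (Num.truncn (b / h)).+1.
have b0 : 0 < b by lra.
have bh : 0 <= b / h by rewrite divr_ge0 ?(ltW b0) ?(ltW h0).
have p1 : b < p%:R * h by rewrite -ltr_pdivrMr // truncnS_gt.
have p2 : p%:R * h <= b + h.
  have : (Num.truncn (b / h))%:R * h <= b by rewrite -ler_pdivlMr // truncn_le.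
  by rewrite /p -natr1 mulrDl mul1r lerD2r.
pose q := a / (2 * d%:R * h).
have dh0 : 0 < 2 * d%:R * h by apply: mulr_gt0 => //; exact: mulr_gt0.
have q0 : 0 <= q by rewrite divr_ge0 ?(ltW a0) ?(ltW dh0).
pose N := Num.truncn q.
have q2 : 2 <= q by rewrite ler_pdivlMr //; move: ha; lra.
have Nq : N%:R <= q by rewrite truncn_le.
have qN : q < N%:R + 1 by rewrite natr1 truncnS_gt.
have N1 : 1 < N%:R :> R by move: q2 qN; lra.
exists h, J, (J + p)%N, N; split; split => //.
- by rewrite natrD addrAC subrr add0r.
- by rewrite natrD mulrDl Jh; lra.
- by rewrite natrD mulrDl Jh; lra.
- by rewrite -(ltr_nat R) (lt_trans _ N1).
- by move: Nq; rewrite ler_pdivlMr //; lra.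
- have Th : (J + p)%:R * h <= b + 2 by rewrite natrD mulrDl Jh; lra.
  have N2 : q <= 2 * N%:R by lra.
  have e : a = q * (2 * d%:R * h) by rewrite /q divfK // lt0r_neq0.
  rewrite -(ler_pM2r h0); apply: le_trans Th _.
  rewrite -[X in _ <= X]mulrA [X in _ <= X]mulrAC ler_pdivlMr // {1}e.
  have b2 : 0 <= b + 2 by lra.
  have := ler_wpM2r (ltW dh0) N2 => /(ler_wpM2l b2); lra.
Qed.

(* Only the weights of pairs at distance more than [r] enter, so that the
   rotated distances stay away from [0]. *)
Lemma body_hits_sqr_le (K : set 'cV[R]_d) (r0 R0 r h delta C : R) (M kap N' n nn : nat)
    (x : 'I_N' -> 'cV[R]_d) (w : 'I_N' -> R) (rho : 'M[R]_d) (l : nat) :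
  convex_body K -> origin_symmetric K -> 0 < r0 -> (forall x, enorm x <= r0 -> K x) ->
  0 < R0 -> (forall x, K x -> enorm x <= R0) ->
  M = (2 ^ n)%N -> (0 < kap)%N -> (0 < d)%N -> 0 < r -> 0 < h ->
  delta * (2 * R0) <= r -> 2 * d%:R * nn%:R * h <= r / R0 ->
  (delta * R0 + l%:R * h * (d%:R * (R0 + R0 ^+ 2 / r0) / (kap * M)%:R)) * M%:R <= 1 ->
  (forall i, 0 <= w i) -> SO rho ->
  \sum_(g : {ffun 'I_d -> 'I_M * 'I_M}) trig_energy w x (frequency g) * dyadic_weight n g <= C * M%:R ^+ d ->
  (\sum_(e | `|body_norm K (rho *m (x e.1 - x e.2)) - l%:R * h| <= delta)
     w e.1 * w e.2 * (r < enorm (x e.1 - x e.2))%R%:R) ^+ 2 <=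
  (if (d * nn <= l)%N then
    (4 / M%:R ^+ 2) ^+ (2 * d) * (C * M%:R ^+ d) * \sum_(g : {ffun 'I_d -> 'I_M * 'I_M})
     trig_energy w x (frequency g) / dyadic_weight n g * net_energy K (kap * M) (rho *m (l%:R * h *: frequency g))
   else 0).
Proof.
move=> bK sK r00 rK R00 KR ME kap0 d0 rp h0 delr nnr near w0 srho EC.
have M0 : (0 < M)%N by rewrite ME expn_gt0.
have MR : (0 : R) < M%:R by rewrite ltr0n.
have kM0 : (0 < kap * M)%N by rewrite muln_gt0 kap0.
pose z (e : 'I_N' * 'I_N') := rho *m (x e.1 - x e.2).
pose W (e : 'I_N' * 'I_N') := w e.1 * w e.2 * (r < enorm (x e.1 - x e.2))%R%:R.
have W0 e : 0 <= W e by rewrite /W !mulr_ge0.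
have tau_ge e : r < enorm (x e.1 - x e.2) -> r / R0 < body_norm K (z e).
  move=> re; rewrite ltr_pdivrMr // mulrC; apply: lt_le_trans re _.
  by rewrite -(SO_enorm (x e.1 - x e.2) srho); exact: enorm_le_body_norm.
have lh0 : 0 <= l%:R * h by rewrite mulr_ge0 // ltW.
(* For smaller [l] nothing is hit: l h and delta are each at most r / (2 R0), up to a strict
   inequality for l h, whereas the weighted distances exceed r / R0. *)
case: ifPn => [ln|]; last first.
  rewrite -ltnNge => ln.
  rewrite big1 ?expr0n // => e he; apply/eqP; rewrite mulf_eq0; apply/orP; right.
  rewrite pnatr_eq0 eqb0; apply/negP => /tau_ge te.
  have l1 : l%:R + 1 <= d%:R * nn%:R :> R by rewrite natr1 -natrM ler_nat.
  have l2 : l%:R * h < d%:R * nn%:R * h by rewrite ltr_pM2r //; lra.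
  move: he; rewrite -/(z e) ler_norml => /andP[_ he].
  have dr : delta <= r / R0 / 2.
    by rewrite ler_pdivlMr // ler_pdivlMr //; move: delr; lra.
  by move: te nnr he; lra.
pose c (m : {ffun 'I_d -> 'I_(2 * (kap * M)).+1}) : R := net_weight m.
(* The rotation is moved from the points of the set to the net, so that the energy of the weights
   does not depend on it. *)
pose Y (m : {ffun 'I_d -> 'I_(2 * (kap * M)).+1}) := rho^T *m (l%:R * h *: net_pt K m).
pose S (g : {ffun 'I_d -> 'I_M * 'I_M}) := \sum_m c m * cos (dot (frequency g) (Y m)).
have hit : \sum_(e | `|body_norm K (z e) - l%:R * h| <= delta) W e <=
    (4 / M%:R ^+ 2) ^+ d * \sum_(g : {ffun 'I_d -> 'I_M * 'I_M}) trig_energy w x (frequency g) * S g.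
  apply: pair_hits_le => //.
    by move=> e; rewrite /W ler_piMr ?mulr_ge0 // lern1 leq_b1.
  move=> e he; rewrite /W; case: (boolP (r < _)) => [re _|_]; last by rewrite mulr0 ltxx.
  have tau0 : 0 < body_norm K (z e) by apply: lt_trans (tau_ge e re); exact: divr_gt0.
  have [m cm hm] := net_hit bK sK r00 rK R00 KR kM0 tau0 lh0 he.
  exists m => // a; apply: le_trans near; rewrite mulrC ler_wpM2r //.
  apply: le_trans (coord_le_enorm _ a) _; apply: le_trans hm.
  have -> : x e.1 - x e.2 - Y m = rho^T *m (z e - l%:R * h *: net_pt K m).
    by rewrite mulmxBr /z mulmxA (proj1 srho) mul1mx.
  by rewrite SO_enorm //; exact: SO_tr.
set k := (4 / M%:R ^+ 2) ^+ d in hit *.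
have k0 : 0 <= k by rewrite exprn_ge0 // divr_ge0 // sqr_ge0.
have nu0 : 0 <= \sum_(e | `|body_norm K (z e) - l%:R * h| <= delta) W e by apply: sumr_ge0.
set V := \sum_(g : {ffun 'I_d -> 'I_M * 'I_M}) trig_energy w x (frequency g) * S g in hit.
apply: (@le_trans _ _ ((k * V) ^+ 2)).
  by rewrite ler_sqr ?nnegrE // (le_trans nu0).
rewrite exprMn mulnC exprM -/k -mulrA ler_wpM2l ?sqr_ge0 //.
have Wg (g : {ffun 'I_d -> 'I_M * 'I_M}) : 0 < dyadic_weight n g :> R.
  by subst M; have [] := @dyadic_weight_lower R d n g.
apply: le_trans (energy_cauchy_schwarz _ _ Wg) _ => [g|]; first exact: trig_energy_ge0.
have t0 (g : {ffun 'I_d -> 'I_M * 'I_M}) : 0 <= trig_energy w x (frequency g) / dyadic_weight n g.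
  by rewrite divr_ge0 ?trig_energy_ge0 // ltW.
apply: ler_pM => //.
- by apply: sumr_ge0 => g _; rewrite mulr_ge0 ?trig_energy_ge0 // ltW.
- by apply: sumr_ge0 => g _; rewrite mulr_ge0 ?sqr_ge0.
apply: ler_sum => g _; rewrite ler_wpM2l //.
(* [S g] is the cosine part of the net's transform at the rotated frequency, so its square is at
   most [net_energy]. *)
have -> : S g = \sum_m c m * cos (dot (rho *m (l%:R * h *: frequency g)) (net_pt K m)).
  apply: eq_bigr => m _; congr (_ * cos _).
  by rewrite /Y dot_mulmx dotZl -scalemxAr dotZr.
by rewrite lerDl sqr_ge0.
Qed.


Variable mu : probability mxT R.
Hypothesis haar_mu : is_haar_SO mu.
Hypothesis d2 : (2 <= d)%N.

(** The second moments are dominated, for each rotation, by a fixed combination of net energies,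
    with the energy of [E] already split off. Averaging then needs only the mean of each net energy,
    and all powers of the scale [M] cancel. *)
Theorem ae_body_distance (E K : set 'cV[R]_d) :
  compact E -> E `<=` unit_cube -> convex_body K -> origin_symmetric K ->
  (((d%:R + 1) / 2)%:E < hausdorff_dim E)%E ->
  {ae mu, forall rho : mxT, SO rho -> (0 < lebesgue_measure (distance_set K (rotate rho E)))%E}.
Proof.
move=> cE Ecube bK sK /real_between[s s1 sdim].
have d0 : (0 < d)%N by exact: ltnW.
have dR : (0 : R) < d%:R by rewrite ltr0n.
have s0 : 0 < s by apply: lt_trans s1; rewrite divr_gt0 // addr_gt0.
have [C C0 frost] := frostman cE s0 sdim.
have [C2 C20 HE] := @dyadic_energy_le R d C s d0 C0 s1.
have [r0 r00 rK] := convex_body_ball bK sK.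
have [R0 R00 KR] := convex_body_bounded bK.
(* Solves C (2 r1)^s = 1/2, so that at least half of the pair mass is separated by r1. *)
pose r1 : R := ((2 * C)^-1) `^ s^-1 / 2.
have C20' : 0 < (2 * C)^-1 by rewrite invr_gt0 mulr_gt0.
have r10 : 0 < r1 by rewrite divr_gt0 // powR_gt0.
have Cr1 : C * (2 * r1) `^ s <= 2^-1.
  rewrite /r1 mulrC -[2 * _]mulrC divfK // -powRrM mulVf ?lt0r_neq0 // powRr1 ?(ltW C20') //.
  by rewrite invfM mulfVK ?lt0r_neq0.
clearbody r1; have [n0 hn0] := exists_half_pow_le r10.
pose a := r1 / R0; pose b := d%:R / r0 + 1; pose D0 := d%:R * (R0 + R0 ^+ 2 / r0).
have a0 : 0 < a by exact: divr_gt0.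
have b1 : 1 <= b by rewrite lerDr divr_ge0 // ltW.
have D00 : 0 <= D0 by rewrite mulr_ge0 ?addr_ge0 ?divr_ge0 ?sqr_ge0 // ltW.
have [aE bE D0E] : [/\ a = r1 / R0, b = d%:R / r0 + 1 & D0 = d%:R * (R0 + R0 ^+ 2 / r0)] by [].
clearbody a b D0.
have b20 : 0 <= b + 2 by rewrite addr_ge0 // (le_trans _ b1).
(* The net is finer than 1 / M by this factor: the first summand makes delta small against r1, the
   others put a dilated net point within 1 / M of every hit. *)
pose kap := (Num.truncn (2 * R0 / r1 + (R0 + (b + 2) * D0))).+1.
have [kap1 kap2] : 2 * R0 / r1 <= kap%:R /\ R0 + (b + 2) * D0 <= kap%:R.
  have h1 : 0 <= 2 * R0 / r1 by rewrite divr_ge0 ?mulr_ge0 // ltW.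
  have h2 : 0 <= R0 + (b + 2) * D0 by rewrite addr_ge0 ?(ltW R00) // mulr_ge0.
  have h3 := ltW (truncnS_gt (2 * R0 / r1 + (R0 + (b + 2) * D0))).
  by split; apply: le_trans h3; rewrite ?lerDl ?lerDr.
pose tau := 4 * d%:R * (b + 2) / a.
have tau0 : 0 <= tau by rewrite divr_ge0 ?(ltW a0) // mulr_ge0 ?mulr_ge0 ?(ltW dR).
have [c3 c30 Hmean] := exists_net_mean_bound bK sK r00 rK R00 KR d2 haar_mu tau0.
apply: (@ae_positive_distance _ _ mu K E (16 ^+ d * C2 ^+ 2 * c3 * (kap%:R ^+ d) ^+ 2 * (b + 2))) => // n.
(* The shift by [n0] makes the scale smaller than r1 as well as 2^-n. *)
pose n' := (n + n0)%N; pose M := (2 ^ n')%N.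
have [N' [x [w [xE w0 w1 wF]]]] := frost n'.
have Fw : frostman_weights C s n' x w by split.
have M0 : (0 < M)%N by rewrite expn_gt0.
have MR : (0 : R) < M%:R by rewrite ltr0n.
have kR : (0 : R) < kap%:R by rewrite ltr0n.
have kM0 : (0 < kap * M)%N by rewrite muln_gt0.
have kMR : (0 : R) < (kap * M)%:R by rewrite ltr0n.
pose delta : R := (kap * M)%:R^-1.
have del0 : 0 < delta by rewrite invr_gt0.
have delM : delta <= 2^-1 ^+ n'.
  by rewrite exprVn -natrX lef_pV2 ?posrE // ler_nat leq_pmull.
have h2n m : (2^-1 : R) ^+ m <= 1 by rewrite exprn_ile1 // ?invr_ge0 // invf_le1 ?ler1n.
have del01 : 0 < delta <= 1 by rewrite del0 (le_trans delM).
(* Collects the upper bounds on h: those of the grid and those of the mean estimate for frequencies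
   up to d kap M. *)
pose X := 4 * d%:R / a + 1 + ((d%:R * (kap * M)%:R) ^+ d + d%:R * (kap * M)%:R * (2 * R0)).
have X1 : 0 <= (d%:R * (kap * M)%:R) ^+ d :> R by rewrite exprn_ge0 // mulr_ge0.
have X2 : 0 <= d%:R * (kap * M)%:R * (2 * R0) by rewrite !mulr_ge0 // ltW.
have X3 : 0 <= 4 * d%:R / a by rewrite divr_ge0 ?mulr_ge0 // ltW.
have aX : 4 * d%:R / a + 1 <= X by rewrite lerDl addr_ge0.
have [h [J [T [N [[h0 J0 Jh hX] [bT Tb T1] [N0 Na TN]]]]]] := grid_parameters d0 a0 b1 del01 aX.
have T0 : (0 < T)%N by rewrite lt0n; apply: contraTneq T1 => ->; rewrite mul0r ler10.
pose A g := trig_energy w x (frequency (g : {ffun 'I_d -> 'I_M * 'I_M})).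
pose W g : R := dyadic_weight n' (g : {ffun 'I_d -> 'I_M * 'I_M}).
have A0 g : 0 <= A g by exact: trig_energy_ge0.
have W0 g : 0 < W g by have [] := @dyadic_weight_lower R d n' g.
have EC : \sum_g A g * W g <= C2 * M%:R ^+ d.
  by apply: HE => // i; exact: Ecube.
pose k2 : R := (4 / M%:R ^+ 2) ^+ (2 * d) * (C2 * M%:R ^+ d).
have k20 : 0 <= k2 by rewrite mulr_ge0 ?mulr_ge0 ?(ltW C20) // exprn_ge0 // divr_ge0 // sqr_ge0.
pose coef g : R := k2 * h / delta ^+ 2 * (A g / W g).
have coef0 g : 0 <= coef g.
  by rewrite mulr_ge0 ?divr_ge0 ?mulr_ge0 ?sqr_ge0 ?(ltW h0) // ltW.
pose f g (rho : 'M[R]_d) : R := \sum_(l < T | (d * N <= l)%N)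
  net_energy K (kap * M) (rho *m (l%:R * h *: frequency (g : {ffun 'I_d -> 'I_M * 'I_M}))).
have f0 g rho : 0 <= f g rho by apply: sumr_ge0 => l _; exact: trig_energy_ge0.
have mf g : measurable_fun setT (f g : mxT -> R).
  by apply: measurable_sum_cond => l; exact: measurable_rot_energy.
exists (fun rho => \sum_g coef g * f g rho); split.
- by apply: measurable_sum => g; exact: measurable_funM.
- by move=> rho; apply: sumr_ge0 => g _; exact: mulr_ge0.
- have hb g : (rot_mean mu (f g) <= (T%:R * ((kap * M)%:R ^+ d.-1) ^+ 2 * c3 * W g ^+ 2)%:E)%E.
    apply: Hmean => //; first by rewrite leq_pmull.
      apply: le_trans hX; rewrite ler_wpM2l ?(ltW h0) // /X; lra.
    apply: le_trans hX; rewrite -mulrA ler_wpM2l ?(ltW h0) // /X; lra.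
  apply: le_trans (rot_mean_comb_le coef0 mf f0 hb) _.
  rewrite lee_fin.
  (* The mean contributes W^2 against the 1 / W of Cauchy-Schwarz, so the energy with weight W
     appears a second time. *)
  have -> : \sum_g coef g * (T%:R * ((kap * M)%:R ^+ d.-1) ^+ 2 * c3 * W g ^+ 2) =
      k2 * h / delta ^+ 2 * (T%:R * ((kap * M)%:R ^+ d.-1) ^+ 2 * c3) * \sum_g A g * W g.
    rewrite mulr_sumr; apply: eq_bigr => g _; rewrite /coef.
    have := W0 g; move: (W g) (A g) => u v u0; field.
    by rewrite !lt0r_neq0.
  have kd0 : 0 <= k2 * h / delta ^+ 2 * (T%:R * ((kap * M)%:R ^+ d.-1) ^+ 2 * c3).
    by rewrite !mulr_ge0 ?invr_ge0 ?sqr_ge0 // ltW.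
  apply: le_trans (ler_wpM2l kd0 EC) _.
  have e1 : (kap * M)%:R ^+ 2 * ((kap * M)%:R ^+ d.-1) ^+ 2 = (kap%:R ^+ d) ^+ 2 * (M%:R ^+ d) ^+ 2 :> R.
    by rewrite -exprMn -exprS prednK // natrM exprMn exprMn.
  have e2 : (4 / M%:R ^+ 2) ^+ (2 * d) = 16 ^+ d / ((M%:R ^+ d) ^+ 2) ^+ 2 :> R.
    rewrite exprM expr_div_n exprMn exprVn -!exprM; congr (_ * _).
      by rewrite exprM; congr (_ ^+ d); ring.
    by rewrite mulnA [(d * _)%N]mulnC.
  (* In powers of M: -4 d from the kernels, d from each of the two energies, 2 d from delta and the
     net masses, total 0. *)
  have -> : k2 * h / delta ^+ 2 * (T%:R * ((kap * M)%:R ^+ d.-1) ^+ 2 * c3) * (C2 * M%:R ^+ d) =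
      16 ^+ d * C2 ^+ 2 * c3 * (kap%:R ^+ d) ^+ 2 * (T%:R * h).
    rewrite /k2 /delta exprVn invrK e2.
    have Md : M%:R ^+ d != 0 :> R by rewrite expf_neq0 // lt0r_neq0.
    transitivity (16 ^+ d / ((M%:R ^+ d) ^+ 2) ^+ 2 * (C2 * M%:R ^+ d) * h *
       ((kap * M)%:R ^+ 2 * ((kap * M)%:R ^+ d.-1) ^+ 2) * T%:R * c3 * (C2 * M%:R ^+ d)); first by ring.
    rewrite e1; move: (16 ^+ d) (M%:R ^+ d) (kap%:R ^+ d) Md => p q t q0.
    by field.
  by rewrite ler_wpM2l // !mulr_ge0 ?sqr_ge0 ?exprn_ge0 // ?ltW.
move=> rho srho.
exists N', x, (fun e => w e.1 * w e.2 * (r1 < enorm (x e.1 - x e.2))%R%:R), h, J, T; split.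
- split => //; first by move=> e; rewrite !mulr_ge0.
  apply: (separated_pairs_mass Fw) Cr1; apply: le_trans hn0.
  by rewrite ler_wiXn2l ?invr_ge0 ?invf_le1 ?ler1n // leq_addl.
- split => //; rewrite Jh; apply: le_trans delM _.
  by rewrite ler_wiXn2l ?invr_ge0 ?invf_le1 ?ler1n // leq_addr.
- move=> e; rewrite body_norm_ge0 //=; apply: le_lt_trans bT.
  apply: le_trans (body_norm_le_enorm _ r00 rK) _; rewrite SO_enorm //.
  apply: (@le_trans _ _ (d%:R / r0)); last by rewrite bE lerDl.
  rewrite ler_pM2r ?invr_gt0 // -[leRHS]mulr1.
  by apply: enorm_le_coord => // i; apply: unit_cube_dist; exact: Ecube.
rewrite Jh.
have delr : delta * (2 * R0) <= r1.
  rewrite /delta mulrC ler_pdivrMr //; move: kap1; rewrite ler_pdivrMr // mulrC => h1.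
  by apply: le_trans h1 _; rewrite [leLHS]mulrC ler_wpM2l ?(ltW r10) // ler_nat leq_pmulr.
have near l : (l < T)%N -> (delta * R0 + l%:R * h * (d%:R * (R0 + R0 ^+ 2 / r0) / (kap * M)%:R)) * M%:R <= 1.
  move=> lT; rewrite -D0E.
  have lh : l%:R * h <= b + 2.
    by apply: le_trans Tb; rewrite ler_wpM2r ?(ltW h0) // ler_nat ltnW.
  have -> : (delta * R0 + l%:R * h * (D0 / (kap * M)%:R)) * M%:R = (R0 + l%:R * h * D0) / kap%:R.
    by rewrite /delta natrM; field; rewrite !lt0r_neq0.
  rewrite ler_pdivrMr // mul1r; apply: le_trans kap2; rewrite lerD2l.
  exact: ler_wpM2r.
apply: (@le_trans _ _ (h * \sum_(l < T) (if (d * N <= l)%N then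
    k2 * \sum_g A g / W g * net_energy K (kap * M) (rho *m (l%:R * h *: frequency g)) else 0))).
  rewrite ler_wpM2l ?(ltW h0) //; apply: ler_sum => l _.
  apply: (@body_hits_sqr_le K r0 R0 r1 h delta C2 M kap N' n' N x w rho l) => //.
    by rewrite -aE.
  exact: near.
rewrite -big_mkcond /= -mulr_sumr exchange_big /= mulrA !mulr_sumr mulr_suml.
apply: ler_sum => g _; rewrite -mulr_sumr -/(f g rho) /coef le_eqVlt; apply/orP; left; apply/eqP.
have := W0 g; move: (f g rho) (A g) (W g) => u v t t0.
by field; rewrite !lt0r_neq0.
Qed.

End FinalAssembly.

Unset Implicit Arguments.

Theorem corollary0p3 (R : realType) (d : nat) (hd : (2 <= d)%N) :
  (* (i) *)
  ((forall E K : set 'cV[R]_d,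
      compact E -> E `<=` unit_cube ->
      convex_body K -> polyhedron K -> origin_symmetric K ->
      (1 < hausdorff_dim E)%E ->
      almost_every_rotation (fun rho : 'M[R]_d =>
        (0 < lebesgue_measure (distance_set K (rotate rho E)))%E))
   /\
   (forall alpha : R, 0 <= alpha < 1 ->
      exists E : set 'cV[R]_d,
        [/\ compact E, E `<=` unit_cube, hausdorff_dim E = alpha%:E &
            forall K : set 'cV[R]_d, convex_body K -> origin_symmetric K ->
              lebesgue_measure (distance_set K E) = 0%E]))
  /\
  (* (ii) *)
  (forall E K : set 'cV[R]_d,
     compact E -> E `<=` unit_cube ->
     convex_body K -> origin_symmetric K ->
     (((d%:R + 1) / 2)%:E < hausdorff_dim E)%E ->
     almost_every_rotation (fun rho : 'M[R]_d =>
       (0 < lebesgue_measure (distance_set K (rotate rho E)))%E))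
  /\
  (* (iii) *)
  (forall (E K : set 'cV[R]_d) (E0 : set R),
     E0 `<=` `[0, 1] ->
     E = [set r *: w | r in E0 & w in unit_sphere] ->
     compact E ->
     (((d%:R + 1) / 2)%:E < hausdorff_dim E)%E ->
     convex_body K -> origin_symmetric K ->
     (0 < lebesgue_measure (distance_set K E))%E).
Proof.
split; [split|split].
- by move=> E K cE Ec bK pK sK dE mu haar_mu; exact: (ae_polyhedral_distance haar_mu hd).
- by move=> alpha; exact: exists_null_distance_set.
- by move=> E K cE Ec bK sK dE mu haar_mu; exact: (ae_body_distance haar_mu hd).
- by move=> E K E0 E01 EE cE dE bK sK; exact: (@radial_distance_pos _ _ E K E0).
Qed.
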